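(* Let $m\ge 0$ be an integer and let $F\in\mathcal{S}(\mathbb{R}^3,\mathrm{End}(V_{\tau_m}))$ satisfy $F(k\cdot x)=\tau_m(k)F(x)\tau_m(k)^{-1}$ for all $k\in SO(3)$, $x\in\mathbb{R}^3$. Then $F$ can be written as $$F(x)=\sum_{k=0}^{2m}g_k(x)Q_k(x)$$ for some infinitely differentiable scalar functions $g_k$ on $\mathbb{R}^3$.
   Context: $H_m$ is the complex space of harmonic homogeneous polynomials of degree $m$ on $\mathbb{R}^3$ (dimension $2m+1$); $V_{\tau_m}=H_m$ and $(\tau_m(k)p)(x)=p(k^{-1}\cdot x)$ for $k\in SO(3)$. $d\tau_m$ is the derived representation of $so(3)$. Let $Y_1=\begin{pmatrix}0&0&0\\0&0&1\\0&-1&0\end{pmatrix}$, $Y_2=\begin{pmatrix}0&0&-1\\0&0&0\\1&0&0\end{pmatrix}$, $Y_3=\begin{pmatrix}0&1&0\\-1&0&0\\0&0&0\end{pmatrix}$, and for $x\in\mathbb{R}^3$ put $d\tau_m(x):=\sum_{i=1}^3x_i\,d\tau_m(Y_i)$. $\mathcal{S}(\mathbb{R}^3,\mathrm{End}(V_{\tau_m}))$ is the space of $\mathrm{End}(V_{\tau_m})$-valued functions all of whose matrix entries are (complex) Schwartz functions on $\mathbb{R}^3$. $D_\tau F:=\sum_{i=1}^3 d\tau_m(Y_i)\frac{\partial F}{\partial x_i}$ for smooth $\mathrm{End}(V_{\tau_m})$-valued $F$. The matrix polynomials $Q_j$ are: $Q_0=I$, $Q_1(x)=d\tau_m(x)$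 and, for $1\le j<2m$, $Q_{j+1}(x)=Q_1(x)Q_j(x)-\frac{|x|^2}{2j+1}(D_\tau Q_j)(x)$. (For each $0\le j\le 2m$, $Q_j$ spans the one-dimensional space of $\mathrm{End}(V_{\tau_m})$-valued polynomials $P$ whose entries are harmonic and homogeneous of degree $j$ and which satisfy $P(k\cdot x)=\tau_m(k)P(x)\tau_m(k)^{-1}$ for all $k\in SO(3)$.) For $m=0$ only $Q_0$ occurs. *)

(* Defs.v *)
(* MathComp and MathComp-Analysis over an arbitrary [R : realType]; the complex
   numbers are [R[i]] and R^3 is ['cV[R]_3]. *)
From HB Require Import structures.
From mathcomp Require Import all_boot all_order all_algebra.
From mathcomp Require Import complex.
From mathcomp Require mpoly.
Set Implicit Arguments.
Unset Strict Implicit.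
Unset Printing Implicit Defensive.
Import Order.TTheory GRing.Theory Num.Theory.
Local Open Scope ring_scope.

(* The notations of mpoly clash with those of MathComp-Analysis: the polynomial
   part comes first, in a module of its own. *)
Module HarmonicPoly.
Import mpoly.
Section HarmonicPoly.
Context {R : rcfType}.
Local Notation C := R[i].

Definition SO3 (k : 'M[R]_3) : Prop := k^T *m k = 1%:M /\ \det k = 1.

Definition laplacian (p : {mpoly C[3]}) : {mpoly C[3]} := \sum_i p^`M(i)^`M(i).

Definition rotpoly (k : 'M[R]_3) (p : {mpoly C[3]}) : {mpoly C[3]} :=
  p \mPo [tuple \sum_j ((invmx k) i j)%:C%C *: 'X_j | i < 3].

(* [indhomog d p] is [p] as a homogeneous polynomial of degree [d]; see
   [homog_laplacian] and [homog_rotpoly] for its two uses.  The truncated [m - 2]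
   is harmless: the Laplacian is zero for [m < 2]. *)
Definition laph m (p : dhomog 3 C m) : dhomog 3 C (m - 2) :=
  indhomog (m - 2) (laplacian p).

Lemma homog_mderiv d (p : {mpoly C[3]}) i :
  p \is d.-homog -> p^`M(i) \is d.-1.-homog.
Proof.
move=> /dhomogP hp; rewrite /mderiv big_seq rpred_sum // => u /hp du.
have [u0|u0] := eqVneq (u i) 0%N; first by rewrite u0 mul0r scale0r rpred0.
apply: rpredZ; rewrite dhomogX; apply/eqP.
have h : (U_(i) <= u)%MM.
  apply/mnm_lepP => j; rewrite mnm1E; case: eqP => // <-; by rewrite lt0n.
have := mdegD (u - U_(i))%MM U_(i)%MM; rewrite submK // mdeg1 => e.
by have /= := du; rewrite e => <-; rewrite addn1.
Qed.

Lemma homog_laplacian m (p : dhomog 3 C m) : laplacian p \is (m - 2).-homog.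
Proof.
rewrite subn2; apply: rpred_sum => i _; do 2! apply: homog_mderiv.
exact: dhomog_is_dhomog.
Qed.

Lemma indhomogK d (p : {mpoly C[3]}) :
  p \is d.-homog -> indhomog d p = p :> {mpoly C[3]}.
Proof. by move=> hp; rewrite /indhomog insubdK. Qed.

Fact laph_linear m : linear (@laph m).
Proof.
move=> a p q; apply: val_inj.
rewrite [LHS]indhomogK ?homog_laplacian //.
transitivity (a *: laplacian p + laplacian q); last first.
  by congr (_ *: _ + _); rewrite [RHS]indhomogK ?homog_laplacian.
rewrite /laplacian scaler_sumr -big_split /=; apply: eq_bigr => i _.
by rewrite !(mderivD, mderivZ).
Qed.
HB.instance Definition _ m :=
  GRing.isLinear.Build C (dhomog 3 C m) (dhomog 3 C (m - 2)) _ (@laph m)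
    (@laph_linear m).

Definition harm m : {vspace dhomog 3 C m} := lker (linfun (@laph m)).

Lemma mem_harm m (p : dhomog 3 C m) : (p \in harm m) = (laplacian p == 0).
Proof.
by rewrite memv_ker lfunE /= -val_eqE /= indhomogK ?homog_laplacian.
Qed.

Lemma homog_rotpoly d k (p : {mpoly C[3]}) :
  p \is d.-homog -> rotpoly k p \is d.-homog.
Proof.
move=> /dhomogP hp; rewrite /rotpoly comp_mpolyEX big_seq.
apply: rpred_sum => u /hp du; apply: rpredZ.
rewrite comp_mpolyX; move: du => /= <-; rewrite mdegE.
apply: (big_ind2 (fun (x : {mpoly C[3]}) e => x \is e.-homog)).
- exact: dhomog1.
- by move=> p1 d1 p2 d2; apply: dhomogM.
move=> i _; rewrite -[X in X.-homog]mul1n; apply: dhomogMn.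
rewrite tnth_mktuple; apply: rpred_sum => j _; apply: rpredZ.
by rewrite dhomogX /= mdeg1.
Qed.

Lemma sum_leibniz (A : comNzRingType) (f d : A -> A) (e : 'I_3 -> A -> A)
    (y : 'I_3 -> A) (q r : A) :
  f (q * r) = f q * f r ->
  d (f q * f r) = d (f q) * f r + f q * d (f r) ->
  (forall j, f (e j (q * r)) = f (e j q) * f r + f q * f (e j r)) ->
  d (f q) = \sum_j f (e j q) * y j -> d (f r) = \sum_j f (e j r) * y j ->
  d (f (q * r)) = \sum_j f (e j (q * r)) * y j.
Proof.
move=> -> -> H -> ->; rewrite mulr_suml mulr_sumr -big_split.
apply: eq_bigr => j _ /=; rewrite H mulrDl.
by congr (_ + _); [rewrite mulrAC | rewrite mulrA].
Qed.

Lemma subUU (i : 'I_3) : (U_(i) - U_(i))%MM = 0%MM :> 'X_{1..3}.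
Proof. by apply/mnmP => l; rewrite mnmBE mnm0E subnn. Qed.

Lemma mderiv_comp (t : 3.-tuple {mpoly C[3]}) (p : {mpoly C[3]}) i :
  (p \mPo t)^`M(i) = \sum_j (p^`M(j) \mPo t) * (tnth t j)^`M(i).
Proof.
pose D (q : {mpoly C[3]}) :=
  \sum_j (q^`M(j) \mPo t) * (tnth t j)^`M(i).
have D1 : D 1 = 0.
  by rewrite /D big1 // => j _; rewrite -mpolyC1 mderivC raddf0 mul0r.
have D1' : (1 \mPo t)^`M(i) = 0 by rewrite comp_mpoly1 -mpolyC1 mderivC.
have MM (q r : {mpoly C[3]}) : (q * r) \mPo t = (q \mPo t) * (r \mPo t).
  exact: (rmorphM (comp_mpoly t)).
have DM q r : (q \mPo t)^`M(i) = D q -> (r \mPo t)^`M(i) = D r ->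
    ((q * r) \mPo t)^`M(i) = D (q * r).
  apply: sum_leibniz; [exact: MM | exact: mderivM |] => j.
  by rewrite mderivM comp_mpolyD !MM.
have DX j : ('X_j \mPo t)^`M(i) = D 'X_j.
  rewrite comp_mpolyXU -tnth_nth /D (bigD1 j) //= mderivX mnm1E eqxx scale1r.
  rewrite subUU mpolyX0 comp_mpoly1 mul1r big1 ?addr0 // => l nlj.
  by rewrite mderivX mnm1E eq_sym (negbTE nlj) scale0r raddf0 mul0r.
rewrite -/(D p); elim/mpolyind: p => [|c u p _ _ ih].
  by rewrite raddf0 mderiv0 /D big1 // => j _; rewrite mderiv0 raddf0 mul0r.
have -> : D (c *: 'X_[u] + p) = c *: D 'X_[u] + D p.
  rewrite /D scaler_sumr -big_split; apply: eq_bigr => j _.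
  by rewrite !linearP mulrDl scalerAl.
rewrite comp_mpolyD comp_mpolyZ mderivD mderivZ.
apply: (f_equal2 +%R) ih; apply: (f_equal (fun z => c *: z)).
rewrite mpolyXE_id.
apply: (big_ind (fun q => (q \mPo t)^`M(i) = D q)) => [|q r|j _].
- by rewrite D1'.
- exact: DM.
- elim: (u j) => [|n ihn]; first by rewrite expr0 D1'.
  rewrite exprS; exact: (DM _ _ (DX j) ihn).
Qed.

Lemma sum_orth (V : lmodType C) (r : 'I_3 -> 'I_3 -> V) (k : 'M[R]_3) :
  k^T *m k = 1%:M ->
  \sum_i \sum_j \sum_l ((k i j)%:C%C * (k i l)%:C%C) *: r j l = \sum_j r j j.
Proof.
move=> kk; rewrite exchange_big /=; apply: eq_bigr => j _.
rewrite exchange_big /= (bigD1 j) //= -scaler_suml.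
have O (l : 'I_3) : \sum_i (k i j)%:C%C * (k i l)%:C%C = (j == l)%:R :> C.
  have /matrixP/(_ j l) := kk; rewrite !mxE => /(congr1 (real_complex R)).
  rewrite rmorph_nat => <-; rewrite rmorph_sum; apply: eq_bigr => i _ /=.
  by rewrite mxE rmorphM.
rewrite O eqxx scale1r big1 ?addr0 // => l nl.
by rewrite -scaler_suml O eq_sym (negbTE nl) scale0r.
Qed.

Lemma laplacian_rotpoly k (p : {mpoly C[3]}) : SO3 k ->
  laplacian (rotpoly k p) = rotpoly k (laplacian p).
Proof.
move=> [kk _].
have ku : invmx k = k^T.
  have hu : k \in unitmx by apply: (proj2 (mulmx1_unit kk)).
  by rewrite -[invmx k]mul1mx -kk -mulmxA mulmxV // mulmx1.
have D (i : 'I_3) (q : {mpoly C[3]}) : (rotpoly k q)^`M(i) =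
    \sum_j (k i j)%:C%C *: rotpoly k q^`M(j).
  rewrite /rotpoly mderiv_comp; apply: eq_bigr => j _.
  rewrite tnth_mktuple (raddf_sum (mderiv i)) (bigD1 i) //=.
  rewrite mderivZ mderivX mnm1E eqxx scale1r subUU mpolyX0 big1 ?addr0; last first.
    by move=> l nl; rewrite mderivZ mderivX mnm1E (negbTE nl) scale0r scaler0.
  by rewrite -scalerAr mulr1 ku mxE.
rewrite {1}/laplacian.
have E i : (rotpoly k p)^`M(i)^`M(i) = \sum_j \sum_l
    ((k i j)%:C%C * (k i l)%:C%C) *: rotpoly k p^`M(j)^`M(l).
  rewrite D linear_sum; apply: eq_bigr => j _; rewrite linearZ /= D scaler_sumr.
  by apply: eq_bigr => l _; rewrite scalerA.
rewrite (eq_bigr _ (fun i _ => E i)) (sum_orth _ kk).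
by rewrite /laplacian /rotpoly [RHS]raddf_sum.
Qed.

Definition roth m (k : 'M[R]_3) (p : dhomog 3 C m) : dhomog 3 C m :=
  indhomog m (rotpoly k p).

Lemma rothE m (k : 'M[R]_3) (p : dhomog 3 C m) :
  roth k p = rotpoly k p :> {mpoly C[3]}.
Proof. by apply/indhomogK/homog_rotpoly/dhomog_is_dhomog. Qed.

Fact roth_linear m (k : 'M[R]_3) : linear (@roth m k).
Proof.
move=> a p q; apply: val_inj; rewrite [LHS]rothE.
transitivity (a *: rotpoly k p + rotpoly k q).
  by rewrite /rotpoly comp_mpolyD comp_mpolyZ.
apply: (f_equal2 +%R); last by rewrite [RHS]rothE.
by apply: (f_equal ( *:%R a)); rewrite [RHS]rothE.
Qed.
HB.instance Definition _ m k :=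
  GRing.isLinear.Build C (dhomog 3 C m) (dhomog 3 C m) _ (@roth m k)
    (@roth_linear m k).

(* Off SO(3), where [roth k] need not preserve [harm m], [tau m k] is the
   compression of [roth k] to [harm m]. *)
Definition tau m (k : 'M[R]_3) : 'End(subvs_of (harm m)) :=
  linfun (vsproj (harm m) \o roth k \o vsval).

Lemma roth_harm m (k : 'M[R]_3) (p : dhomog 3 C m) : SO3 k ->
  p \in harm m -> roth k p \in harm m.
Proof.
move=> hk; rewrite !mem_harm => /eqP hp; apply/eqP.
by rewrite rothE laplacian_rotpoly // hp /rotpoly comp_mpoly0.
Qed.

Lemma tauE m (k : 'M[R]_3) (p : subvs_of (harm m)) : SO3 k ->
  vsval (tau m k p) = rotpoly k (vsval p) :> {mpoly C[3]}.
Proof.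
move=> hk; rewrite /tau lfunE /= vsprojK ?rothE //.
by apply/roth_harm/subvsP.
Qed.
End HarmonicPoly.
End HarmonicPoly.
Export HarmonicPoly.

From mathcomp Require Import all_classical all_reals all_analysis.
Import numFieldNormedType.Exports.

Section Derivatives.
Context {R : realType} {U : normedModType R}.

Definition cderive (f : U -> R[i]) (v x : U) : R[i] :=
  Complex ('D_v (fun y => complex.Re (f y)) x) ('D_v (fun y => complex.Im (f y)) x).

(* Derivative of a function with values in a finite-dimensional complex space,
   computed in coordinates; the result does not depend on the basis when the
   coordinates are differentiable. *)
Definition vderive (W : vectType R[i]) (f : U -> W) (v x : U) : W :=
  \sum_i cderive (fun y => coord (vbasis {:W}) i (f y)) v x *: (vbasis {:W})`_i.

End Derivatives.

Section Functions.
Context {R : realType}.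
Local Notation R3 := 'cV[R]_3.

Definition evec (i : 'I_3) : R3 := delta_mx i 0.

Definition iter_partial (s : seq 'I_3) (f : R3 -> R) : R3 -> R :=
  foldr (fun i g => fun x => 'D_(evec i) g x) f s.

Definition smooth (f : R3 -> R) : Prop :=
  forall (s : seq 'I_3) (x : R3), differentiable (iter_partial s f) x.

Definition schwartz (f : R3 -> R) : Prop :=
  smooth f /\
  forall (a : 'I_3 -> nat) (s : seq 'I_3), exists M : R, forall x : R3,
    `|(\prod_i x i 0 ^+ a i) * iter_partial s f x| <= M.

Definition csmooth (f : R3 -> R[i]) : Prop :=
  smooth (fun x => complex.Re (f x)) /\ smooth (fun x => complex.Im (f x)).

Definition cschwartz (f : R3 -> R[i]) : Prop :=
  schwartz (fun x => complex.Re (f x)) /\ schwartz (fun x => complex.Im (f x)).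

Definition schwartzEnd (V : vectType R[i]) (F : R3 -> 'End(V)) : Prop :=
  forall i j : 'I_(\dim {:V}),
    cschwartz (fun x => coord (vbasis {:V}) i (F x (vbasis {:V})`_j)).

End Functions.

Section Representation.
Context {R : realType}.
Local Notation R3 := 'cV[R]_3.
Local Notation C := R[i].
Local Notation V m := (subvs_of (@harm R m)).

Definition mx3 (rows : seq (seq R)) : 'M[R]_3 :=
  \matrix_(i, j) nth 0 (nth [::] rows i) j.

Definition so3Y (i : 'I_3) : 'M[R]_3 :=
  nth 0 [:: mx3 [:: [::  0;  0;  0];
                    [::  0;  0;  1];
                    [::  0; -1;  0]];
            mx3 [:: [::  0;  0; -1];
                    [::  0;  0;  0];
                    [::  1;  0;  0]];
            mx3 [:: [::  0;  1;  0];
                    [:: -1;  0;  0];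
                    [::  0;  0;  0]]] i.

Definition expmx (A : 'M[R]_3) : 'M[R]_3 :=
  limn (series (fun n => (n`!%:R)^-1 *: A ^+ n)).

Definition dtau m (Y : 'M[R]_3) : 'End(V m) :=
  vderive (fun t : R => tau m (expmx (t *: Y))) 1 0.

Definition dtauR3 m (x : R3) : 'End(V m) :=
  \sum_i (x i 0)%:C%C *: dtau m (so3Y i).

Definition Dtau m (F : R3 -> 'End(V m)) (x : R3) : 'End(V m) :=
  \sum_i (dtau m (so3Y i) \o vderive F (evec i) x)%VF.

Definition sqnorm (x : R3) : R := \sum_i x i 0 ^+ 2.

Fixpoint Q m (j : nat) : R3 -> 'End(V m) :=
  match j with
  | 0 => fun=> \1%VF
  | j'.+1 =>
    match j' with
    | 0 => dtauR3 m
    | _ => fun x => (dtauR3 m x \o Q m j' x)%VF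
             - (sqnorm x / (2 * j' + 1)%N%:R)%:C%C *: Dtau (Q m j') x
    end
  end.

End Representation.

(* Main.v *)
From HB Require Import structures.
Require Import Defs.
From mathcomp Require Import all_boot all_order all_algebra.
From mathcomp Require Import complex reals.
From mathcomp Require mpoly.
From mathcomp Require Import ring lra zify.

(** The point r e_3 is fixed by the rotations about the third axis, and the weights
of tau_m are simple, so F(r e_3) is diagonal in a basis v_0, ..., v_2m of weight
vectors, v_k = J^k v_0 with J the lowering operator.  Let f_k(r) be its diagonal
entries.  The entry (j, 0) of ad(J)^j F(r e_3) is, up to sign, the j-th difference
of k |-> f_k(r) at 0 ([adM_entry]).  On the other hand, differentiating the
equivariance of F along one-parameter groups of rotations turns ad(J) into the
vector field
  L = x_2 (d_0 - i d_1) - (x_0 - i x_1) d_2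
(coordinates are numbered from 0).  As d_0 - i d_1 kills both x_0 - i x_1 and x_2,
one has L^j F = x_2^j (d_0 - i d_1)^j F on the axis ([adM_dminus]).  Hence the j-th
difference of the f_k is r^j times a smooth function of r, and Newton's
interpolation formula gives
  F(r e_3) = sum_(i <= 2m) c_i(r) (r T_2)^i, with c_i smooth and T_2 = dtau(Y_2)
([M_axis_comb]); no Taylor expansion and no decomposition into spherical harmonics
is used.  The rotation by pi about the first axis shows that c_i may be replaced by
its even part, and an even smooth function of |x| is smooth on R^3
([smooth_radial]).  Moving the third axis to x by a rotation then yields
F(x) = sum_(i <= 2m) c_i(|x|) Q_1(x)^i ([M_comb]).

It remains to replace the powers of Q_1 by the Q_j.  Filter the functions
|x|^(2a) Q_1(x)^b by the weight 2a + b.  The operator D_tau lowers the weight by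
one ([filt_diff]), because the Casimir operator is a scalar and because the brackets
[T_i, Q_1(x)] form the cross product of x and T.  By the recursion, Q_j - Q_1^j is
|x|^2 times an element of weight at most j - 2 ([Qmx_lead]), so that Q_j is a
unitriangular combination of the powers of Q_1 with polynomial coefficients, and
this can be inverted ([powers_Qmx]).

Both parts use only the following facts on the representation
([ladder_matrices]): the commutation relations of the T_i, a highest weight vector,
here (x_0 + i x_1)^m, and the bound 2m + 1 for the dimension, which holds as a
harmonic polynomial is determined by its coefficients of degree at most one in x_2
([dim_harm]).  They are available once dtau(Y_i) is known to be the differential
operator of the rotation ([pval_dtau]).  The theorem is therefore proved first for
an abstract representation, in matrices ([equivariant_decomposition]). *)

Set Implicit Arguments.
Unset Strict Implicit.
Unset Printing Implicit Defensive.
Import Order.TTheory GRing.Theory Num.Theory.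
Local Open Scope ring_scope.

(** * Infinitesimal rotations of polynomials and highest weight vectors *)

Lemma sum3 (V : nmodType) (F : 'I_3 -> V) : \sum_i F i = F 0 + F 1 + F 2%:R.
Proof.
rewrite !big_ord_recl big_ord0 addr0 addrA.
by congr (F _ + F _ + F _); apply: val_inj.
Qed.

Lemma ord3P (Q : 'I_3 -> Prop) : Q 0 -> Q 1 -> Q 2%:R -> forall i, Q i.
Proof.
move=> q0 q1 q2 [[|[|[|//]]] i3].
- by rewrite (_ : Ordinal _ = 0) //; apply: val_inj.
- by rewrite (_ : Ordinal _ = 1) //; apply: val_inj.
- by rewrite (_ : Ordinal _ = 2%:R) //; apply: val_inj.
Qed.

Module LiePoly.
Import mpoly.
Section LiePoly.
Context {R : rcfType}.
Local Notation C := R[i].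
Local Notation P3 := {mpoly C[3]}.
Implicit Types (A B k : 'M[R]_3) (p q : P3).

(** Key of the definitions that are to be treated as abstract by unification. *)
Fact seal : unit. Proof. exact: tt. Qed.

Definition rowform : 'M[R]_3 -> 'I_3 -> P3 :=
  locked_with seal (fun A i => \sum_j (A i j)%:C%C *: 'X_j).

Lemma rowformE A i : rowform A i = \sum_j (A i j)%:C%C *: 'X_j.
Proof. by rewrite /rowform unlock. Qed.

(** The vector field x |-> - A x, that is, the derivative at t = 0 of p (exp (- t A) x). *)
Definition lie : 'M[R]_3 -> P3 -> P3 :=
  locked_with seal (fun A p => - \sum_i rowform A i * p^`M(i)).

Lemma lieE A p : lie A p = - \sum_i rowform A i * p^`M(i).
Proof. by rewrite /lie unlock. Qed.

Definition rot : 'M[R]_3 -> P3 -> P3 := locked_with seal rotpoly.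

Lemma rotE : rot = rotpoly.
Proof. by rewrite /rot unlock. Qed.

Fact lie_linear A : linear (lie A).
Proof.
move=> c p q; rewrite !lieE scalerN -opprD; congr (- _).
rewrite scaler_sumr -big_split; apply: eq_bigr => i _ /=.
by rewrite mderivD mderivZ mulrDr scalerAr.
Qed.
HB.instance Definition _ A := GRing.isLinear.Build C P3 P3 _ (lie A) (lie_linear A).

Lemma lieM A p q : lie A (p * q) = lie A p * q + p * lie A q.
Proof.
rewrite !lieE mulNr mulrN -opprD; congr (- _).
rewrite mulr_suml mulr_sumr -big_split; apply: eq_bigr => i _ /=.
rewrite mderivM; ring.
Qed.

Lemma lieXn A p n : lie A (p ^+ n) = (p ^+ n.-1 * lie A p) *+ n.
Proof.
elim: n => [|n IH].
  rewrite expr0 mulr0n !lieE big1 ?oppr0 // => i _.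
  by rewrite -mpolyC1 mderivC mulr0.
rewrite exprS lieM IH /=; case: n {IH} => [|n]; first by rewrite expr0 !mulr0n mulr0 addr0 mulr1 mul1r.
by rewrite /= mulrnAr mulrA -exprS [lie A p * _]mulrC -mulrS.
Qed.

Lemma mderivXU (i j : 'I_3) : ('X_j : P3)^`M(i) = (i == j)%:R.
Proof.
rewrite mderivX mnm1E eq_sym; have [->|ij] := eqVneq i j; last by rewrite scale0r.
by rewrite scale1r subUU mpolyX0.
Qed.

Lemma lieX A i : lie A 'X_i = - rowform A i.
Proof.
rewrite !lieE (bigD1 i) //= big1 ?addr0; last first.
  by move=> j ji; rewrite mderivXU (negbTE ji) mulr0.
by rewrite mderivXU eqxx mulr1.
Qed.

Lemma lie_scale A (c : C) p : lie A (c *: p) = c *: lie A p.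
Proof. exact: linearZ. Qed.

Lemma lie_add A p q : lie A (p + q) = lie A p + lie A q.
Proof. exact: linearD. Qed.

Lemma rowform1 i : rowform 1%:M i = 'X_i.
Proof.
rewrite !rowformE (bigD1 i) //= big1 ?addr0; first by rewrite mxE eqxx scale1r.
by move=> j ji; rewrite mxE eq_sym (negbTE ji) scale0r.
Qed.

Lemma lie_rowform A B i : lie A (rowform B i) = - rowform (B *m A) i.
Proof.
rewrite !rowformE linear_sum /= -sumrN.
have E l : lie A ((B i l)%:C%C *: 'X_l) =
    \sum_j - (((B i l * A l j)%:C%C : C) *: 'X_j).
  rewrite lie_scale lieX scalerN rowformE scaler_sumr -sumrN.
  by apply: eq_bigr => j _; rewrite scalerA rmorphM.
under eq_bigr do rewrite E; rewrite exchange_big; apply: eq_bigr => j _ /=.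
by rewrite sumrN mxE rmorph_sum scaler_suml.
Qed.

Lemma rowformD A B i : rowform (A + B) i = rowform A i + rowform B i.
Proof.
rewrite !rowformE -big_split; apply: eq_bigr => j _ /=.
by rewrite mxE rmorphD scalerDl.
Qed.

Lemma rowformZ (c : R) A i : rowform (c *: A) i = c%:C%C *: rowform A i.
Proof.
rewrite !rowformE scaler_sumr; apply: eq_bigr => j _ /=.
by rewrite mxE rmorphM scalerA.
Qed.

Lemma lieD A B p : lie (A + B) p = lie A p + lie B p.
Proof.
rewrite !lieE -opprD -big_split; congr (- _); apply: eq_bigr => i _ /=.
by rewrite rowformD mulrDl.
Qed.

Lemma lieZ (c : R) A p : lie (c *: A) p = c%:C%C *: lie A p.
Proof.
rewrite !lieE scalerN scaler_sumr; congr (- _); apply: eq_bigr => i _ /=.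
by rewrite rowformZ scalerAl.
Qed.

(** The second-order part of the product of two vector fields is symmetric in them, so only the
bracket of the coefficients remains. *)
Lemma lie_comm A B p :
  lie A (lie B p) - lie B (lie A p) = lie (A *m B - B *m A) p.
Proof.
have E (X Y : 'M[R]_3) : lie X (lie Y p) = \sum_i rowform (Y *m X) i * p^`M(i)
    + \sum_i \sum_j rowform Y i * rowform X j * p^`M(i)^`M(j).
  rewrite (lieE Y) linearN linear_sum -sumrN -big_split; apply: eq_bigr => i _ /=.
  rewrite lieM lie_rowform opprD; congr (_ + _); first by rewrite mulNr opprK.
  rewrite !lieE mulrN opprK mulr_sumr; apply: eq_bigr => j _; by rewrite mulrA.
rewrite !E opprD addrACA -[RHS]addr0; congr (_ + _).
  rewrite -sumrB !lieE -sumrN; apply: eq_bigr => i _.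
  rewrite -[- (B *m A)]scaleN1r rowformD rowformZ rmorphN1 scaleN1r; ring.
apply/eqP. rewrite subr_eq0. apply/eqP. apply: etrans (exchange_big _ _ _ _ _ _) _.
apply: eq_bigr => i _. apply: eq_bigr => j _.
exact: (congr2 *%R (mulrC _ _) (mderiv_comm _ _ _)).
Qed.

Lemma rotD k p q : rot k (p + q) = rot k p + rot k q.
Proof. rewrite rotE; exact: comp_mpolyD. Qed.

Lemma rotZ k (c : C) p : rot k (c *: p) = c *: rot k p.
Proof. rewrite rotE; exact: comp_mpolyZ. Qed.

Lemma rotM k p q : rot k (p * q) = rot k p * rot k q.
Proof. rewrite rotE; exact: (rmorphM (comp_mpoly _)). Qed.

Lemma rotX k i : rot k 'X_i = rowform (invmx k) i.
Proof. by rewrite rotE /rotpoly comp_mpolyXU -tnth_nth tnth_mktuple rowformE. Qed.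

Lemma rot_sum k (I : Type) (r : seq I) (Q : pred I) (F : I -> P3) :
  rot k (\sum_(i <- r | Q i) F i) = \sum_(i <- r | Q i) rot k (F i).
Proof. rewrite rotE; exact: (raddf_sum (comp_mpoly _)). Qed.

Lemma rot1 k : rot k 1 = 1.
Proof. rewrite rotE; exact: comp_mpoly1. Qed.

Lemma rot0 k : rot k 0 = 0.
Proof. rewrite rotE; exact: comp_mpoly0. Qed.

Lemma mpoly_alg_ind (Q : P3 -> Prop) : Q 0 -> Q 1 -> (forall i, Q 'X_i) ->
  (forall p q, Q p -> Q q -> Q (p + q)) -> (forall (c : C) p, Q p -> Q (c *: p)) ->
  (forall p q, Q p -> Q q -> Q (p * q)) -> forall p, Q p.
Proof.
move=> Q0 Q1 QX QD QZ QM; elim/mpolyind => // c u p _ _ Qp.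
apply: QD => //; apply: QZ; rewrite mpolyXE_id.
apply: big_ind => // i _; elim: (u i) => // n IH; rewrite exprS; exact: QM.
Qed.

Lemma rot_id p : rot 1%:M p = p.
Proof.
elim/mpoly_alg_ind: p => [||i|p q IHp IHq|c p IH|p q IHp IHq].
- by rewrite rot0.
- exact: rot1.
- rewrite rotX invmx1 rowform1 //.
- by rewrite rotD IHp IHq.
- by rewrite rotZ IH.
- by rewrite rotM IHp IHq.
Qed.

Lemma SO3_inv k : SO3 k -> invmx k = k^T.
Proof.
move=> [kk _]; have hu : k \in unitmx by apply: (proj2 (mulmx1_unit kk)).
by rewrite -[invmx k]mul1mx -kk -mulmxA mulmxV // mulmx1.
Qed.

Lemma SO3_unit k : SO3 k -> k \in unitmx.
Proof. by move=> [kk _]; apply: (proj2 (mulmx1_unit kk)). Qed.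

Lemma rot_rowform k A i : rot k (rowform A i) = rowform (A *m invmx k) i.
Proof.
rewrite !rowformE rot_sum; under eq_bigr do rewrite rotZ rotX rowformE scaler_sumr.
rewrite exchange_big; apply: eq_bigr => j _ /=.
rewrite mxE rmorph_sum scaler_suml; apply: eq_bigr => l _.
by rewrite scalerA rmorphM.
Qed.

Lemma rotK k p : SO3 k -> rot k^T (rot k p) = p.
Proof.
move=> hk; elim/mpoly_alg_ind: p => [||i|p q IHp IHq|c p IH|p q IHp IHq].
- by rewrite !rot0.
- by rewrite !rot1.
- rewrite rotX rot_rowform (SO3_inv hk) mulmxV; last by rewrite unitmx_tr SO3_unit.
  by rewrite -invmx1 -rotX rot_id.
- rewrite (rotD k p q) (rotD k^T). by congr (_ + _).
- by rewrite (rotZ k c p) (rotZ k^T) IH.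
- rewrite (rotM k p q) (rotM k^T (rot k p)). by congr (_ * _).
Qed.

Lemma rot_lie k A p : SO3 k ->
  rot k (lie A p) = lie (k *m A *m k^T) (rot k p).
Proof.
move=> hk; have kT := SO3_inv hk.
elim/mpoly_alg_ind: p => [||i|p q IHp IHq|c p IH|p q IHp IHq].
- by rewrite linear0 rot0 linear0.
- by rewrite -(expr0 0) lieXn mulr0n expr0 rot1 -(expr0 0) lieXn mulr0n rot0.
- rewrite lieX -scaleN1r rotZ scaleN1r rot_rowform rotX lie_rowform.
  by rewrite kT !mulmxA; case: (hk) => -> _; rewrite mul1mx.
- by rewrite lie_add rotD (rotD k p q) lie_add; congr (_ + _).
- by rewrite lie_scale (rotZ k c (lie A p)) (rotZ k c p) IH lie_scale.
- rewrite lieM rotD (rotM k (lie A p)) (rotM k p (lie A q)) (rotM k p q) lieM.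
  exact: (congr2 +%R (congr2 *%R IHp (erefl _)) (congr2 *%R (erefl _) IHq)).
Qed.

(** The rule of differentiation D is a parameter: differentiating an action by algebra
morphisms takes only the value on the generators X_i and the Leibniz rule. *)
Lemma rot_deriv (T : Type) (k : T -> 'M[R]_3) (t0 : T) A
  (D : (T -> P3) -> P3 -> Prop) :
  k t0 = 1%:M ->
  (forall p, D (fun=> p) 0) ->
  (forall i, D (fun t => rowform (invmx (k t)) i) (- rowform A i)) ->
  (forall P Q dP dQ, D P dP -> D Q dQ -> D (fun t => P t + Q t) (dP + dQ)) ->
  (forall P Q dP dQ, D P dP -> D Q dQ ->
     D (fun t => P t * Q t) (dP * Q t0 + P t0 * dQ)) ->
  (forall P Q dP dQ, P =1 Q -> dP = dQ -> D P dP -> D Q dQ) ->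
  forall p, D (fun t => rot (k t) p) (lie A p).
Proof.
move=> k0 Dc DX DD DM De p.
elim/mpoly_alg_ind: p => [||i|p q IHp IHq|c p IH|p q IHp IHq].
- apply: De (Dc 0) => [t|]; last by rewrite linear0.
  by rewrite rot0.
- apply: De (Dc 1) => [t|]; first by rewrite rot1.
  by rewrite -(expr0 0) lieXn mulr0n.
- by apply: De (DX i) => [t|]; rewrite ?rotX ?lieX.
- by apply: De (DD _ _ _ _ IHp IHq) => [t|]; rewrite ?rotD ?linearD.
- apply: De (DM _ _ _ _ (Dc c%:MP) IH) => [t|]; first by rewrite rotZ mul_mpolyC.
  by rewrite mul0r add0r mul_mpolyC lie_scale.
- apply: De (DM _ _ _ _ IHp IHq) => [t|]; first by rewrite rotM.
  by rewrite k0 !rot_id lieM.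
Qed.

(** The cast [indhomog m] is not linear on all polynomials; composed with the projection to
degree m it is, and it agrees with [roth] after a rotation. *)
Definition homproj m (p : P3) : dhomog 3 C m := indhomog m (pihomog mdeg m p).

Lemma homprojE m p : homproj m p = pihomog mdeg m p :> P3.
Proof. by apply: indhomogK; apply: pihomogP. Qed.

Fact homproj_linear m : linear (homproj m).
Proof.
move=> c p q; apply: val_inj; rewrite [LHS]homprojE linearP.
by rewrite /= -!homprojE.
Qed.
HB.instance Definition _ m :=
  GRing.isLinear.Build C P3 (dhomog 3 C m) _ (homproj m) (homproj_linear m).

Lemma roth_homproj m k (p : dhomog 3 C m) : roth k p = homproj m (rotpoly k p).
Proof.
apply: val_inj; rewrite [RHS]homprojE [LHS]rothE pihomog_dE //.
exact/homog_rotpoly/dhomog_is_dhomog.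
Qed.

Definition pval m (v : subvs_of (@harm R m)) : P3 := val (vsval v).

Fact pval_linear m : linear (@pval m).
Proof. by move=> c u v; rewrite /pval linearP. Qed.
HB.instance Definition _ m :=
  GRing.isLinear.Build C (subvs_of (@harm R m)) P3 _ (@pval m) (@pval_linear m).

Lemma pval_inj m : injective (@pval m).
Proof. by move=> u v /val_inj/val_inj. Qed.

Lemma pval_tau m k v : SO3 k -> pval (tau m k v) = rotpoly k (pval v).
Proof. exact: tauE. Qed.

Lemma mcoeff_sep p : (forall u : 'X_{1..3}, mcoeff u p = 0) -> p = 0.
Proof. by move=> H; apply/mpolyP => u; rewrite H mcoeff0. Qed.

Definition hwform : P3 := 'X_0 + 'i%C *: 'X_1.

Definition hwpoly m : P3 := hwform ^+ m.

Lemma mderivXn p n i : (p ^+ n)^`M(i) = (p ^+ n.-1 * p^`M(i)) *+ n.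
Proof.
elim: n => [|n IH]; first by rewrite expr0 mulr0n -mpolyC1 mderivC.
rewrite exprS mderivM IH /=; case: n {IH} => [|n].
  by rewrite expr0 !mulr0n mulr0 addr0 mulr1 mul1r.
by rewrite /= mulrnAr mulrA -exprS [p^`M(i) * _]mulrC -mulrS.
Qed.

Lemma sqri : 'i%C * 'i%C = -1 :> C.
Proof. by rewrite -expr2 sqr_i. Qed.

Lemma mderiv_hwform i : hwform^`M(i) = (i == 0)%:R + 'i%C *: (i == 1)%:R.
Proof. by rewrite mderivD mderivZ !mderivXU. Qed.

Lemma mderiv2_hwform i : hwform^`M(i)^`M(i) = 0.
Proof.
rewrite mderiv_hwform mderivD mderivZ.
have E (b : bool) : (b%:R : P3)^`M(i) = 0.
  by case: b; rewrite /= ?mderiv0 // -mpolyC1 mderivC.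
by rewrite !E scaler0 addr0.
Qed.

(** The gradient (1, i, 0) of x_0 + i x_1 is isotropic. *)
Lemma laplacian_hwpoly m : laplacian (hwpoly m) = 0.
Proof.
have E i : (hwpoly m)^`M(i)^`M(i) =
    (hwform ^+ m.-1.-1 * (hwform^`M(i) * hwform^`M(i))) *+ (m.-1 * m).
  rewrite /hwpoly mderivXn mderivMn mderivM mderivXn mderiv2_hwform mulr0 addr0.
  by rewrite mulrnAl -mulrnA mulrA.
rewrite /laplacian; under eq_bigr do rewrite E.
have D0 : hwform^`M(0) = 1 by rewrite mderiv_hwform scaler0 addr0.
have D1 : hwform^`M(1) = 'i%C *: 1 by rewrite mderiv_hwform add0r.
have D2 : hwform^`M(2%:R) = 0 by rewrite mderiv_hwform scaler0 addr0.
rewrite sumrMnl -mulr_sumr sum3 D0 D1 D2 mulr0 addr0 mulr1.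
by rewrite -scalerAl -scalerAr scalerA sqri mul1r scaleN1r subrr mulr0 mul0rn.
Qed.

Lemma hwpoly_neq0 m : hwpoly m != 0.
Proof.
rewrite /hwpoly expf_neq0 //; apply/eqP => /(congr1 (mcoeff U_(0))).
by rewrite mcoeffD mcoeffZ !mcoeffXU mcoeff0 mulr0 addr0 => /eqP; rewrite oner_eq0.
Qed.

Lemma homog_hwpoly m : hwpoly m \is m.-homog.
Proof.
rewrite /hwpoly -[X in X.-homog]mul1n; apply: dhomogMn.
by apply: rpredD; last apply: rpredZ; rewrite dhomogX /= mdeg1.
Qed.

Lemma lie_hwform A : lie A hwform = - (rowform A 0 + 'i%C *: rowform A 1).
Proof. by rewrite /hwform lie_add lie_scale !lieX scalerN opprD. Qed.

Lemma rowform3 A i : rowform A i =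
  (A i 0)%:C%C *: 'X_0 + (A i 1)%:C%C *: 'X_1 + (A i 2%:R)%:C%C *: 'X_(2%:R).
Proof. by rewrite rowformE sum3. Qed.

(** The hypotheses give the first two rows of Y_2, by which x_0 + i x_1 is an eigenvector for
i. *)
Lemma lie_hwpoly_weight A m : A 0 0 = 0 -> A 0 1 = 1 -> A 0 2%:R = 0 ->
  A 1 0 = -1 -> A 1 1 = 0 -> A 1 2%:R = 0 ->
  lie A (hwpoly m) = ('i%C * m%:R) *: hwpoly m.
Proof.
move=> a00 a01 a02 a10 a11 a12.
have E : lie A hwform = 'i%C *: hwform.
  rewrite lie_hwform !rowform3 a00 a01 a02 a10 a11 a12 rmorphN1 rmorph0 rmorph1.
  rewrite !scale0r !addr0 add0r scale1r scaleN1r scalerN opprD opprK /hwform.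
  by rewrite scalerDr scalerA sqri scaleN1r addrC.
rewrite /hwpoly lieXn E -scalerAr; case: m => [|m]; first by rewrite mulr0 scale0r mulr0n.
by rewrite -exprSr mulrC -scalerA scaler_nat scalerMnr.
Qed.

(** The hypotheses give the first two rows of Y_0 and Y_1: the raising operator kills x_0 + i
x_1. *)
Lemma lie_hwpoly_raise A B m : (forall j, A 0 j = 0) -> A 1 0 = 0 -> A 1 1 = 0 ->
  A 1 2%:R = 1 -> (forall j, B 1 j = 0) -> B 0 0 = 0 -> B 0 1 = 0 -> B 0 2%:R = -1 ->
  lie B (hwpoly m) - 'i%C *: lie A (hwpoly m) = 0.
Proof.
move=> a0 a10 a11 a12 b1 b00 b01 b02.
have E : lie B hwform - 'i%C *: lie A hwform = 0.
  rewrite !lie_hwform !rowform3 !a0 a10 a11 a12 !b1 b00 b01 b02 rmorphN1 rmorph0 rmorph1.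
  rewrite !scale0r !addr0 !add0r scale1r scaler0 addr0 scaleN1r opprK.
  by rewrite scalerN scalerA sqri scaleN1r !opprK subrr.
rewrite /hwpoly !lieXn -scalerMnr -mulrnBl.
by rewrite scalerAr -mulrBr E mulr0 mul0rn.
Qed.

Definition hwvec m : subvs_of (@harm R m) := vsproj (harm m) (indhomog m (hwpoly m)).

Lemma pval_hwvec m : pval (hwvec m) = hwpoly m.
Proof.
have E : val (indhomog m (hwpoly m)) = hwpoly m by apply/indhomogK/homog_hwpoly.
rewrite /pval /hwvec vsprojK ?E // mem_harm; apply/eqP.
by rewrite [X in laplacian X]E laplacian_hwpoly.
Qed.

(** The Laplace equation expresses a coefficient of degree c + 2 in x_2 by coefficients of
degree c in x_2. *)
Lemma harm_coeff0 m (p : P3) : p \is m.-homog -> laplacian p = 0 ->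
  (forall u : 'X_{1..3}, mdeg u = m -> (u 2%:R <= 1)%N -> p@_u = 0) -> p = 0.
Proof.
move=> hp lp H; apply: mcoeff_sep => u.
have [n] := ubnP (u 2%:R); elim: n u => // n IH u un.
have [um|um] := eqVneq (mdeg u) m; last first.
  by apply: (dhomog_nemf_coeff hp).
have [u1|u1] := leqP (u 2%:R) 1; first exact: H.
have le1 : (U_(2%:R) + U_(2%:R) <= u)%MM.
  apply/mnm_lepP => j; rewrite mnmDE mnm1E; case: eqP => [<-|//] //=.
pose w := (u - (U_(2%:R) + U_(2%:R)))%MM.
have uw : u = (w + U_(2%:R) + U_(2%:R))%MM by rewrite -addmA submK.
have := congr1 (mcoeff w) lp; rewrite mcoeff0 /laplacian sum3 !mcoeffD !mcoeff_mderiv -uw.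
rewrite [p@_(w + U_(0) + U_(0))]IH; last first.
  by rewrite !mnmDE !mnm1E /= /w !addn0 mnmBE mnmDE mnm1E /=; lia.
rewrite [p@_(w + U_(1) + U_(1))]IH; last first.
  by rewrite !mnmDE !mnm1E /= /w !addn0 mnmBE mnmDE mnm1E /=; lia.
rewrite !mul0rn !add0r => /eqP; rewrite !mulrn_eq0 /= => /eqP //.
Qed.

Definition mon3 (a b c : nat) : 'X_{1..3} := [multinom nth 0%N [:: a; b; c] i | i < 3].

(** There are m + 1 monomials of degree m without x_2 and m monomials of degree m linear in
x_2. *)
Definition harm_coeffs m (p : dhomog 3 C m) : 'rV[C]_(m.+1 + m) :=
  \row_i match split i with
         | inl a => p@_(mon3 a (m - a) 0)
         | inr a => p@_(mon3 a (m.-1 - a) 1)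
         end.

Fact harm_coeffs_linear m : linear (@harm_coeffs m).
Proof.
move=> c p q; apply/rowP => i; rewrite !mxE.
by case: split => a; rewrite /= mcoeffD mcoeffZ.
Qed.
HB.instance Definition _ m :=
  GRing.isLinear.Build C (dhomog 3 C m) 'rV[C]_(m.+1 + m) _ (@harm_coeffs m) (@harm_coeffs_linear m).

Lemma dim_harm m : (\dim (@harm R m) <= (2 * m).+1)%N.
Proof.
pose f := linfun (@harm_coeffs m).
have inj : (harm m :&: lker f)%VS = 0%VS.
  apply/eqP; rewrite -subv0; apply/subvP => p; rewrite memv_cap mem_harm memv_ker lfunE /= memv0.
  move=> /andP[/eqP lp /eqP cp]; apply/eqP; apply: val_inj => /=.
  apply: (@harm_coeff0 m) => //; first exact: dhomog_is_dhomog.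
  move=> u um u1; move: um; rewrite mdegE sum3 => um.
  have E : u = mon3 (u 0) (u 1) (u 2%:R).
    apply/mnmP => i; rewrite mnmE; case: i => -[|[|[|//]]] i3 /=; congr (u _); exact: val_inj.
  have [a um'] := (u 0, um).
  case: (u 2%:R) u1 um E => [|[|//]] _ um ->.
    have lt : (u 0%R < m.+1)%N by lia.
    have /rowP/(_ (lshift m (Ordinal lt))) := cp; rewrite !mxE.
    rewrite (unsplitK (inl _)) /=; congr (_@_(mon3 _ _ _) = _); lia.
  have lt : (u 0%R < m)%N by lia.
  have /rowP/(_ (rshift m.+1 (Ordinal lt))) := cp; rewrite !mxE.
  rewrite (unsplitK (inr _)) /=; congr (_@_(mon3 _ _ _) = _); lia.
rewrite -(limg_dim_eq inj); apply: leq_trans (dimvS (subvf _)) _.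
by rewrite dimvf /dim /= mul1n; lia.
Qed.

End LiePoly.
End LiePoly.
Export LiePoly.

(** * Rotation matrices *)

Section Rotations.
Context {R : realType}.
Implicit Types (k A B : 'M[R]_3) (x : 'cV[R]_3).

Lemma matrix3P A B :
  [/\ A 0 0 = B 0 0, A 0 1 = B 0 1 & A 0 2%:R = B 0 2%:R] ->
  [/\ A 1 0 = B 1 0, A 1 1 = B 1 1 & A 1 2%:R = B 1 2%:R] ->
  [/\ A 2%:R 0 = B 2%:R 0, A 2%:R 1 = B 2%:R 1 & A 2%:R 2%:R = B 2%:R 2%:R] ->
  A = B.
Proof.
move=> [? ? ?] [? ? ?] [? ? ?]; apply/matrixP.
by elim/ord3P; elim/ord3P.
Qed.

Lemma nat_entries (A : 'M[R]_3) : {B : nat -> nat -> R | forall i j, A i j = B i j}.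
Proof. by exists (fun a b => A (inord a) (inord b)) => i j; rewrite !inord_val. Qed.

Lemma det3 A : \det A =
  A 0 0 * (A 1 1 * A 2%:R 2%:R - A 1 2%:R * A 2%:R 1)
  - A 0 1 * (A 1 0 * A 2%:R 2%:R - A 1 2%:R * A 2%:R 0)
  + A 0 2%:R * (A 1 0 * A 2%:R 1 - A 1 1 * A 2%:R 0).
Proof.
have [B E] := nat_entries A.
rewrite (expand_det_row _ 0) sum3 /cofactor !(expand_det_row _ 0) !big_ord_recl !big_ord0.
rewrite /cofactor !det_mx11 !mxE !E /= /bump /=; ring.
Qed.

(** The inverse of a rotation is its transpose, and its adjugate as the determinant is 1. *)
Lemma SO3_cofactor k i j : SO3 k -> k i j = cofactor k i j.
Proof.
move=> [kk dk]; have := mul_mx_adj k; rewrite dk => /(congr1 (mulmx k^T)).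
by rewrite mulmxA kk mul1mx mulmx1 => /matrixP/(_ j i); rewrite !mxE => ->.
Qed.

Lemma SO3M k A : SO3 k -> SO3 A -> SO3 (k *m A).
Proof.
move=> [kk dk] [AA dA]; split; last by rewrite det_mulmx dk dA mulr1.
by rewrite trmx_mul mulmxA -(mulmxA A^T) kk mulmx1.
Qed.

Lemma SO3_1 : SO3 (1%:M : 'M[R]_3).
Proof. by split; rewrite ?det1 // trmx1 mulmx1. Qed.

(** The image of x under the isomorphism of R^3 with so(3): this matrix sends v to the cross
product of v and x. *)
Definition crossmx x : 'M[R]_3 := \sum_i x i 0 *: so3Y i.

Lemma so3YE : (so3Y 0 = mx3 [:: [:: 0;  0;  0 : R]; [:: 0;  0;  1]; [:: 0; -1;  0]]) *
  (so3Y 1 = mx3 [:: [:: 0;  0; -1 : R]; [:: 0;  0;  0]; [:: 1;  0;  0]]) *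
  (so3Y 2%:R = mx3 [:: [:: 0;  1;  0 : R]; [:: -1;  0;  0]; [:: 0;  0;  0]]).
Proof. by []. Qed.

(** Rotations preserve the cross product: the entries on the left are combinations of 2 by 2
minors of k, and these minors are entries of k. *)
Lemma crossmx_conj k x : SO3 k -> k *m crossmx x *m k^T = crossmx (k *m x).
Proof.
move=> hk; have H i j := SO3_cofactor i j hk.
have [B E] := nat_entries k.
have H0 := (H 0 0, H 0 1, H 0 2%:R); have H1 := (H 1 0, H 1 1, H 1 2%:R).
have H2 := (H 2%:R 0, H 2%:R 1, H 2%:R 2%:R).
move: H0 H1 H2; rewrite /cofactor !(expand_det_row _ 0) !big_ord_recl !big_ord0.
rewrite /cofactor !det_mx11 !mxE !E /= /bump /=.
move=> [[c00 c01] c02] [[c10 c11] c12] [[c20 c21] c22].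
apply: matrix3P; split; rewrite /crossmx !sum3 !so3YE /mx3 !(mxE, sum3) /= !E /=.
- ring.
- rewrite c20 c21 c22; ring.
- rewrite c10 c11 c12; ring.
- rewrite c20 c21 c22; ring.
- ring.
- rewrite c00 c01 c02; ring.
- rewrite c10 c11 c12; ring.
- rewrite c00 c01 c02; ring.
- ring.
Qed.

Lemma polar (p q : R) : exists c s, [/\ c ^+ 2 + s ^+ 2 = 1,
  p = c * Num.sqrt (p ^+ 2 + q ^+ 2) & q = s * Num.sqrt (p ^+ 2 + q ^+ 2)].
Proof.
set h := Num.sqrt _.
have h2 : h ^+ 2 = p ^+ 2 + q ^+ 2 by rewrite sqr_sqrtr // addr_ge0 ?sqr_ge0.
have [h0|h0] := eqVneq h 0.
  exists 1, 0; rewrite expr1n expr0n addr0; split=> //; rewrite h0 mulr0.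
    by apply/eqP; move/eqP: h2; rewrite h0 expr0n eq_sym paddr_eq0 ?sqr_ge0 // !sqrf_eq0 => /andP[].
  by apply/eqP; move/eqP: h2; rewrite h0 expr0n eq_sym paddr_eq0 ?sqr_ge0 // !sqrf_eq0 => /andP[].
exists (p / h), (q / h); rewrite !divfK //; split=> //.
by rewrite !expr_div_n -mulrDl -h2 divff // expf_neq0.
Qed.

Lemma SO3_planar_z (c s : R) : c ^+ 2 + s ^+ 2 = 1 ->
  SO3 (mx3 [:: [:: c; - s; 0]; [:: s; c; 0]; [:: 0; 0; 1]]).
Proof.
move=> cs; have cs' : s ^+ 2 = 1 - c ^+ 2 by rewrite -cs; ring.
split; last by rewrite det3 !mxE /=; ring: cs'.
apply: matrix3P; split; rewrite !(mxE, sum3) /=; ring: cs'.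
Qed.

Lemma SO3_planar_y (c s : R) : c ^+ 2 + s ^+ 2 = 1 ->
  SO3 (mx3 [:: [:: s; 0; c]; [:: 0; 1; 0]; [:: - c; 0; s]]).
Proof.
move=> cs; have cs' : s ^+ 2 = 1 - c ^+ 2 by rewrite -cs; ring.
split; last by rewrite det3 !mxE /=; ring: cs'.
apply: matrix3P; split; rewrite !(mxE, sum3) /=; ring: cs'.
Qed.

Lemma SO3_flip : SO3 (mx3 [:: [:: 1; 0; 0]; [:: 0; -1; 0]; [:: 0; 0; -1 : R]]).
Proof.
split; last by rewrite det3 !mxE /=; ring.
apply: matrix3P; split; rewrite !(mxE, sum3) /=; ring.
Qed.

Lemma col3P (x y : 'cV[R]_3) : x 0 0 = y 0 0 -> x 1 0 = y 1 0 -> x 2%:R 0 = y 2%:R 0 -> x = y.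
Proof.
by move=> e0 e1 e2; apply/matrixP => i j; rewrite ord1; elim/ord3P: i.
Qed.

Lemma SO3_flip_axis (r : R) :
  mx3 [:: [:: 1; 0; 0]; [:: 0; -1; 0]; [:: 0; 0; -1 : R]] *m (r *: evec 2%:R) = - r *: evec 2%:R.
Proof. apply: col3P; rewrite !(mxE, sum3) /=; ring. Qed.

(** Spherical coordinates: a rotation about the second axis followed by one about the third. *)
Lemma SO3_axis x : exists2 k, SO3 k & x = k *m (Num.sqrt (sqnorm x) *: evec 2%:R).
Proof.
have [c [s [cs e0 e1]]] := polar (x 0 0) (x 1 0).
set h := Num.sqrt _ in e0 e1.
have [c' [s' [cs' eh ez]]] := polar h (x 2%:R 0).
have hx : h ^+ 2 + x 2%:R 0 ^+ 2 = sqnorm x.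
  by rewrite /sqnorm sum3 sqr_sqrtr // addr_ge0 ?sqr_ge0.
rewrite hx in eh ez.
exists (mx3 [:: [:: c; - s; 0]; [:: s; c; 0]; [:: 0; 0; 1]] *m
        mx3 [:: [:: s'; 0; c']; [:: 0; 1; 0]; [:: - c'; 0; s']]).
  by apply: SO3M; [apply: SO3_planar_z | apply: SO3_planar_y].
apply: col3P; rewrite -mulmxA !(mxE, sum3) /=.
- rewrite {1}e0 {1}eh; ring.
- rewrite {1}e1 {1}eh; ring.
- rewrite {1}ez; ring.
Qed.
End Rotations.

(** * Weight basis generated by a highest weight vector *)

Section RankOne.
Variables (C : fieldType) (V : vectType C) (n : nat) (X : n.-tuple V).

Definition rank1_fun (b : 'I_n) (w x : V) : V := coord X b x *: w.

Fact rank1_fun_linear b w : linear (rank1_fun b w).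
Proof. by move=> c x y; rewrite /rank1_fun linearP scalerDl scalerA. Qed.
HB.instance Definition _ b w :=
  GRing.isLinear.Build C V V _ (rank1_fun b w) (rank1_fun_linear b w).

Definition rank1 b (w : V) : 'End(V) := linfun (rank1_fun b w).

Fact rank1_linear b : linear (rank1 b).
Proof.
move=> c u v; apply/lfunP => x; rewrite add_lfunE scale_lfunE !lfunE /= /rank1_fun.
by rewrite scalerDr !scalerA mulrC.
Qed.
HB.instance Definition _ b := GRing.isLinear.Build C V 'End(V) _ (rank1 b) (rank1_linear b).

Lemma rank1_sum (f : 'End(V)) : basis_of {:V} X -> f = \sum_b rank1 b (f X`_b).
Proof.
move=> bX; apply/lfunP => x; rewrite sum_lfunE {1}(coord_basis bX (memvf x)) linear_sum.
by apply: eq_bigr => b _; rewrite lfunE /= /rank1_fun linearZ.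
Qed.
End RankOne.

Section EndMatrix.
Variables (C : fieldType) (V : vectType C) (n : nat) (X : n.+1.-tuple V).
Hypothesis X_basis : basis_of {:V} X.
Implicit Types f g : 'End(V).

Definition endmx f : 'M[C]_n.+1 := \matrix_(i, j) coord X i (f X`_j).

Lemma endmxP f (j : 'I_n.+1) : f X`_j = \sum_i endmx f i j *: X`_i.
Proof.
rewrite {1}(coord_basis X_basis (memvf (f X`_j))).
by apply: eq_bigr => i _; rewrite mxE.
Qed.

Fact endmx_linear : linear endmx.
Proof.
by move=> c f g; apply/matrixP => i j; rewrite !mxE add_lfunE scale_lfunE linearP.
Qed.
HB.instance Definition _ := GRing.isLinear.Build C 'End(V) 'M[C]_n.+1 _ endmx endmx_linear.

Lemma X_free : free X.
Proof. exact: basis_free X_basis. Qed.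

Lemma endmx_comp f g : endmx (f \o g)%VF = endmx f * endmx g.
Proof.
apply/matrixP => i j; rewrite !mxE comp_lfunE (endmxP g) !linear_sum.
apply: eq_bigr => k _; rewrite !linearZ /= (mxE _ _ i k) mulrC //.
Qed.

Lemma endmx1 : endmx \1%VF = 1.
Proof. by apply/matrixP => i j; rewrite [LHS]mxE [RHS]mxE id_lfunE coord_free ?X_free // eq_sym. Qed.

Lemma endmx_inj : injective endmx.
Proof.
move=> f g fg; apply/lfunP => v; rewrite (coord_basis X_basis (memvf v)) !linear_sum.
by apply: eq_bigr => j _; rewrite !linearZ /= !endmxP fg.
Qed.

Lemma endmx_decomp f : f = \sum_j \sum_i endmx f i j *: rank1 X j X`_i.
Proof.
rewrite [LHS](rank1_sum _ X_basis); apply: eq_bigr => j _.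
by rewrite endmxP linear_sum; apply: eq_bigr => i _; rewrite linearZ.
Qed.

Lemma endmx_col f (j : 'I_n.+1) (c : 'I_n.+1 -> C) :
  f X`_j = \sum_i c i *: X`_i -> forall i, endmx f i j = c i.
Proof. by move=> E i; rewrite mxE E coord_sum_free ?X_free. Qed.

End EndMatrix.

Section Ladder.
Variable R : rcfType.
Local Notation C := R[i].
Variables (V : vectType C) (m : nat) (T : 'I_3 -> 'End(V)) (v0 : V).
Hypothesis T01 : forall v, T 0 (T 1 v) - T 1 (T 0 v) = - T 2%:R v.
Hypothesis T12 : forall v, T 1 (T 2%:R v) - T 2%:R (T 1 v) = - T 0 v.
Hypothesis T20 : forall v, T 2%:R (T 0 v) - T 0 (T 2%:R v) = - T 1 v.
Hypothesis v0_neq0 : v0 != 0.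
Hypothesis T2v0 : T 2%:R v0 = ('i%C * m%:R) *: v0.
Hypothesis Jpv0 : T 1 v0 - 'i%C *: T 0 v0 = 0.
Hypothesis dimV : (\dim {:V} <= (2 * m).+1)%N.

Let ii : 'i%C * 'i%C = -1 :> C.
Proof. by rewrite -expr2 sqr_i. Qed.

(** With J_a = - i T_a, these are the ladder operators J_0 - i J_1 and J_0 + i J_1. *)
Definition Jm : 'End(V) := - ('i%C *: T 0 + T 1).
Definition Jp : 'End(V) := T 1 - 'i%C *: T 0.

Lemma JmE v : Jm v = - ('i%C *: T 0 v + T 1 v).
Proof. by rewrite /Jm opp_lfunE add_lfunE scale_lfunE. Qed.

Lemma JpE v : Jp v = T 1 v - 'i%C *: T 0 v.
Proof. by rewrite /Jp add_lfunE opp_lfunE scale_lfunE. Qed.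

(** Reduces an identity between vectors to an identity between scalars, through linear forms. *)
Lemma vec_ext (u w : V) :
  (forall phi : V -> C, (forall x y, phi (x + y) = phi x + phi y) ->
     (forall x, phi (- x) = - phi x) -> (forall c x, phi (c *: x) = c * phi x) ->
     phi u = phi w) -> u = w.
Proof.
move=> E; rewrite (coord_vbasis (memvf u)) (coord_vbasis (memvf w)).
apply: eq_bigr => i _; congr (_ *: _).
by apply: E => [x y|x|c x]; rewrite (linearD, linearN, linearZ).
Qed.

Lemma T2_Jm v : T 2%:R (Jm v) = Jm (T 2%:R v) - 'i%C *: Jm v.
Proof.
have E1 : T 2%:R (T 0 v) = T 0 (T 2%:R v) - T 1 v by rewrite -(T20 v) addrC subrK.
have E2 : T 2%:R (T 1 v) = T 1 (T 2%:R v) + T 0 v.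
  by rewrite -[T 0 v]opprK -(T12 v) opprB addrC subrK.
rewrite !JmE linearN linearD linearZ /= E1 E2.
move: (T 0 (T 2%:R v)) (T 1 (T 2%:R v)) (T 0 v) (T 1 v) => p q r s.
apply: vec_ext => phi fD fN fZ; rewrite !(fN, fD, fZ); ring: ii.
Qed.

Lemma Jp_Jm v : Jp (Jm v) = Jm (Jp v) - ('i%C *+ 2) *: T 2%:R v.
Proof.
have E : T 2%:R v = T 1 (T 0 v) - T 0 (T 1 v) by rewrite -[LHS]opprK -T01 opprB.
have P a : T a (Jm v) = - ('i%C *: T a (T 0 v) + T a (T 1 v)).
  by rewrite JmE linearN linearD linearZ.
have Q a : T a (Jp v) = T a (T 1 v) - 'i%C *: T a (T 0 v) by rewrite JpE linearB linearZ.
rewrite E (JpE (Jm v)) (JmE (Jp v)) (P 0) (P 1) (Q 0) (Q 1).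
move: (T 0 (T 0 v)) (T 0 (T 1 v)) (T 1 (T 0 v)) (T 1 (T 1 v)) => p q r s.
apply: vec_ext => phi fD fN fZ; rewrite !(fN, fD, fZ); ring: ii.
Qed.

Definition ladder (k : nat) : V := iter k Jm v0.

Lemma T2_ladder k : T 2%:R (ladder k) = ('i%C * (m%:R - k%:R)) *: ladder k.
Proof.
elim: k => [|k IH]; first by rewrite subr0.
rewrite [ladder _]/= T2_Jm IH linearZ /= -scalerBl; congr (_ *: _).
by rewrite -[k.+1]addn1 natrD; ring.
Qed.

Lemma Jp_ladder k :
  Jp (ladder k.+1) = (k.+1%:R * ((2 * m)%:R - k%:R)) *: ladder k.
Proof.
elim: k => [|k IH].
  rewrite [ladder 1]/= Jp_Jm JpE Jpv0 linear0 add0r T2v0 -scaleNr scalerA; congr (_ *: _).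
  by rewrite natrM; ring: ii.
rewrite [ladder k.+2]/= Jp_Jm IH linearZ /= -[Jm _]/(ladder k.+1) T2_ladder scalerA -scalerBl.
congr (_ *: _); rewrite natrM -[k.+2]addn2 -[k.+1]addn1 (natrD _ k 2) (natrD _ k 1); ring: ii.
Qed.

Definition Jp_iter (j : nat) : 'End(V) := iter j (fun f => (f \o Jp)%VF) \1%VF.

Lemma Jp_iterS j v : Jp_iter j.+1 v = Jp_iter j (Jp v).
Proof. by rewrite /= comp_lfunE. Qed.

Lemma Jp_iter_ladder k : (k <= 2 * m)%N ->
  exists2 c : C, c != 0 & Jp_iter k (ladder k) = c *: v0.
Proof.
elim: k => [|k IH] km; first by exists 1; rewrite ?oner_eq0 // id_lfunE scale1r.
have [c c0 E] := IH (ltnW km).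
exists ((k.+1%:R * ((2 * m)%:R - k%:R)) * c).
  by rewrite -natrB 1?ltnW // mulf_neq0 // -natrM pnatr_eq0 muln_eq0 /= subn_eq0 -ltnNge.
by rewrite Jp_iterS Jp_ladder linearZ /= E scalerA.
Qed.

Lemma Jp_iter_ladder0 j k : (k < j)%N -> Jp_iter j (ladder k) = 0.
Proof.
elim: j k => // j IH [|k] kj; rewrite Jp_iterS; first by rewrite JpE Jpv0 linear0.
by rewrite Jp_ladder linearZ /= IH // scaler0.
Qed.

Definition ladder_basis : (2 * m).+1.-tuple V := [tuple ladder k | k < (2 * m).+1].

Lemma nth_ladder (k : 'I_(2 * m).+1) : ladder_basis`_k = ladder k.
Proof. by rewrite -tnth_nth tnth_mktuple. Qed.

(** Jp^k sends the k-th vector of the ladder to a non-zero multiple of v0 and kills the earlier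
ones; hence the coefficients of a vanishing combination vanish, from the last one down. *)
Lemma ladder_free : free ladder_basis.
Proof.
apply/freeP => a; under eq_bigr do rewrite nth_ladder; move=> E.
suff H n (i : 'I_(2 * m).+1) : (2 * m - i < n)%N -> a i = 0 by move=> i; apply: (H (2 * m - i).+1).
elim: n i => // n IH i ni; have im : (i <= 2 * m)%N by rewrite -ltnS.
have [c c0 Ec] := Jp_iter_ladder im.
have := congr1 (Jp_iter i) E; rewrite linear0 linear_sum (bigD1 i) //= big1 => [|j ji].
  rewrite addr0 linearZ /= Ec scalerA => /eqP; rewrite scaler_eq0 (negbTE v0_neq0) orbF.
  by rewrite mulf_eq0 (negbTE c0) orbF => /eqP.
have [lt|ge] := ltnP j i; first by rewrite linearZ /= Jp_iter_ladder0 // scaler0.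
rewrite IH ?scale0r ?linear0 //.
have : (i < j)%N by rewrite ltn_neqAle ge andbT eq_sym; apply: contraNneq ji => /val_inj ->.
have := ltn_ord j; lia.
Qed.

Lemma ladder_basisP : basis_of {:V} ladder_basis.
Proof.
by rewrite basisEfree ladder_free subvf size_tuple dimV.
Qed.

Let tomx := endmx ladder_basis.

Lemma tomx_T2 i j : tomx (T 2%:R) i j = ('i%C * (m%:R - (j : nat)%:R)) *+ (i == j).
Proof.
rewrite (endmx_col ladder_basisP (c := fun i => ('i%C * (m%:R - (j : nat)%:R)) *+ (i == j))) //.
rewrite (bigD1 j) //= big1 ?addr0 => [|k /negbTE ->]; last by rewrite mulr0n scale0r.
by rewrite eqxx mulr1n nth_ladder T2_ladder.
Qed.

Lemma tomx_Jm i (j : 'I_(2 * m).+1) : (j < 2 * m)%N -> tomx Jm i j = (i == j.+1 :> nat)%:R.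
Proof.
move=> jm; rewrite (endmx_col ladder_basisP (c := fun i => (i == j.+1 :> nat)%:R)) //.
have lt : (j.+1 < (2 * m).+1)%N by [].
rewrite (bigD1 (Ordinal lt)) //= big1 ?addr0 => [|k kj].
  by have /= -> := nth_ladder (Ordinal lt); rewrite eqxx scale1r nth_ladder.
rewrite (_ : (_ == _) = false) ?scale0r //; apply: contraNF kj => /eqP e.
by apply/eqP/val_inj.
Qed.

Definition casimir_op : 'End(V) := (T 0 \o T 0)%VF + (T 1 \o T 1)%VF + (T 2%:R \o T 2%:R)%VF.

Lemma casimir_opE v : casimir_op v = T 0 (T 0 v) + T 1 (T 1 v) + T 2%:R (T 2%:R v).
Proof. by rewrite /casimir_op !add_lfunE !comp_lfunE. Qed.

Lemma casimir_Jm_Jp v : casimir_op v = T 2%:R (T 2%:R v) + 'i%C *: T 2%:R v - Jm (Jp v).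
Proof.
have E : T 2%:R v = T 1 (T 0 v) - T 0 (T 1 v) by rewrite -[LHS]opprK -T01 opprB.
rewrite casimir_opE addrC -[RHS]addrA; congr (_ + _).
have P a : T a (Jp v) = T a (T 1 v) - 'i%C *: T a (T 0 v) by rewrite JpE linearB linearZ.
rewrite E JmE (P 0) (P 1).
move: (T 0 (T 0 v)) (T 0 (T 1 v)) (T 1 (T 0 v)) (T 1 (T 1 v)) => p q r s.
apply: vec_ext => phi fD fN fZ; rewrite !(fN, fD, fZ); ring: ii.
Qed.

Lemma casimir_ladder k : casimir_op (ladder k) = (- (m%:R ^+ 2 + m%:R)) *: ladder k.
Proof.
have JJ : Jm (Jp (ladder k)) = (k%:R * ((2 * m)%:R - k%:R + 1)) *: ladder k.
  case: k => [|k]; first by rewrite /= JpE Jpv0 linear0 mul0r scale0r.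
  by rewrite Jp_ladder linearZ; congr (_ *: _); rewrite -[k.+1]addn1 (natrD _ k 1); ring.
rewrite casimir_Jm_Jp JJ T2_ladder linearZ /= T2_ladder !scalerA -scalerDl -scalerBl.
by congr (_ *: _); rewrite natrM; ring: ii.
Qed.

(** It suffices to look at the ladder, where the operator is expressed by Jm Jp and T 2. *)
Lemma casimir_scalar : casimir_op = (- (m%:R ^+ 2 + m%:R)) *: \1%VF.
Proof.
apply: (endmx_inj ladder_basisP); rewrite linearZ /= endmx1 ?ladder_basisP //.
apply/matrixP => i j; rewrite [LHS](endmx_col ladder_basisP
  (c := fun i => (- (m%:R ^+ 2 + m%:R)) *+ (i == j))); first by rewrite !mxE mulr_natr.
rewrite (bigD1 j) //= big1 ?addr0 => [|k /negbTE ->]; last by rewrite mulr0n scale0r.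
by rewrite eqxx mulr1n nth_ladder casimir_ladder.
Qed.

Lemma tomx_comm (f g h : 'End(V)) : (forall v, f (g v) - g (f v) = - h v) ->
  tomx f * tomx g - tomx g * tomx f = - tomx h.
Proof.
move=> E; rewrite /tomx -!(endmx_comp ladder_basisP) -linearB -linearN /=; congr endmx.
by apply/lfunP => v; rewrite add_lfunE !opp_lfunE !comp_lfunE E.
Qed.

Lemma tomx_casimir : tomx (T 0) * tomx (T 0) + tomx (T 1) * tomx (T 1) +
  tomx (T 2%:R) * tomx (T 2%:R) = (- (m%:R ^+ 2 + m%:R))%:M.
Proof.
rewrite /tomx -!(endmx_comp ladder_basisP) -!linearD /= -[X in endmx _ X]/casimir_op casimir_scalar.
by rewrite linearZ /= endmx1 ?ladder_basisP // -scalemx1.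
Qed.

(** Everything that is used of the representation.  The lowering operator is described on the
vectors v_0, ..., v_(2m - 1) only, since no power J^j with j > 2m is applied to v_0. *)
Theorem ladder_matrices : exists X : (2 * m).+1.-tuple V,
  [/\ basis_of {:V} X,
   [/\ endmx X (T 0) * endmx X (T 1) - endmx X (T 1) * endmx X (T 0) = - endmx X (T 2%:R),
     endmx X (T 1) * endmx X (T 2%:R) - endmx X (T 2%:R) * endmx X (T 1) = - endmx X (T 0) &
     endmx X (T 2%:R) * endmx X (T 0) - endmx X (T 0) * endmx X (T 2%:R) = - endmx X (T 1)],
   forall i j, endmx X (T 2%:R) i j = ('i%C * (m%:R - (j : nat)%:R)) *+ (i == j),
   forall i (j : 'I_(2 * m).+1), (j < 2 * m)%N ->
     (- ('i%C *: endmx X (T 0) + endmx X (T 1)) : 'M[C]_((2 * m).+1)) i j = (i == j.+1 :> nat)%:R &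
   exists c, endmx X (T 0) * endmx X (T 0) + endmx X (T 1) * endmx X (T 1) +
     endmx X (T 2%:R) * endmx X (T 2%:R) = c%:M].
Proof.
exists ladder_basis; split; first exact: ladder_basisP.
- by split; apply: tomx_comm.
- exact: tomx_T2.
- have E : endmx ladder_basis Jm =
      - ('i%C *: endmx ladder_basis (T 0) + endmx ladder_basis (T 1)).
    by rewrite /Jm linearN linearD linearZ.
  by move=> i j ij; rewrite -E; apply: tomx_Jm.
- by exists (- (m%:R ^+ 2 + m%:R)); apply: tomx_casimir.
Qed.
End Ladder.

From mathcomp Require Import all_classical all_reals all_analysis.
Import numFieldNormedType.Exports.
Import (canonicals) mpoly.
Local Open Scope ring_scope.
Local Open Scope classical_set_scope.

(** * Even smooth functions of one variable *)

Section OneVar.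
Local Notation "f ^` ( n )" := (derive1n n f) : ring_scope.
Local Notation "f ^` ()" := (derive1 f) : ring_scope.
Context {R : realType}.
Implicit Types f g h d : R -> R.

Lemma is_derive1_continuous f (x d : R) :
  is_derive x (1 : R) f d -> {for x, continuous f}.
Proof. by case=> df _; apply/differentiable_continuous/derivable1_diffP. Qed.

(** A continuous function whose derivative has a limit at 0 is differentiable at 0, by
L'Hopital's rule. *)
Lemma is_derive_at0_limit f d : {for 0, continuous f} -> {for 0, continuous d} ->
  (forall t : R, t != 0 -> is_derive t (1 : R) f (d t)) -> is_derive (0 : R) (1 : R) f (d 0).
Proof.
move=> cf cd fd.
suff H : h^-1 *: (f (h *: (1 : R) + 0) - f 0) @[h --> 0^'] --> d 0.
  by split; [apply/cvg_ex; exists (d 0) | apply: cvg_lim].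
have H : (f x - f 0) / x @[x --> 0^'] --> d 0.
  apply: (@lhopital R (fun x => f x - f 0) d (fun x => x) (fun=> 1) (-1) 1 0 (d 0)).
  - by rewrite in_itv /= ltrN10 ltr01.
  - move=> x; rewrite inE /= => -[_ /eqP x0].
    rewrite -[d x]subr0; apply: is_deriveB; exact: fd.
  - rewrite -[X in _ --> X](subrr (f 0)); apply: cvgB => //; exact: cvg_cst.
  - exact: cvg_id.
  - by move=> x _; rewrite oner_eq0.
  - have -> : (fun x => d x / 1) = d by apply: funext => x; rewrite divr1.
    exact: cd.
have -> : (fun h : R => h^-1 *: (f (h *: (1 : R) + 0) - f 0)) = (fun x => (f x - f 0) / x).
  by apply: funext => x; rewrite /= addr0 /GRing.scale /= mulr1 mulrC.
exact: H.
Qed.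

Definition smooth1 f := forall n x, derivable (f^`(n)) x 1.

Lemma derive1n_derive1 f n : f^`()^`(n) = f^`(n.+1).
Proof. by rewrite /derive1n -iterSr. Qed.

Lemma smooth1_derive1 f : smooth1 f -> smooth1 f^`().
Proof. by move=> sf n x; rewrite derive1n_derive1. Qed.

Lemma smooth1_is_derive f n x : smooth1 f -> is_derive x (1 : R) (f^`(n)) (f^`(n.+1) x).
Proof. by move=> sf; rewrite derive1nS derive1E; apply: derivableP. Qed.

Lemma smooth1_continuous f n : smooth1 f -> continuous (f^`(n)).
Proof.
by move=> sf x; apply: differentiable_continuous; apply/derivable1_diffP; apply: sf.
Qed.

Arguments smooth1_continuous {f} n _ x.

Lemma smooth1_coind (P : (R -> R) -> Prop) :
  (forall f, P f -> (forall x, derivable f x 1) /\ P f^`()) ->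
  forall f, P f -> smooth1 f.
Proof.
move=> HP f Pf n; have : P (f^`(n)).
  by elim: n => [|n IH]; rewrite ?derive1n0 // derive1nS; apply: (HP _ IH).2.
by case/HP.
Qed.

Lemma derive1_ext f d : (forall x, is_derive x (1:R) f (d x)) -> f^`() = d.
Proof. by move=> fd; apply: funext => x; rewrite derive1E; apply: derive_val. Qed.

(** The primitive of s^n h^(n+1)(s) that vanishes at 0, obtained from the previous one by
parts. *)
Fixpoint moment_prim h n : R -> R :=
  if n is n'.+1 then fun s => s ^+ n * h^`(n) s - n%:R * moment_prim h n' s
  else fun s => h s - h 0.

Lemma moment_prim0 h n : moment_prim h n 0 = 0.
Proof. by elim: n => [|n IH] /=; rewrite ?subrr // IH expr0n /= mul0r mulr0 subrr. Qed.

Lemma is_derive_expn n (x : R) : is_derive x (1 : R) (fun s => s ^+ n) (n%:R * x ^+ n.-1).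
Proof.
have := @is_deriveX R R id n x 1 1 (is_derive_id _ _).
have -> : (id ^+ n : R -> R) = (fun s => s ^+ n).
  by apply: funext => y; elim: n => // n IH; rewrite !exprS -IH.
by rewrite /GRing.scale /= mulr1.
Qed.

Lemma is_derive_moment_prim h n (x : R) : smooth1 h ->
  is_derive x (1 : R) (moment_prim h n) (x ^+ n * h^`(n.+1) x).
Proof.
move=> sh; elim: n => [|n IH].
  rewrite expr0 mul1r -[h^`(1) x]subr0; apply: is_deriveB.
  exact: (smooth1_is_derive 0).
have D1 := @is_deriveM R R _ _ x 1 _ _ (is_derive_expn n.+1 x) (smooth1_is_derive n.+1 x sh).
have D2 := @is_deriveZ R R R _ (n.+1%:R) x 1 _ IH.
have D := is_deriveB D1 D2.
apply: (is_derive_eq D).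
rewrite /GRing.scale /=; ring.
Qed.

(** This is the integral of t^n h^(n+1)(t s) for t in [0, 1], written without integrals; for n = 0
it is (h s - h 0) / s. *)
Definition moment_quot h n : R -> R :=
  fun s => if s == 0 then h^`(n.+1) 0 / n.+1%:R else moment_prim h n s / s ^+ n.+1.

(** The derivatives of the primitive and of s^(n+1) have the quotient h^(n+1)(s) / (n+1). *)
Lemma moment_quot_continuous0 h n : smooth1 h -> {for 0, continuous (moment_quot h n)}.
Proof.
move=> sh; have H : moment_quot h n x @[x --> 0^'] --> moment_quot h n 0.
  (* x ^+ n without its zero at 0: L'Hopital's rule asks for a denominator that is never 0. *)
  pose w (x : R) := if x == 0 then 1 else x ^+ n.
  have w0 x : w x != 0 by rewrite /w; case: (eqVneq x 0) => [_|x0]; rewrite ?oner_eq0 ?expf_neq0.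
  have n0 : n.+1%:R != 0 :> R by rewrite pnatr_eq0.
  have L : moment_prim h n x / x ^+ n.+1 @[x --> 0^'] --> moment_quot h n 0.
    apply: (@lhopital R (moment_prim h n) (fun x => w x * h^`(n.+1) x) (fun x => x ^+ n.+1)
      (fun x => w x * n.+1%:R) (-1) 1 0 (moment_quot h n 0)).
    - by rewrite in_itv /= ltrN10 ltr01.
    - move=> x; rewrite inE /= => -[_ /eqP x0]; rewrite /w (negbTE x0).
      exact: is_derive_moment_prim.
    - move=> x; rewrite inE /= => -[_ /eqP x0]; rewrite /w (negbTE x0) mulrC.
      exact: is_derive_expn.
    - by have := is_derive1_continuous (is_derive_moment_prim n 0 sh); rewrite /prop_for /continuous_at moment_prim0.
    - by have := is_derive1_continuous (is_derive_expn n.+1 (0 : R));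
        rewrite /prop_for /continuous_at expr0n.
    - by move=> x _; rewrite mulf_neq0.
    - have -> : (fun x => w x * h^`(n.+1) x / (w x * n.+1%:R)) =
                (fun x => h^`(n.+1) x * n.+1%:R^-1).
        by apply: funext => x; rewrite invfM mulrACA divff // mul1r.
      rewrite /moment_quot eqxx; apply: cvgM; last exact: cvg_cst.
      exact: (smooth1_continuous n.+1 sh).
  apply: cvg_trans L; apply: near_eq_cvg.
  near=> x; rewrite /moment_quot ifF //; apply/negbTE; near: x; exact: nbhs_dnbhs_neq.
exact/continuous_withinNx.
Unshelve. all: by end_near. Qed.

(** Differentiation under the integral sign.  Away from 0 it is the recursion that defines
[moment_prim]; at 0 it follows by continuity. *)
Lemma is_derive_moment_quot h n (x : R) : smooth1 h ->
  is_derive x (1 : R) (moment_quot h n) (moment_quot h n.+1 x).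
Proof.
move=> sh.
suff H (t : R) : t != 0 -> is_derive t (1 : R) (moment_quot h n) (moment_quot h n.+1 t).
  have [->|/H //] := eqVneq x 0.
  apply: is_derive_at0_limit => //; exact: moment_quot_continuous0.
move=> t0; pose q s := moment_prim h n s / s ^+ n.+1.
apply: (@near_eq_is_derive _ _ _ q).
  have := @open_neq R 0; rewrite openE => /(_ t t0).
  by apply: filterS => y /= y0; rewrite /moment_quot (negbTE y0).
rewrite /moment_quot (negbTE t0).
have tn0 : t ^+ n.+1 != 0 by rewrite expf_neq0.
have DV : is_derive t (1 : R) (fun s => (s ^+ n.+1)^-1)
    (- (t ^+ n.+1) ^- 2 *: (n.+1%:R * t ^+ n)).
  have [d1 d2] := is_derive_expn n.+1 t.
  by split; [exact: derivableV | rewrite deriveV // d2].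
apply: (is_derive_eq (is_deriveM (is_derive_moment_prim n t sh) DV)).
rewrite /GRing.scale /= !exprS; field; by rewrite expf_neq0 t0.
Qed.

Lemma smooth1_moment_quot h n : smooth1 h -> smooth1 (moment_quot h n).
Proof.
move=> sh; apply: (@smooth1_coind (fun f => exists n, f = moment_quot h n)); last by exists n.
move=> _ [k ->]; split=> [x|]; first by have [] := is_derive_moment_quot k x sh.
by exists k.+1; apply: derive1_ext => x; apply: is_derive_moment_quot.
Qed.

Definition even1 g := smooth1 g /\ forall r, g (- r) = g r.

(** The derivative of an even function is odd, so it vanishes at 0 and can be divided by r. *)
Lemma even1_derive g : even1 g ->
  exists a, even1 a /\ forall r : R, is_derive r (1 : R) g (r * a r).
Proof.
move=> [sg eg]; have sg' := smooth1_derive1 sg.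
have og r : g^`() (- r) = - g^`() r.
  have D : is_derive r (1 : R) (g \o -%R) (g^`() (- r) * -1).
    apply: is_derive1_comp; rewrite -derive1n1; exact: (smooth1_is_derive 0).
  have E : g \o -%R = g by apply: funext => y /=.
  rewrite E in D; have [_] := D; rewrite -derive1E => ->.
  by rewrite mulrN1 opprK.
have g0 : g^`() 0 = 0.
  have /eqP := og 0; rewrite oppr0 -addr_eq0 -mulr2n mulrn_eq0 /= => /eqP //.
have E r : g^`() r = r * moment_quot g^`() 0 r.
  rewrite /moment_quot; have [->|r0] := eqVneq r 0; first by rewrite mul0r.
  by rewrite /= g0 subr0 expr1 mulrCA divff // mulr1.
exists (moment_quot g^`() 0); split; last first.
  by move=> r; rewrite -E -derive1n1; apply: (smooth1_is_derive 0).
split; first exact: smooth1_moment_quot.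
move=> r; rewrite /moment_quot oppr_eq0; case: eqP => // _ /=.
by rewrite g0 !subr0 !expr1 og invrN mulrNN.
Qed.

(** For t >= 0 this is g (sqrt t); for t < 0, where [Num.sqrt] is 0, it is the line of slope c / 2,
tangent at 0 if c is the second derivative of g at 0. *)
Definition even_sqrt g (c : R) : R -> R :=
  fun t => g (Num.sqrt t) - c / 2 * (Num.sqrt (- t)) ^+ 2.

(** By the chain rule off 0, and then at 0 by continuity of the derivative found. *)
Lemma is_derive_even_sqrt g a (t : R) : even1 g -> even1 a ->
  (forall r : R, is_derive r (1 : R) g (r * a r)) ->
  is_derive t (1 : R) (even_sqrt g (a 0)) (a (Num.sqrt t) / 2).
Proof.
move=> [sg _] [sa _] ga.
have ca : continuous (fun t : R => a (Num.sqrt t) / 2).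
  move=> x; apply: cvgM; last exact: cvg_cst.
  apply: continuous_comp; [exact: sqrt_continuous | exact: (smooth1_continuous 0 sa)].
suff H (y : R) : y != 0 -> is_derive y (1 : R) (even_sqrt g (a 0)) (a (Num.sqrt y) / 2).
  have [->|/H //] := eqVneq t 0.
  apply: (@is_derive_at0_limit _ (fun t => a (Num.sqrt t) / 2)) => //; last exact: (ca 0).
  apply: cvgB.
    apply: continuous_comp; [exact: sqrt_continuous | exact: (smooth1_continuous 0 sg)].
  apply: cvgM; first exact: cvg_cst.
  apply: (@continuous_comp _ _ _ (fun t : R => Num.sqrt (- t)) (fun x => x ^+ 2)).
    apply: continuous_comp; [exact: oppr_continuous | exact: sqrt_continuous].
  exact: exprn_continuous.
move=> y0; have [yp|yn] : 0 < y \/ y < 0 by move: y0; rewrite neq_lt => /orP[]; [right|left].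
- apply: (@near_eq_is_derive _ _ _ (g \o Num.sqrt)).
    near=> z; rewrite /even_sqrt /= [Num.sqrt (- z)]ler0_sqrtr ?expr0n ?mulr0 ?subr0 //.
    by rewrite oppr_le0; apply: ltW; near: z; apply: lt_nbhsr.
  have sy : Num.sqrt y != 0 by rewrite gt_eqF // sqrtr_gt0.
  apply: is_derive_eq; first exact: (is_derive1_comp (ga _) (is_derive1_sqrt yp)).
  by field.
- apply: (@near_eq_is_derive _ _ _ (fun z => g 0 + a 0 / 2 * z)).
    near=> z; have z0 : z < 0 by near: z; apply: lt_nbhsl.
    rewrite /even_sqrt [Num.sqrt z]ler0_sqrtr ?ltW // sqr_sqrtr ?oppr_ge0 ?ltW //.
    by rewrite mulrN opprK.
  rewrite ler0_sqrtr ?ltW //.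
  apply: (is_derive_eq (is_deriveD (is_derive_cst _ _ _)
    (is_deriveZ (a 0 / 2) (@is_derive_id R R y 1)))).
  by rewrite add0r /GRing.scale /= mulr1.
Unshelve. all: by end_near. Qed.
End OneVar.

(** * Smooth functions on R^3 *)

Section Smooth.
Context {R : realType}.
Local Notation R3 := 'cV[R]_3.
Implicit Types f g : R3 -> R.

(** Smooth functions form the largest class of differentiable functions stable under partial
derivatives. *)
Lemma smooth_coind (P : (R3 -> R) -> Prop) :
  (forall f, P f -> (forall x, differentiable f x) /\
                    forall i, P (fun x => 'D_(evec i) f x)) ->
  forall f, P f -> smooth f.
Proof.
move=> HP f Pf s; have : P (iter_partial s f).
  by elim: s => //= i s IH; apply: (HP _ IH).2.
by case/HP.
Qed.

Lemma smooth_diff f x : smooth f -> differentiable f x.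
Proof. by move=> /(_ [::] x). Qed.

Lemma smooth_partial f i : smooth f -> smooth (fun x => 'D_(evec i) f x).
Proof.
move=> sf s x; have := sf (rcons s i) x.
by rewrite /iter_partial foldr_rcons.
Qed.

Lemma derive_coord (x v : R3) i : 'D_v (fun y : R3 => y i 0) x = v i 0.
Proof.
have := derive_mx (@derivable_id R R3 x v).
by rewrite derive_id => /matrixP/(_ i 0); rewrite mxE.
Qed.

Lemma derive_evec f (x v : R3) : differentiable f x ->
  'D_v f x = \sum_i v i 0 * 'D_(evec i) f x.
Proof.
move=> df; rewrite deriveE //.
have {1}-> : v = \sum_i v i 0 *: evec i.
  apply/matrixP => i j; rewrite summxE (bigD1 i) //= !mxE !eqxx ord1 mulr1.
  by rewrite big1 ?addr0 // => k ki; rewrite !mxE eq_sym (negbTE ki) mulr0.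
rewrite linear_sum; apply: eq_bigr => i _.
by rewrite linearZ /= deriveE.
Qed.

Lemma is_derive_curve f (c : R -> R3) (t : R) (dc : R3) :
  (forall i, is_derive t (1 : R) (fun s => c s i 0) (dc i 0)) ->
  differentiable f (c t) ->
  is_derive t (1 : R) (f \o c) ('D_dc f (c t)).
Proof.
move=> cd fd.
have Dc : derivable c t 1.
  by apply/derivable_mxP => i j; rewrite ord1; have [] := cd i.
have Ec : 'D_1 c t = dc.
  rewrite derive_mx //; apply/matrixP => i j; rewrite mxE ord1.
  by have [] := cd i.
have dfc : differentiable c t by apply/derivable1_diffP.
split; first by apply/derivable1_diffP/differentiable_comp.
rewrite deriveE; last exact: differentiable_comp.
by rewrite diff_comp //= -[X in 'd f _ X](deriveE (1:R^o) dfc) Ec deriveE.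
Qed.

(** A class stable under partial derivatives.  Its elements are smooth, and this yields at once the
smoothness of sums, of products and of radial functions with an even smooth profile. *)
Inductive smooth_gen : (R3 -> R) -> Prop :=
| smooth_gen_smooth f : smooth f -> smooth_gen f
| smooth_gen_cst c : smooth_gen (fun=> c)
| smooth_gen_coord i : smooth_gen (fun x => x i 0)
| smooth_gen_radial (h : R -> R) : even1 h -> smooth_gen (fun x => h (Num.sqrt (sqnorm x)))
| smooth_gen_add f g : smooth_gen f -> smooth_gen g -> smooth_gen (f + g)
| smooth_gen_mul f g : smooth_gen f -> smooth_gen g -> smooth_gen (f * g).

Lemma differentiable_sqnorm (x : R3) : differentiable (@sqnorm R) x.
Proof.
rewrite /sqnorm (_ : (fun _ => _) = \sum_i (fun y : R3 => y i 0) ^+ 2).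
  by apply: differentiable_sum => i; apply: differentiableX; apply: differentiable_coord.
by apply: funext => y; rewrite fct_sumE; apply: eq_bigr.
Qed.

Lemma derive_sqnorm (x v : R3) : 'D_v (@sqnorm R) x = 2 * \sum_i v i 0 * x i 0.
Proof.
rewrite /sqnorm (_ : (fun _ => _) = \sum_i (fun y : R3 => y i 0) ^+ 2); last first.
  by apply: funext => y; rewrite fct_sumE; apply: eq_bigr.
have D i : derivable (fun y : R3 => y i 0) x v.
  exact/diff_derivable/differentiable_coord.
rewrite derive_sum; last by move=> i; apply: derivableX.
rewrite mulr_sumr; apply: eq_bigr => i _.
rewrite deriveX // derive_coord /GRing.scale /= expr1; ring.
Qed.

Lemma sqnorm_ge0 (x : R3) : 0 <= sqnorm x.
Proof. by apply: sumr_ge0 => i _; apply: sqr_ge0. Qed.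

(** If g' = r a with a even, then the i-th partial derivative of g(|x|) is x_i a(|x|), which has
again a radial factor with an even profile. *)
Lemma smooth_gen_partial f : smooth_gen f ->
  (forall x, differentiable f x) /\ forall i, smooth_gen (fun x => 'D_(evec i) f x).
Proof.
elim=> {f} [f sf|c|j|g eg|f g sf [df Df] sg [dg Dg]|f g sf [df Df] sg [dg Dg]].
- by split=> [x|i]; [apply: smooth_diff | apply/smooth_gen_smooth/smooth_partial].
- split=> [x|i]; first exact: differentiable_cst.
  rewrite (_ : (fun _ => _) = fun=> (0 : R)); first exact: (smooth_gen_cst 0).
  by apply: funext => x; rewrite derive_cst.
- split=> [x|i]; first exact: differentiable_coord.
  rewrite (_ : (fun _ => _) = fun=> @evec R i j 0); first exact: smooth_gen_cst.
  by apply: funext => x; rewrite derive_coord.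
- have [a [ea ga]] := even1_derive eg.
  have E : (fun x => g (Num.sqrt (sqnorm x))) = even_sqrt g (a 0) \o @sqnorm R.
    apply: funext => x; rewrite /= /even_sqrt [Num.sqrt (- _)]ler0_sqrtr ?oppr_le0 ?sqnorm_ge0 //.
    by rewrite expr0n /= mulr0 subr0.
  have D t := is_derive_even_sqrt t eg ea ga.
  have dE t : differentiable (even_sqrt g (a 0)) t.
    by apply/derivable1_diffP; have [] := D t.
  rewrite E; split=> [x|i].
    by apply: differentiable_comp => //; apply: differentiable_sqnorm.
  rewrite (_ : (fun _ => _) = (fun x : R3 => x i 0) * (fun x : R3 => a (Num.sqrt (sqnorm x)))).
    by apply: smooth_gen_mul; [apply: smooth_gen_coord | apply: smooth_gen_radial].
  apply: funext => x /=.
  have ds := differentiable_sqnorm x.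
  rewrite deriveE; last exact: differentiable_comp.
  rewrite diff_comp //= -(deriveE _ ds) derive_sqnorm (bigD1 i) //= !mxE !eqxx mul1r.
  rewrite big1 ?addr0; last by move=> k ki; rewrite !mxE (negbTE ki) mul0r.
  rewrite -[X in 'd _ _ X]mulr1 [X in 'd _ _ X](_ : _ = (2 * x i 0) *: (1:R)) //.
  rewrite linearZ /= -deriveE //; have [_ ->] := D (sqnorm x).
  rewrite [RHS]/GRing.mul /= /GRing.scale /=; by field.
- split=> [x|i]; first exact: differentiableD.
  rewrite [X in smooth_gen X](_ : _ = (fun x => 'D_(evec i) f x) + (fun x => 'D_(evec i) g x)).
    exact: smooth_gen_add.
  by apply: funext => x; rewrite deriveD //; apply: diff_derivable.
- split=> [x|i]; first exact: differentiableM.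
  rewrite [X in smooth_gen X](_ : _ = f * (fun x => 'D_(evec i) g x) + g * (fun x => 'D_(evec i) f x)).
    by apply: smooth_gen_add; apply: smooth_gen_mul.
  by apply: funext => x; rewrite deriveM //; apply: diff_derivable.
Qed.

Lemma smooth_genP f : smooth_gen f -> smooth f.
Proof. exact/smooth_coind/smooth_gen_partial. Qed.

Lemma smooth_cst (c : R) : smooth (fun=> c).
Proof. exact/smooth_genP/smooth_gen_cst. Qed.

Lemma smooth_coord i : smooth (fun x : R3 => x i 0).
Proof. exact/smooth_genP/smooth_gen_coord. Qed.

Lemma smoothD f g : smooth f -> smooth g -> smooth (fun x => f x + g x).
Proof. by move=> sf sg; apply: smooth_genP; apply: smooth_gen_add; apply: smooth_gen_smooth. Qed.

Lemma smoothM f g : smooth f -> smooth g -> smooth (fun x => f x * g x).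
Proof. by move=> sf sg; apply: smooth_genP; apply: smooth_gen_mul; apply: smooth_gen_smooth. Qed.

Lemma smoothN f : smooth f -> smooth (fun x => - f x).
Proof.
move=> sf; rewrite (_ : (fun _ => _) = fun x => -1 * f x); last first.
  by apply: funext => x; rewrite mulN1r.
by apply: smoothM => //; apply: smooth_cst.
Qed.

Lemma smooth_sqnorm : smooth (@sqnorm R).
Proof.
rewrite /sqnorm.
have -> : (fun x : R3 => \sum_i x i 0 ^+ 2) =
   (fun x => x 0 0 * x 0 0 + (x 1 0 * x 1 0 + x 2%:R 0 * x 2%:R 0)).
  apply: funext => x; rewrite !big_ord_recl big_ord0 addr0 -!expr2.
  by congr (_ ^+ 2 + (_ ^+ 2 + _ ^+ 2)); congr (x _ 0); apply: val_inj.
by do 2?apply: smoothD; apply: smoothM; apply: smooth_coord.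
Qed.

Lemma smooth_line f (v : R3) : smooth f -> smooth1 (fun r : R => f (r *: v)).
Proof.
move=> sf; apply: (@smooth1_coind _ (fun g : R -> R => exists f : R3 -> R, smooth f /\ g = fun r : R => f (r *: v)));
  last by exists f.
move=> _ [{sf}f [sf ->]].
have D r : is_derive r (1 : R) (f \o (fun r => r *: v)) ('D_v f (r *: v)).
  apply: is_derive_curve; last exact: smooth_diff.
  move=> i; rewrite (_ : (fun _ => _) = v i 0 \*: (@idfun R)); last first.
    by apply: funext => s; rewrite mxE mulrC.
  rewrite -[X in is_derive _ _ _ X]mulr1; exact: is_deriveZ.
split=> [r|]; first by have [] := D r.
exists (fun x => \sum_i v i 0 * 'D_(evec i) f x); split.
  rewrite (_ : (fun _ => _) = (fun x => v 0 0 * 'D_(evec 0) f x +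
    (v 1 0 * 'D_(evec 1) f x + v 2%:R 0 * 'D_(evec 2%:R) f x))); last first.
    apply: funext => x; rewrite !big_ord_recl big_ord0 addr0.
    by congr (v _ 0 * 'D_(evec _) f x + (v _ 0 * 'D_(evec _) f x + v _ 0 * 'D_(evec _) f x)); apply: val_inj.
  by do 2?apply: smoothD; apply: smoothM; (apply: smooth_cst || apply: smooth_partial).
apply: derive1_ext => r; rewrite -derive_evec; [exact: D | exact: smooth_diff].
Qed.

Lemma smooth1D (g h : R -> R) : smooth1 g -> smooth1 h -> smooth1 (fun r => g r + h r).
Proof.
move=> sg sh; apply: (@smooth1_coind _ (fun f : R -> R => exists g h : R -> R,
  [/\ smooth1 g, smooth1 h & f = fun r => g r + h r])); last by exists g, h.
move=> _ [{sg}g [{sh}h [sg sh ->]]].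
have D r : is_derive r (1 : R) (fun r => g r + h r) (derive1 g r + derive1 h r).
  by apply: is_deriveD; rewrite -derive1n1; apply: (smooth1_is_derive 0).
split=> [r|]; first by have [] := D r.
exists (derive1 g), (derive1 h); split; try exact: smooth1_derive1.
exact: derive1_ext.
Qed.

Lemma smooth_radial (g : R -> R) : even1 g -> smooth (fun x => g (Num.sqrt (sqnorm x))).
Proof. by move=> eg; apply/smooth_genP/smooth_gen_radial. Qed.

End Smooth.

(** * Complex-valued smooth functions *)

Section ComplexDeriv.
Context {R : realType} {U : normedModType R}.
Local Notation C := R[i].
Implicit Types (f g : U -> C) (x v : U) (a b c : C).

Lemma ReD a b : complex.Re (a + b) = complex.Re a + complex.Re b.
Proof. by case: a; case: b. Qed.
Lemma ImD a b : complex.Im (a + b) = complex.Im a + complex.Im b.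
Proof. by case: a; case: b. Qed.
Lemma ReM a b : complex.Re (a * b) =
  complex.Re a * complex.Re b - complex.Im a * complex.Im b.
Proof. by case: a; case: b. Qed.
Lemma ImM a b : complex.Im (a * b) =
  complex.Re a * complex.Im b + complex.Im a * complex.Re b.
Proof. by case: a; case: b. Qed.
Lemma complex_ext a b : complex.Re a = complex.Re b -> complex.Im a = complex.Im b -> a = b.
Proof. by case: a; case: b => ? ? ? ? /= -> ->. Qed.

Definition is_cderive x v f c :=
  is_derive x v (fun y => complex.Re (f y)) (complex.Re c) /\
  is_derive x v (fun y => complex.Im (f y)) (complex.Im c).

Lemma is_cderive_val x v f c : is_cderive x v f c -> cderive f v x = c.
Proof. by case=> -[_ D1] [_ D2]; apply: complex_ext. Qed.

Lemma is_cderive_unique x v f b c : is_cderive x v f b -> is_cderive x v f c -> b = c.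
Proof. by move=> /is_cderive_val <- /is_cderive_val. Qed.

Lemma is_cderive_cst x v c : is_cderive x v (fun=> c) 0.
Proof. by split; apply: is_derive_cst. Qed.

Lemma is_cderiveD x v f g b c : is_cderive x v f b -> is_cderive x v g c ->
  is_cderive x v (fun y => f y + g y) (b + c).
Proof.
move=> [f1 f2] [g1 g2]; split.
  rewrite ReD (_ : (fun _ => _) = (fun y => complex.Re (f y)) + (fun y => complex.Re (g y))).
    exact: is_deriveD.
  by apply: funext => y; rewrite ReD.
rewrite ImD (_ : (fun _ => _) = (fun y => complex.Im (f y)) + (fun y => complex.Im (g y))).
  exact: is_deriveD.
by apply: funext => y; rewrite ImD.
Qed.

Lemma is_cderiveM x v f g b c : is_cderive x v f b -> is_cderive x v g c ->
  is_cderive x v (fun y => f y * g y) (b * g x + f x * c).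
Proof.
move=> [f1 f2] [g1 g2]; split.
  rewrite (_ : (fun _ => _) = (fun y => complex.Re (f y)) * (fun y => complex.Re (g y)) -
      (fun y => complex.Im (f y)) * (fun y => complex.Im (g y))).
    apply: (is_derive_eq (is_deriveB (is_deriveM f1 g1) (is_deriveM f2 g2))).
    rewrite /GRing.scale /= ReD !ReM; ring.
  by apply: funext => y; rewrite ReM.
rewrite (_ : (fun _ => _) = (fun y => complex.Re (f y)) * (fun y => complex.Im (g y)) +
    (fun y => complex.Im (f y)) * (fun y => complex.Re (g y))).
  apply: (is_derive_eq (is_deriveD (is_deriveM f1 g2) (is_deriveM f2 g1))).
  rewrite /GRing.scale /= ImD !ImM; ring.
by apply: funext => y; rewrite ImM.
Qed.

Lemma is_cderiveZ x v f b c : is_cderive x v f b ->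
  is_cderive x v (fun y => c * f y) (c * b).
Proof.
move=> fb; have := is_cderiveM (is_cderive_cst x v c) fb.
by rewrite mul0r add0r.
Qed.

Lemma is_cderive_sum (I : Type) (r : seq I) (P : pred I) x v (f : I -> U -> C) (d : I -> C) :
  (forall i, P i -> is_cderive x v (f i) (d i)) ->
  is_cderive x v (fun y => \sum_(i <- r | P i) f i y) (\sum_(i <- r | P i) d i).
Proof.
move=> H; elim: r => [|i r IH].
  rewrite big_nil (_ : (fun _ => _) = fun=> 0); first exact: is_cderive_cst.
  by apply: funext => y; rewrite big_nil.
rewrite big_cons (_ : (fun _ => _) = fun y => if P i then f i y + \sum_(j <- r | P j) f j y
    else \sum_(j <- r | P j) f j y); last by apply: funext => y; rewrite big_cons.
by case: ifP => // Pi; apply: is_cderiveD => //; apply: H.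
Qed.

Lemma is_cderive_real x v (f : U -> R) d : is_derive x v f d ->
  is_cderive x v (fun y => (f y)%:C%C) (d%:C)%C.
Proof. by split => //=; apply: is_derive_cst. Qed.
End ComplexDeriv.

Section CSmooth.
Context {R : realType}.
Local Notation C := R[i].
Local Notation R3 := 'cV[R]_3.
Implicit Types (f g : R3 -> C) (x v : R3) (a b c : C).

Definition cpartial (i : 'I_3) f x : C := cderive f (evec i) x.

Lemma csmooth_cst c : csmooth (fun=> c : C).
Proof. by split; apply: smooth_cst. Qed.

Lemma csmooth_real (f : R3 -> R) : smooth f -> csmooth (fun x => (f x)%:C%C).
Proof. by split=> //=; apply: smooth_cst. Qed.

Lemma csmoothD f g : csmooth f -> csmooth g -> csmooth (fun x => f x + g x).
Proof.
move=> [f1 f2] [g1 g2]; split.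
  by rewrite (_ : (fun _ => _) = fun x => complex.Re (f x) + complex.Re (g x));
    [apply: smoothD | apply: funext => x; rewrite ReD].
by rewrite (_ : (fun _ => _) = fun x => complex.Im (f x) + complex.Im (g x));
  [apply: smoothD | apply: funext => x; rewrite ImD].
Qed.

Lemma csmoothM f g : csmooth f -> csmooth g -> csmooth (fun x => f x * g x).
Proof.
move=> [f1 f2] [g1 g2]; split.
  rewrite (_ : (fun _ => _) = fun x => complex.Re (f x) * complex.Re (g x) +
     - (complex.Im (f x) * complex.Im (g x))); last by apply: funext => x; rewrite ReM.
  by apply: smoothD; [apply: smoothM | apply/smoothN/smoothM].
rewrite (_ : (fun _ => _) = fun x => complex.Re (f x) * complex.Im (g x) +
   complex.Im (f x) * complex.Re (g x)); last by apply: funext => x; rewrite ImM.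
by apply: smoothD; apply: smoothM.
Qed.

Lemma csmoothZ c f : csmooth f -> csmooth (fun x => c * f x).
Proof. by move=> sf; apply: csmoothM => //; apply: csmooth_cst. Qed.

Lemma csmooth_sum (I : Type) (r : seq I) (P : pred I) (f : I -> R3 -> C) :
  (forall i, P i -> csmooth (f i)) -> csmooth (fun x => \sum_(i <- r | P i) f i x).
Proof.
move=> H; elim: r => [|i r IH].
  rewrite (_ : (fun _ => _) = fun=> 0); first exact: csmooth_cst.
  by apply: funext => y; rewrite big_nil.
rewrite (_ : (fun _ => _) = fun y => if P i then f i y + \sum_(j <- r | P j) f j y
    else \sum_(j <- r | P j) f j y); last by apply: funext => y; rewrite big_cons.
by case: (P i) (H i) => // Hi; apply: csmoothD => //; apply: Hi.
Qed.

Lemma csmoothB f g : csmooth f -> csmooth g -> csmooth (fun x => f x - g x).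
Proof.
move=> sf sg; rewrite (_ : (fun _ => _) = fun x => f x + -1 * g x).
  by apply: csmoothD => //; apply: csmoothZ.
by apply: funext => x; rewrite mulN1r.
Qed.

Lemma csmoothX f n : csmooth f -> csmooth (fun x => f x ^+ n).
Proof.
move=> sf; elim: n => [|n IH]; first exact: (csmooth_cst 1).
rewrite (_ : (fun _ => _) = fun x => f x * f x ^+ n); first exact: csmoothM.
by apply: funext => x; rewrite exprS.
Qed.

Lemma csmooth_coord i : csmooth (fun x => (x i 0)%:C%C).
Proof. exact/csmooth_real/smooth_coord. Qed.

Lemma csmooth_cpartial f i : csmooth f -> csmooth (cpartial i f).
Proof. by move=> [f1 f2]; split; apply: smooth_partial. Qed.

Lemma is_cderive_dir f x v : csmooth f ->
  is_cderive x v f (\sum_i (v i 0)%:C%C * cpartial i f x).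
Proof.
have H (h : R3 -> R) : smooth h -> is_derive x v h (\sum_i v i 0 * 'D_(evec i) h x).
  move=> sh; rewrite -derive_evec; last exact: smooth_diff.
  exact/derivableP/diff_derivable/smooth_diff.
move=> [f1 f2]; split.
  rewrite (big_morph _ ReD (erefl _)); under eq_bigr do rewrite ReM /= mul0r subr0.
  exact: H.
rewrite (big_morph _ ImD (erefl _)); under eq_bigr do rewrite ImM /= mul0r addr0.
exact: H.
Qed.

Lemma is_cderive_partial f x i : csmooth f -> is_cderive x (evec i) f (cpartial i f x).
Proof.
move=> sf; have := is_cderive_dir x (evec i) sf.
rewrite (bigD1 i) //= big1 ?addr0; last by move=> k ki; rewrite !mxE (negbTE ki) mul0r.
by rewrite !mxE !eqxx mul1r.
Qed.

Lemma is_cderive_curve f (k : R -> R3) (t : R) (v : R3) : csmooth f ->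
  (forall i, is_derive t (1 : R) (fun s => k s i 0) (v i 0)) ->
  is_cderive t (1 : R) (fun s => f (k s)) (\sum_i (v i 0)%:C%C * cpartial i f (k t)).
Proof.
move=> sf kv; have [D1 D2] := is_cderive_dir (k t) v sf.
case: sf => s1 s2; split.
  case: D1 => _ <-; apply: (is_derive_curve kv); exact: smooth_diff.
case: D2 => _ <-; apply: (is_derive_curve kv); exact: smooth_diff.
Qed.

Lemma cpartialD f g i x : csmooth f -> csmooth g ->
  cpartial i (fun x => f x + g x) x = cpartial i f x + cpartial i g x.
Proof. by move=> sf sg; apply/is_cderive_val/is_cderiveD; apply: is_cderive_partial. Qed.

Lemma cpartialM f g i x : csmooth f -> csmooth g ->
  cpartial i (fun x => f x * g x) x = cpartial i f x * g x + f x * cpartial i g x.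
Proof. by move=> sf sg; apply/is_cderive_val/is_cderiveM; apply: is_cderive_partial. Qed.

Lemma cpartialZ f c i x : csmooth f ->
  cpartial i (fun x => c * f x) x = c * cpartial i f x.
Proof. by move=> sf; apply/is_cderive_val/is_cderiveZ; apply: is_cderive_partial. Qed.

Lemma cpartial_sum (I : Type) (r : seq I) (P : pred I) (f : I -> R3 -> C) i x :
  (forall j, csmooth (f j)) ->
  cpartial i (fun x => \sum_(j <- r | P j) f j x) x = \sum_(j <- r | P j) cpartial i (f j) x.
Proof. by move=> sf; apply/is_cderive_val/is_cderive_sum => j _; apply: is_cderive_partial. Qed.

Lemma cpartial_cst c i x : cpartial i (fun=> c) x = 0.
Proof. exact/is_cderive_val/is_cderive_cst. Qed.

Lemma cpartial_coord i j x : cpartial i (fun x => (x j 0)%:C%C) x = (i == j)%:R.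
Proof.
have D := derivableP (diff_derivable (v := evec i) (differentiable_coord x j 0)).
apply: (etrans (is_cderive_val (is_cderive_real D))).
by rewrite derive_coord !mxE eqxx andbT eq_sym; case: eqP.
Qed.

Lemma csmooth_sqnorm : csmooth (fun x => (sqnorm x)%:C%C).
Proof. exact/csmooth_real/smooth_sqnorm. Qed.

Lemma cpartial_sqnorm i x : cpartial i (fun x => (sqnorm x)%:C%C) x = 2 * (x i 0)%:C%C.
Proof.
have D := derivableP (diff_derivable (v := evec i) (differentiable_sqnorm x)).
apply: (etrans (is_cderive_val (is_cderive_real D))).
rewrite derive_sqnorm (bigD1 i) //= big1 ?addr0; last first.
  by move=> k ki; rewrite !mxE (negbTE ki) mul0r.
by rewrite !mxE !eqxx mul1r rmorphM /= rmorph_nat.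
Qed.

(** The restriction of f to the line of direction v has an even smooth part. *)
Lemma csmooth_even_radial f v : csmooth f ->
  csmooth (fun x => (f (Num.sqrt (sqnorm x) *: v) + f (- Num.sqrt (sqnorm x) *: v)) / 2).
Proof.
have H (h : R3 -> R) : smooth h ->
    smooth (fun x => h (Num.sqrt (sqnorm x) *: v) + h (- Num.sqrt (sqnorm x) *: v)).
  move=> sh; apply: (@smooth_radial _ (fun r => h (r *: v) + h (- r *: v))); split.
    apply: smooth1D; first exact: smooth_line.
    rewrite (_ : (fun _ => _) = fun r : R => h (r *: - v)); first exact: smooth_line.
    by apply: funext => r; rewrite scalerN scaleNr.
  by move=> r; rewrite opprK addrC.
move=> [f1 f2]; rewrite (_ : (fun _ => _) = fun x => 2^-1 *
    (f (Num.sqrt (sqnorm x) *: v) + f (- Num.sqrt (sqnorm x) *: v))); last first.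
  by apply: funext => x; rewrite mulrC.
apply: csmoothZ; split.
  rewrite [X in smooth X](_ : _ = fun x => complex.Re (f (Num.sqrt (sqnorm x) *: v)) +
    complex.Re (f (- Num.sqrt (sqnorm x) *: v))); first exact: (H _ f1).
  by apply: funext => x; rewrite ReD.
rewrite [X in smooth X](_ : _ = fun x => complex.Im (f (Num.sqrt (sqnorm x) *: v)) +
    complex.Im (f (- Num.sqrt (sqnorm x) *: v))); first exact: (H _ f2).
by apply: funext => x; rewrite ImD.
Qed.

End CSmooth.

(** * Derivatives of curves and the exponential of so(3) *)

Section CurveDeriv.
Context {R : realType}.
Local Notation C := R[i].

(** Curves that are finite sums of scalar functions times fixed vectors, with their derivative at 0.
No topology on the vector space is involved, and it may be infinite-dimensional. *)
Inductive sepder (V : lmodType C) : (R -> V) -> V -> Prop :=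
| sepder0 : sepder (fun=> 0) 0
| sepder_term q dq v : is_cderive (0 : R) (1 : R) q dq ->
    sepder (fun t => q t *: v) (dq *: v)
| sepderD P Q dP dQ : sepder P dP -> sepder Q dQ ->
    sepder (fun t => P t + Q t) (dP + dQ).

Lemma sepder_eq (V : lmodType C) (P Q : R -> V) dP dQ :
  P =1 Q -> dP = dQ -> sepder P dP -> sepder Q dQ.
Proof. by move=> /funext -> ->. Qed.

Lemma sepder_cst (V : lmodType C) (v : V) : sepder (fun=> v) 0.
Proof.
apply: sepder_eq (sepder_term v (is_cderive_cst (0 : R) (1 : R) 1)) => [t|].
  by rewrite scale1r.
by rewrite scale0r.
Qed.

Lemma sepder_lin (V W : lmodType C) (f : {linear V -> W}) (P : R -> V) dP :
  sepder P dP -> sepder (fun t => f (P t)) (f dP).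
Proof.
elim=> {P dP} [|q dq v qd|P Q dP dQ _ IHP _ IHQ].
- by apply: sepder_eq (sepder0 W) => [t|]; rewrite linear0.
- by apply: sepder_eq (sepder_term (f v) qd) => [t|]; rewrite linearZ.
- by apply: sepder_eq (sepderD IHP IHQ) => [t|]; rewrite linearD.
Qed.

Lemma sepder_sum (V : lmodType C) (I : Type) (r : seq I) (P : I -> R -> V) dP :
  (forall i, sepder (P i) (dP i)) ->
  sepder (fun t => \sum_(i <- r) P i t) (\sum_(i <- r) dP i).
Proof.
move=> H; elim: r => [|i r IH].
  by apply: sepder_eq (sepder0 V) => [t|]; rewrite big_nil.
by apply: sepder_eq (sepderD (H i) IH) => [t|]; rewrite big_cons.
Qed.

Lemma sepderM (A : comAlgType C) (P Q : R -> A) dP dQ :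
  sepder P dP -> sepder Q dQ ->
  sepder (fun t => P t * Q t) (dP * Q 0 + P 0 * dQ).
Proof.
elim=> {P dP} [|q dq v qd|P P' dP dP' _ IHP _ IHP'] hQ.
- by apply: sepder_eq (sepder0 A) => [t|]; rewrite ?mul0r ?addr0.
- elim: hQ => {Q dQ} [|r dr w rd|Q Q' dQ dQ' _ IHQ _ IHQ'].
  + by apply: sepder_eq (sepder0 A) => [t|]; rewrite ?mulr0 ?addr0.
  + apply: sepder_eq (sepder_term (v * w) (is_cderiveM qd rd)) => [t|].
      by rewrite -scalerAl -scalerAr scalerA.
    by rewrite scalerDl -!scalerAl -!scalerAr !scalerA.
  + apply: sepder_eq (sepderD IHQ IHQ') => [t|]; first by rewrite mulrDr.
    by rewrite !mulrDr addrACA.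
- apply: sepder_eq (sepderD (IHP hQ) (IHP' hQ)) => [t|]; first by rewrite mulrDl.
  by rewrite !mulrDl addrACA.
Qed.

Lemma sepder_scalar (V : lmodType C) (f : V -> C) (P : R -> V) dP :
  (forall c u v, f (c *: u + v) = c * f u + f v) ->
  sepder P dP -> is_cderive (0 : R) (1 : R) (fun t => f (P t)) (f dP).
Proof.
move=> fl; have f0 : f 0 = 0.
  by have := fl 1 0 0; rewrite scale1r mul1r addr0 => /eqP; rewrite -subr_eq0 opprD addrA addrN add0r oppr_eq0 => /eqP.
have fZ c u : f (c *: u) = c * f u by rewrite -[c *: u]addr0 fl f0 addr0.
have fD u v : f (u + v) = f u + f v by rewrite -{1}[u]scale1r fl mul1r.
elim=> {P dP} [|q dq v qd|P Q dP dQ _ IHP _ IHQ].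
- by rewrite f0; apply: is_cderive_cst.
- rewrite (_ : (fun t => _) = fun t => f v * q t); last first.
    by apply: funext => t; rewrite fZ mulrC.
  rewrite fZ mulrC; exact: is_cderiveZ.
- rewrite (_ : (fun t => _) = fun t => f (P t) + f (Q t)); last first.
    by apply: funext => t; rewrite fD.
  rewrite fD; exact: is_cderiveD.
Qed.

Lemma vderive_sepder (W : vectType C) (P : R -> W) dP : sepder P dP ->
  vderive P (1 : R) (0 : R) = dP.
Proof.
move=> h; rewrite [RHS](coord_vbasis (memvf dP)).
apply: eq_bigr => i _; congr (_ *: _).
apply: is_cderive_val; apply: sepder_scalar h => c u v; exact: linearP.
Qed.

Lemma sepder_End (V : vectType C) (P : R -> 'End(V)) (dP : V -> V) :
  (forall v, sepder (fun t => P t v) (dP v)) -> exists d, sepder P d.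
Proof.
move=> hP; pose X := vbasis {:V}.
exists (\sum_b rank1 X b (dP X`_b)).
have D b := sepder_lin (rank1 X b) (hP X`_b).
apply: sepder_eq (sepder_sum _ D) => // t.
by rewrite [RHS](rank1_sum _ (vbasisP _)).
Qed.

(** The coefficients separate polynomials, and scalar derivatives are unique. *)
Lemma sepder_mpoly_unique (P : R -> mpoly.mpoly 3 C) dP dQ :
  sepder P dP -> sepder P dQ -> dP = dQ.
Proof.
move=> hP hQ; apply/eqP; rewrite -subr_eq0; apply/eqP/mcoeff_sep => u.
rewrite mpoly.mcoeffB.
have L c (p q : mpoly.mpoly 3 C) : mpoly.mcoeff u (c *: p + q) =
    c * mpoly.mcoeff u p + mpoly.mcoeff u q by rewrite mpoly.mcoeffD mpoly.mcoeffZ.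
apply/eqP; rewrite subr_eq0; apply/eqP.
exact: is_cderive_unique (sepder_scalar L hP) (sepder_scalar L hQ).
Qed.

End CurveDeriv.

Section Exponential.
Context {R : realType}.
Local Notation C := R[i].

(** The rotation exp (t Y_i), grouped so that the power series of sin t and cos t can be
recognized. *)
Definition rotc (i : 'I_3) (t : R) : 'M[R]_3 :=
  1%:M + so3Y i *m so3Y i + (sin t *: so3Y i - cos t *: (so3Y i *m so3Y i)).

Lemma so3Y_cube i : so3Y i *m so3Y i *m so3Y i = - so3Y i :> 'M[R]_3.
Proof.
by elim/ord3P: i; apply: matrix3P; split; rewrite so3YE /mx3 !(mxE, sum3) /=; ring.
Qed.

Lemma so3Y_tr i : (so3Y i)^T = - so3Y i :> 'M[R]_3.
Proof.
by elim/ord3P: i; apply: matrix3P; split; rewrite so3YE /mx3 !(mxE, sum3) /=; ring.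
Qed.

Lemma so3Y_pow i n : (so3Y i : 'M[R]_3) ^+ n.+1 =
  if odd n then (-1) ^+ n./2 *: (so3Y i *m so3Y i) else (-1) ^+ n./2 *: so3Y i.
Proof.
elim: n => [|n IH]; first by rewrite /= expr1 expr0 scale1r.
rewrite exprSr IH [n.+1./2]/= uphalf_half [odd n.+1]/=; case: (odd n) => /=.
  rewrite -[_ * _]/(_ *m _) -scalemxAl so3Y_cube add1n exprS mulN1r scaleNr.
  by rewrite scalerN.
by rewrite add0n -[_ * _]/(_ *m _) -scalemxAl.
Qed.

(** Since Y_i^3 = - Y_i, the powers of Y_i are periodic up to sign from the first one on. *)
Lemma series_expmx i (t : R) n :
  series (fun n => (n`!%:R)^-1 *: (t *: so3Y i : 'M[R]_3) ^+ n) n.+1 =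
  1%:M + so3Y i *m so3Y i +
  (series (sin_coeff t) n.+1 *: so3Y i - series (cos_coeff t) n.+1 *: (so3Y i *m so3Y i)).
Proof.
elim: n => [|n IH].
  rewrite /series /= !big_nat1 /sin_coeff /cos_coeff /= !fact0 !expr0 !mul0r !mul1r.
  by rewrite invr1 scale0r !scale1r add0r addrK.
have S (V : zmodType) (u : nat -> V) : series u n.+2 = series u n.+1 + u n.+1.
  by rewrite /series /= big_nat_recr.
rewrite S IH !S exprZn so3Y_pow /sin_coeff /cos_coeff /=.
rewrite -addrA; congr (_ + _); rewrite !scalerDl opprD addrACA; congr (_ + _).
have N (a b : R) : a / b = b^-1 * a by rewrite mulrC.
case: (odd n) (odd_double_half n) => /= En.
  rewrite !mul0r scale0r add0r !scalerA mul1r -scaleNr; congr (_ *: _).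
  rewrite uphalf_half -(addn1 n) /=.
  have -> : (odd n + n./2)%N = n./2.+1 by rewrite -En /= odd_double; lia.
rewrite -exprnP exprS N; ring.
by rewrite !mul0r scale0r subr0 !scalerA mul1r; congr (_ *: _); rewrite N; ring.
Qed.

Lemma expmx_rotc i (t : R) : expmx (t *: so3Y i) = rotc i t.
Proof.
rewrite /expmx; apply: cvg_lim => //.
rewrite -(cvg_shiftS _) /=.
rewrite (_ : (fun n => _) = fun n => 1%:M + so3Y i *m so3Y i +
  (series (sin_coeff t) n.+1 *: so3Y i - series (cos_coeff t) n.+1 *: (so3Y i *m so3Y i))); last first.
  by apply: funext => n; apply: series_expmx.
apply: cvgD; first exact: cvg_cst.
apply: cvgB; apply: cvgZr_tmp.
  rewrite (cvg_shiftS (series (sin_coeff t))) unlock; exact: is_cvg_series_sin_coeff.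
rewrite (cvg_shiftS (series (cos_coeff t))) unlock; exact: is_cvg_series_cos_coeff.
Qed.

Lemma rotc0 i : rotc i 0 = 1%:M.
Proof. by rewrite /rotc sin0 cos0 scale0r scale1r add0r addrK. Qed.

Lemma rotcE (t : R) :
  (rotc 0 t = mx3 [:: [:: 1; 0; 0]; [:: 0; cos t; sin t]; [:: 0; - sin t; cos t]]) *
  (rotc 1 t = mx3 [:: [:: cos t; 0; - sin t]; [:: 0; 1; 0]; [:: sin t; 0; cos t]]) *
  (rotc 2%:R t = mx3 [:: [:: cos t; sin t; 0]; [:: - sin t; cos t; 0]; [:: 0; 0; 1]]).
Proof.
by split; first split; apply: matrix3P; split; rewrite /rotc so3YE /mx3 !(mxE, sum3) /=; ring.
Qed.

Lemma SO3_rotc i (t : R) : SO3 (rotc i t).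
Proof.
have cs : sin t ^+ 2 = 1 - cos t ^+ 2 by rewrite -(cos2Dsin2 t); ring.
elim/ord3P: i; rewrite rotcE; (split; last by rewrite det3 !mxE /=; ring: cs);
by apply: matrix3P; split; rewrite !(mxE, sum3) /=; ring: cs.
Qed.

Lemma is_derive_rotc i (a b : 'I_3) :
  is_derive (0 : R) (1 : R) (fun t => rotc i t a b) (so3Y i a b).
Proof.
pose Y2 : 'M[R]_3 := so3Y i *m so3Y i.
rewrite (_ : (fun t => _) = cst ((1%:M + Y2) a b) + (so3Y i a b \*: @sin R - Y2 a b \*: @cos R)).
  have D := is_deriveD (is_derive_cst ((1%:M + Y2) a b) (0 : R) (1 : R))
    (is_deriveB (is_deriveZ (so3Y i a b) (is_derive_sin (0 : R)))
                (is_deriveZ (Y2 a b) (is_derive_cos (0 : R)))).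
  apply: (is_derive_eq D).
  by rewrite sin0 cos0 /GRing.scale /= add0r oppr0 mulr0 subr0 mulr1.
apply: funext => t; rewrite /rotc -/Y2 !mxE.
by rewrite /GRing.scale /= [sin t * _]mulrC [cos t * _]mulrC.
Qed.

End Exponential.

(** * The derived representation *)

Section Dtau.
Context {R : realType}.
Local Notation C := R[i].
Variable m : nat.
Local Notation V := (subvs_of (@harm R m)).

Lemma sepder_rowform i j :
  sepder (fun t => rowform (invmx (@rotc R i t)) j) (- rowform (so3Y i) j).
Proof.
have D l : sepder (fun t => (@rotc R i t l j)%:C%C *: (mpoly.mpolyX _ (mpoly.mnm1 l) : mpoly.mpoly 3 C))
    ((so3Y i l j)%:C%C *: mpoly.mpolyX _ (mpoly.mnm1 l)).
  by apply: sepder_term; apply: is_cderive_real; apply: is_derive_rotc.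
apply: sepder_eq (sepder_sum (index_enum 'I_3) D) => [t|].
  rewrite (SO3_inv (SO3_rotc i t)) rowformE; apply: eq_bigr => l _; by rewrite [_^T _ _]mxE.
rewrite rowformE -sumrN; apply: eq_bigr => l _.
have := congr1 (fun M : 'M[R]_3 => M j l) (so3Y_tr i); rewrite !mxE => ->.
by rewrite rmorphN scaleNr.
Qed.

Lemma sepder_rot i p : sepder (fun t => rot (@rotc R i t) p) (lie (so3Y i) p).
Proof.
apply: (@rot_deriv _ _ (@rotc R i) 0 (so3Y i) (@sepder R _)).
- exact: rotc0.
- exact: sepder_cst.
- exact: sepder_rowform.
- exact: sepderD.
- exact: sepderM.
- exact: sepder_eq.
Qed.

Definition tau_coef (k : 'M[R]_3) (v : V) : V := vsproj (harm m) (homproj m (rot k (pval v))).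

Lemma tau_coefE k v : tau m k v = tau_coef k v.
Proof. by rewrite /tau_coef /tau lfunE /= roth_homproj rotE. Qed.

Lemma sepder_tau i : exists d : 'End(V), sepder (fun t : R => tau m (rotc i t)) d.
Proof.
apply: (@sepder_End R V _ (fun v => vsproj (harm m) (homproj m (lie (so3Y i) (pval v))))) => v.
have H := sepder_lin (vsproj (harm m)) (sepder_lin (homproj m) (sepder_rot i (pval v))).
apply: sepder_eq H => [t|]; last exact: erefl.
exact: (esym (tau_coefE (rotc i t) v)).
Qed.

Definition eval_pval (v : V) (f : 'End(V)) : mpoly.mpoly 3 C := pval (f v).
Fact eval_pval_linear v : linear (eval_pval v).
Proof. by move=> c f g; rewrite /eval_pval !lfunE /= lfunE linearP. Qed.
HB.instance Definition _ v := GRing.isLinear.Build C 'End(V) (mpoly.mpoly 3 C) _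
  (eval_pval v) (eval_pval_linear v).

Lemma dtau_sepder i : sepder (fun t : R => tau m (rotc i t)) (@dtau R m (so3Y i)).
Proof.
have [d hd] := sepder_tau i.
have F : (fun t : R => tau m (expmx (t *: so3Y i))) = (fun t : R => tau m (rotc i t)).
  by apply: funext => t; rewrite expmx_rotc.
have E : @dtau R m (so3Y i) = vderive (fun t : R => tau m (rotc i t)) (1 : R) (0 : R).
  exact: (f_equal (fun f => vderive f (1 : R) (0 : R)) F).
have E2 := vderive_sepder hd.
rewrite E.
rewrite E2.
exact: hd.
Qed.

(** Both sides are the derivative at t = 0 of the same curve of polynomials, exp (t Y_i) acting
on v. *)
Lemma pval_dtau i v : pval (@dtau R m (so3Y i) v) = lie (so3Y i) (pval v).
Proof.
have D := sepder_lin (eval_pval v) (dtau_sepder i).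
apply: (sepder_mpoly_unique D).
apply: sepder_eq (sepder_rot i (pval v)) => // t.
rewrite /= /eval_pval. rewrite pval_tau ?rotE //; exact: SO3_rotc.
Qed.

Definition Top (i : 'I_3) : 'End(V) := locked_with seal (@dtau R m (so3Y i)).

Lemma TopE i : Top i = @dtau R m (so3Y i).
Proof. by rewrite /Top unlock. Qed.

Definition tauop (k : 'M[R]_3) : 'End(V) := locked_with seal (tau m k).

Lemma tauopE k : tauop k = tau m k.
Proof. by rewrite /tauop unlock. Qed.

Lemma pval_Top i v : pval (Top i v) = lie (so3Y i) (pval v).
Proof. by rewrite TopE pval_dtau. Qed.

Lemma pval_tauop k v : SO3 k -> pval (tauop k v) = rot k (pval v).
Proof. by move=> hk; rewrite tauopE pval_tau ?rotE. Qed.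

Lemma Top_comm i j k (c : R) v :
  so3Y i *m so3Y j - so3Y j *m so3Y i = c *: so3Y k :> 'M[R]_3 ->
  Top i (Top j v) - Top j (Top i v) = c%:C%C *: Top k v.
Proof.
move=> H; apply: pval_inj.
have -> : pval (c%:C%C *: Top k v) = c%:C%C *: pval (Top k v) by exact: linearZ.
have -> : pval (Top i (Top j v) - Top j (Top i v)) =
  pval (Top i (Top j v)) - pval (Top j (Top i v)) by exact: linearB.
have E a b : pval (Top a (Top b v)) = lie (so3Y a) (lie (so3Y b) (pval v)).
  exact: (etrans (pval_Top a (Top b v)) (congr1 (lie (so3Y a)) (pval_Top b v))).
apply: etrans (congr2 (fun p q => p - q) (E i j) (E j i)) _.
apply: etrans (lie_comm (so3Y i) (so3Y j) (pval v)) _.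
apply: etrans (congr1 (fun A => lie A (pval v)) H) _.
exact: (etrans (lieZ c (so3Y k) (pval v)) (congr1 (fun p => c%:C%C *: p) (esym (pval_Top k v)))).
Qed.

Lemma dtauR3E x : dtauR3 m x = \sum_i (x i 0)%:C%C *: Top i.
Proof. by rewrite /dtauR3; apply: eq_bigr => i _; rewrite TopE. Qed.

Definition Aop (x : 'cV[R]_3) : 'End(V) := locked_with seal (dtauR3 m x).

Lemma AopE x : Aop x = \sum_i (x i 0)%:C%C *: Top i.
Proof. by rewrite /Aop unlock dtauR3E. Qed.

Lemma pval_Aop x v : pval (Aop x v) = lie (crossmx x) (pval v).
Proof.
rewrite AopE.
have L : eval_pval v (\sum_i (x i 0)%:C%C *: Top i) = \sum_i (x i 0)%:C%C *: eval_pval v (Top i).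
  apply: etrans (linear_sum _ _ _ _) _.
  by apply: eq_bigr => i _; exact: linearZ.
apply: etrans L _.
apply: etrans (eq_bigr _ (fun i _ => congr1 (fun p => (x i 0)%:C%C *: p) (pval_Top i v))) _.
by rewrite /crossmx !sum3 !lieD !lieZ.
Qed.

(** The equivariance of the derived representation, from that of the cross product. *)
Lemma tauop_Aop k x v : SO3 k -> tauop k (Aop x v) = Aop (k *m x) (tauop k v).
Proof.
move=> hk; apply: pval_inj.
apply: etrans (pval_tauop (Aop x v) hk) _.
apply: etrans (congr1 (rot k) (pval_Aop x v)) _.
apply: etrans (rot_lie (crossmx x) (pval v) hk) _.
apply: etrans (congr1 (fun A => lie A (rot k (pval v))) (crossmx_conj x hk)) _.
apply: esym; apply: etrans (pval_Aop (k *m x) (tauop k v)) _.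
exact: (congr1 (lie _) (pval_tauop v hk)).
Qed.

Lemma tauop_inj k : SO3 k -> lker (tauop k) == 0%VS.
Proof.
move=> hk; apply/lker0P => u v uv; apply: pval_inj.
have K w : rot k^T (pval (tauop k w)) = pval w.
  exact: (etrans (congr1 (rot k^T) (pval_tauop w hk)) (rotK (pval w) hk)).
exact: (etrans (esym (K u)) (etrans (congr1 (fun w => rot k^T (pval w)) uv) (K v))).
Qed.

Lemma dim_V : (\dim {:V} <= (2 * m).+1)%N.
Proof. by rewrite dimvf /dim /= dim_harm. Qed.
End Dtau.

(** * Matrix-valued functions and the polynomials Q_j *)

Section MatrixCalculus.
Context {R : realType} {n : nat}.
Local Notation C := R[i].
Local Notation R3 := 'cV[R]_3.
Local Notation mat := 'M[C]_n.+1.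
Implicit Types (G H : R3 -> mat) (x : R3).

Definition msmooth G := forall i j, csmooth (fun x => G x i j).

Definition mpart (a : 'I_3) G x : mat := \matrix_(i, j) cpartial a (fun y => G y i j) x.

Lemma msmooth_ext G H : G =1 H -> msmooth G -> msmooth H.
Proof. by move=> /funext ->. Qed.

Lemma msmooth_cst (K : mat) : msmooth (fun=> K).
Proof. by move=> i j; apply: csmooth_cst. Qed.

Lemma msmoothD G H : msmooth G -> msmooth H -> msmooth (fun x => G x + H x).
Proof.
move=> sG sH i j; rewrite (_ : (fun _ => _) = fun x => G x i j + H x i j).
  exact: csmoothD.
by apply: funext => x; rewrite mxE.
Qed.

Lemma msmoothZ (c : R3 -> C) G : csmooth c -> msmooth G -> msmooth (fun x => c x *: G x).
Proof.
move=> sc sG i j; rewrite (_ : (fun _ => _) = fun x => c x * G x i j).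
  exact: csmoothM.
by apply: funext => x; rewrite mxE.
Qed.

Lemma msmoothM G H : msmooth G -> msmooth H -> msmooth (fun x => G x * H x).
Proof.
move=> sG sH i j; rewrite (_ : (fun _ => _) = fun x => \sum_k G x i k * H x k j).
  by apply: csmooth_sum => k _; apply: csmoothM.
by apply: funext => x; rewrite mxE.
Qed.

Lemma msmooth_mpart a G : msmooth G -> msmooth (mpart a G).
Proof.
move=> sG i j; rewrite (_ : (fun _ => _) = cpartial a (fun y => G y i j)).
  exact: csmooth_cpartial.
by apply: funext => x; rewrite mxE.
Qed.

Lemma mpart_cst a (K : mat) x : mpart a (fun=> K) x = 0.
Proof. by apply/matrixP => i j; rewrite !mxE cpartial_cst. Qed.

Lemma mpartD a G H x : msmooth G -> msmooth H ->
  mpart a (fun x => G x + H x) x = mpart a G x + mpart a H x.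
Proof.
move=> sG sH; apply/matrixP => i j; rewrite !mxE -cpartialD //.
by congr (cpartial a _ x); apply: funext => y; rewrite mxE.
Qed.

Lemma mpartZ a (c : R3 -> C) G x : csmooth c -> msmooth G ->
  mpart a (fun x => c x *: G x) x = cpartial a c x *: G x + c x *: mpart a G x.
Proof.
move=> sc sG; apply/matrixP => i j; rewrite !mxE -cpartialM //.
by congr (cpartial a _ x); apply: funext => y; rewrite mxE.
Qed.

Lemma mpartM a G H x : msmooth G -> msmooth H ->
  mpart a (fun x => G x * H x) x = mpart a G x * H x + G x * mpart a H x.
Proof.
move=> sG sH; apply/matrixP => i j; rewrite !mxE -big_split /=.
under [RHS]eq_bigr do rewrite !mxE -cpartialM //.
rewrite -cpartial_sum => [|k]; last exact: csmoothM.
by congr (cpartial a _ x); apply: funext => y; rewrite mxE.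
Qed.

Lemma mpart_scale a (c : C) G x : msmooth G ->
  mpart a (fun x => c *: G x) x = c *: mpart a G x.
Proof.
move=> sG; rewrite (mpartZ a x (csmooth_cst c) sG) cpartial_cst scale0r add0r //.
Qed.

Lemma mpart_mull a (K : mat) G x : msmooth G ->
  mpart a (fun x => K * G x) x = K * mpart a G x.
Proof.
by move=> sG; rewrite (mpartM a x (msmooth_cst K) sG) mpart_cst mul0r add0r.
Qed.

Lemma mpart_mulr a (K : mat) G x : msmooth G ->
  mpart a (fun x => G x * K) x = mpart a G x * K.
Proof.
by move=> sG; rewrite (mpartM a x sG (msmooth_cst K)) mpart_cst mulr0 addr0.
Qed.

Definition smooth_comb (B : nat -> R3 -> mat) (dom : R3 -> Prop) d G :=
  exists2 c : nat -> R3 -> C, (forall i, csmooth (c i)) &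
    forall x, dom x -> G x = \sum_(i < d) c i x *: B i x.

Section SmoothComb.
Variables (B : nat -> R3 -> mat) (dom : R3 -> Prop).

Lemma smooth_comb_ext d G H : (forall x, dom x -> G x = H x) ->
  smooth_comb B dom d G -> smooth_comb B dom d H.
Proof. by move=> E [c sc Ec]; exists c => // x dx; rewrite -E // Ec. Qed.

Lemma smooth_comb0 d : smooth_comb B dom d (fun=> 0).
Proof.
exists (fun _ _ => 0) => [i|x _]; first exact: csmooth_cst.
by rewrite big1 // => i _; rewrite scale0r.
Qed.

Lemma smooth_combD d G H : smooth_comb B dom d G -> smooth_comb B dom d H ->
  smooth_comb B dom d (fun x => G x + H x).
Proof.
move=> [c sc Ec] [e se Ee]; exists (fun i x => c i x + e i x) => [i|x dx].
  exact: csmoothD.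
by rewrite Ec // Ee // -big_split; apply: eq_bigr => i _; rewrite scalerDl.
Qed.

Lemma smooth_combZ d (a : R3 -> C) G : csmooth a -> smooth_comb B dom d G ->
  smooth_comb B dom d (fun x => a x *: G x).
Proof.
move=> sa [c sc Ec]; exists (fun i x => a x * c i x) => [i|x dx]; first exact: csmoothM.
by rewrite Ec // scaler_sumr; apply: eq_bigr => i _; rewrite scalerA.
Qed.

Lemma smooth_comb_sum d (I : Type) (r : seq I) (P : pred I) (G : I -> R3 -> mat) :
  (forall i, P i -> smooth_comb B dom d (G i)) ->
  smooth_comb B dom d (fun x => \sum_(i <- r | P i) G i x).
Proof.
move=> H; elim: r => [|i r IH].
  by apply: smooth_comb_ext (smooth_comb0 d) => x _; rewrite big_nil.
case Pi : (P i); last by apply: smooth_comb_ext IH => x _; rewrite big_cons Pi.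
by apply: smooth_comb_ext (smooth_combD (H i Pi) IH) => x _; rewrite big_cons Pi.
Qed.

Lemma smooth_comb_mono d e G : (d <= e)%N -> smooth_comb B dom d G -> smooth_comb B dom e G.
Proof.
move=> de [c sc Ec]; exists (fun i x => if (i < d)%N then c i x else 0) => [i|x dx].
  by case: (i < d)%N => //; apply: csmooth_cst.
rewrite Ec // (big_ord_widen e (fun i => c i x *: B i x) de) big_mkcond /=.
by apply: eq_bigr => i _; case: ifP; rewrite ?scale0r.
Qed.

Lemma smooth_comb_base i d : (i < d)%N -> smooth_comb B dom d (B i).
Proof.
move=> id; exists (fun j _ => (j == i)%:R) => [j|x _]; first exact: csmooth_cst.
rewrite (bigD1 (Ordinal id)) //= eqxx scale1r big1 ?addr0 // => j ji.
by rewrite (_ : (_ == _) = false) ?scale0r //; apply: contraNF ji => /eqP e; apply/eqP/val_inj.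
Qed.
End SmoothComb.

(** Change of the family B: a triangular base change is enough, as the coefficients form an
algebra. *)
Lemma smooth_comb_trans B B' dom d e G :
  (forall i, (i < d)%N -> smooth_comb B' dom e (B i)) ->
  smooth_comb B dom d G -> smooth_comb B' dom e G.
Proof.
move=> H [c sc Ec]; apply: (@smooth_comb_ext _ _ _ (fun x => \sum_(i < d) c i x *: B i x)).
  by move=> x /Ec.
by apply: smooth_comb_sum => i _; apply: smooth_combZ => //; apply: H.
Qed.

End MatrixCalculus.

Section Filtration.
Context {R : realType} {n : nat}.
Local Notation C := R[i].
Local Notation R3 := 'cV[R]_3.
Local Notation mat := 'M[C]_n.+1.
Variables (T : 'I_3 -> mat) (c : C).
Hypothesis T01 : T 0 * T 1 - T 1 * T 0 = - T 2%:R.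
Hypothesis T12 : T 1 * T 2%:R - T 2%:R * T 1 = - T 0.
Hypothesis T20 : T 2%:R * T 0 - T 0 * T 2%:R = - T 1.
Hypothesis casimir : T 0 * T 0 + T 1 * T 1 + T 2%:R * T 2%:R = c%:M.
Implicit Types (G H : R3 -> mat) (x : R3).

Definition Amx x : mat := \sum_i (x i 0)%:C%C *: T i.
Let rho x : C := (sqnorm x)%:C%C.

Lemma msmooth_Amx : msmooth Amx.
Proof.
apply: (@msmooth_ext _ _ (fun x => (x 0 0)%:C%C *: T 0 + (x 1 0)%:C%C *: T 1 +
  (x 2%:R 0)%:C%C *: T 2%:R)); first by move=> x; rewrite /Amx sum3.
by do 2?apply: msmoothD; apply: msmoothZ (msmooth_cst _); apply: csmooth_coord.
Qed.

Lemma mpart_Amx a x : mpart a Amx x = T a.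
Proof.
have E : Amx = fun x => (x 0 0)%:C%C *: T 0 + (x 1 0)%:C%C *: T 1 + (x 2%:R 0)%:C%C *: T 2%:R.
  by apply: funext => y; rewrite /Amx sum3.
have S i : msmooth (fun x => (x i 0)%:C%C *: T i).
  by apply: msmoothZ (msmooth_cst _); apply: csmooth_coord.
have D i y : mpart a (fun x => (x i 0)%:C%C *: T i) y = (a == i)%:R *: T i.
  rewrite (mpartZ a y (csmooth_coord i) (msmooth_cst _)) mpart_cst scaler0 addr0.
  by rewrite cpartial_coord.
rewrite E mpartD //; last exact: msmoothD.
rewrite mpartD // !D.
by move: a D; elim/ord3P => _; rewrite /= !(scale1r, scale0r) ?addr0 ?add0r.
Qed.

Definition brkmx i x : mat := T i * Amx x - Amx x * T i.

Lemma T10_swap : T 1 * T 0 = T 0 * T 1 + T 2%:R.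
Proof. by rewrite -[T 2%:R]opprK -T01 opprB addrC subrK. Qed.
Lemma T21_swap : T 2%:R * T 1 = T 1 * T 2%:R + T 0.
Proof. by rewrite -[T 0]opprK -T12 opprB addrC subrK. Qed.
Lemma T20_swap : T 2%:R * T 0 = T 0 * T 2%:R - T 1.
Proof. by rewrite -T20 addrC subrK. Qed.

Lemma mat_ext (X Y : mat) : (forall i j, X i j = Y i j) -> X = Y.
Proof. by move=> E; apply/matrixP. Qed.

Lemma Amx3 x : Amx x = (x 0 0)%:C%C *: T 0 + (x 1 0)%:C%C *: T 1 + (x 2%:R 0)%:C%C *: T 2%:R.
Proof. by rewrite /Amx sum3. Qed.

Lemma brkmxE x :
  (brkmx 0 x = (x 2%:R 0)%:C%C *: T 1 - (x 1 0)%:C%C *: T 2%:R) *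
  (brkmx 1 x = (x 0 0)%:C%C *: T 2%:R - (x 2%:R 0)%:C%C *: T 0) *
  (brkmx 2%:R x = (x 1 0)%:C%C *: T 0 - (x 0 0)%:C%C *: T 1).
Proof.
split; first split; rewrite /brkmx Amx3 !(mulrDl, mulrDr) -!scalerAl -!scalerAr ?T10_swap ?T21_swap ?T20_swap;
  move: (T 0 * T 0) (T 0 * T 1) (T 0 * T 2%:R) (T 1 * T 1) (T 1 * T 2%:R) (T 2%:R * T 2%:R) => ? ? ? ? ? ?;
  move: (x 0 0)%:C%C (x 1 0)%:C%C (x 2%:R 0)%:C%C => ? ? ?;
  move: (T 0) (T 1) (T 2%:R) => ? ? ?;
  apply: mat_ext => i j; rewrite !mxE; ring.
Qed.

Lemma rho3 x : rho x = (x 0 0)%:C%C ^+ 2 + (x 1 0)%:C%C ^+ 2 + (x 2%:R 0)%:C%C ^+ 2.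
Proof. by rewrite /rho /sqnorm sum3 !rmorphD !rmorphXn. Qed.

(** The brackets [T_i, A(x)] are the components of a cross product of T and x; this is the
double cross product formula. *)
Lemma brkmx_comm i x : brkmx i x * Amx x - Amx x * brkmx i x = (x i 0)%:C%C *: Amx x - rho x *: T i.
Proof.
have E j l (a b : C) : (a *: T j - b *: T l) * Amx x - Amx x * (a *: T j - b *: T l) =
    a *: brkmx j x - b *: brkmx l x.
  rewrite mulrBl mulrBr -!scalerAl -!scalerAr opprD addrACA -scalerBr; congr (_ + _).
  by rewrite -opprD -scalerBr.
have F : forall j, brkmx j x * Amx x - Amx x * brkmx j x = (x j 0)%:C%C *: Amx x - rho x *: T j.
  elim/ord3P.
  - rewrite brkmxE. rewrite E. rewrite !brkmxE. rewrite rho3. rewrite Amx3.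
    move: (x 0 0)%:C%C (x 1 0)%:C%C (x 2%:R 0)%:C%C => a b d.
    move: (T 0) (T 1) (T 2%:R) => ? ? ?.
    apply: mat_ext => k l. rewrite !mxE. ring.
  - rewrite brkmxE. rewrite E. rewrite !brkmxE. rewrite rho3. rewrite Amx3.
    move: (x 0 0)%:C%C (x 1 0)%:C%C (x 2%:R 0)%:C%C => a b d.
    move: (T 0) (T 1) (T 2%:R) => ? ? ?.
    apply: mat_ext => k l. rewrite !mxE. ring.
  - rewrite brkmxE. rewrite E. rewrite !brkmxE. rewrite rho3. rewrite Amx3.
    move: (x 0 0)%:C%C (x 1 0)%:C%C (x 2%:R 0)%:C%C => a b d.
    move: (T 0) (T 1) (T 2%:R) => ? ? ?.
    apply: mat_ext => k l. rewrite !mxE. ring.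
exact: F.
Qed.

Lemma sum_brkmx_T x : \sum_i brkmx i x * T i = Amx x.
Proof.
have E (a b : C) j k l : (a *: T j - b *: T k) * T l = a *: (T j * T l) - b *: (T k * T l).
  by rewrite mulrBl -!scalerAl.
rewrite sum3 !brkmxE.
apply: etrans (congr2 +%R (congr2 +%R (E _ _ 1 2%:R 0) (E _ _ 2%:R 0 1)) (E _ _ 0 1 2%:R)) _.
rewrite Amx3 T10_swap T21_swap T20_swap.
move: (T 0 * T 0) (T 0 * T 1) (T 0 * T 2%:R) (T 1 * T 1) (T 1 * T 2%:R) (T 2%:R * T 2%:R) => ? ? ? ? ? ?.
move: (x 0 0)%:C%C (x 1 0)%:C%C (x 2%:R 0)%:C%C => ? ? ?.
move: (T 0) (T 1) (T 2%:R) => ? ? ?.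
apply: mat_ext => k l; rewrite !mxE; ring.
Qed.

Lemma sum_x_brkmx x : \sum_i (x i 0)%:C%C *: brkmx i x = 0.
Proof.
rewrite sum3 !brkmxE.
move: (x 0 0)%:C%C (x 1 0)%:C%C (x 2%:R 0)%:C%C => ? ? ?.
move: (T 0) (T 1) (T 2%:R) => ? ? ?.
apply: mat_ext => k l; rewrite !mxE; ring.
Qed.

Definition Dmx G x : mat := \sum_i T i * mpart i G x.
(** The first-order operator that appears when D is commuted with the multiplication by A(x). *)
Definition Dbrk G x : mat := \sum_i brkmx i x * mpart i G x.
Definition eulermx G x : mat := \sum_i (x i 0)%:C%C *: mpart i G x.

Lemma mpart_AG i G x : msmooth G ->
  mpart i (fun x => Amx x * G x) x = T i * G x + Amx x * mpart i G x.
Proof. by move=> sG; rewrite (mpartM i x msmooth_Amx sG) mpart_Amx. Qed.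

Lemma mpart_rhoG i G x : msmooth G ->
  mpart i (fun x => rho x *: G x) x = (2 * (x i 0)%:C%C) *: G x + rho x *: mpart i G x.
Proof. by move=> sG; rewrite (mpartZ i x csmooth_sqnorm sG) cpartial_sqnorm. Qed.

Lemma Dmx_AG G x : msmooth G ->
  Dmx (fun x => Amx x * G x) x = c *: G x + Amx x * Dmx G x + Dbrk G x.
Proof.
move=> sG; rewrite /Dmx; under eq_bigr do rewrite mpart_AG // mulrDr !mulrA.
rewrite big_split /= -mulr_suml sum3 casimir -addrA; congr (_ + _).
  by rewrite -[_ * _]/(_ *m _) mul_scalar_mx.
rewrite mulr_sumr /Dbrk -big_split; apply: eq_bigr => i _ /=.
by rewrite /brkmx mulrA mulrBl addrC subrK.
Qed.

Lemma Dbrk_AG G x : msmooth G ->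
  Dbrk (fun x => Amx x * G x) x =
  Amx x * G x + Amx x * Dbrk G x + Amx x * eulermx G x - rho x *: Dmx G x.
Proof.
move=> sG; rewrite /Dbrk; under eq_bigr do rewrite mpart_AG // mulrDr !mulrA.
rewrite big_split /= -mulr_suml sum_brkmx_T -!addrA; congr (_ + _).
rewrite /eulermx /Dmx !mulr_sumr scaler_sumr -sumrB -big_split; apply: eq_bigr => i _ /=.
have -> : brkmx i x * Amx x = Amx x * brkmx i x + ((x i 0)%:C%C *: Amx x - rho x *: T i).
  by rewrite -brkmx_comm addrC subrK.
by rewrite mulrDl mulrBl -!scalerAl -scalerAr !mulrA.
Qed.

Lemma eulermx_AG G x : msmooth G ->
  eulermx (fun x => Amx x * G x) x = Amx x * G x + Amx x * eulermx G x.
Proof.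
move=> sG; rewrite /eulermx; under eq_bigr do rewrite mpart_AG // scalerDr scalerAl.
rewrite big_split /= -mulr_suml; congr (_ + _).
by rewrite mulr_sumr; apply: eq_bigr => i _; rewrite scalerAr.
Qed.

Lemma Dmx_rhoG G x : msmooth G ->
  Dmx (fun x => rho x *: G x) x = 2 *: (Amx x * G x) + rho x *: Dmx G x.
Proof.
move=> sG; rewrite /Dmx; under eq_bigr do rewrite mpart_rhoG // mulrDr.
rewrite big_split /=; congr (_ + _); last first.
  by rewrite scaler_sumr; apply: eq_bigr => i _; rewrite scalerAr.
rewrite /Amx mulr_suml scaler_sumr; apply: eq_bigr => i _.
by rewrite -scalerAl scalerA -scalerAr.
Qed.

Lemma Dbrk_rhoG G x : msmooth G ->
  Dbrk (fun x => rho x *: G x) x = rho x *: Dbrk G x.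
Proof.
move=> sG; rewrite /Dbrk; under eq_bigr do rewrite mpart_rhoG // mulrDr.
rewrite big_split /=; rewrite [X in X + _](_ : _ = 0) ?add0r; last first.
  under eq_bigr do rewrite -scalerAr -scalerA scalerAl.
  by rewrite -scaler_sumr -mulr_suml sum_x_brkmx mul0r scaler0.
by rewrite scaler_sumr; apply: eq_bigr => i _; rewrite scalerAr.
Qed.

Lemma eulermx_rhoG G x : msmooth G ->
  eulermx (fun x => rho x *: G x) x = 2 *: (rho x *: G x) + rho x *: eulermx G x.
Proof.
move=> sG; rewrite /eulermx; under eq_bigr do rewrite mpart_rhoG // scalerDr.
rewrite big_split /=; congr (_ + _); last first.
  by rewrite scaler_sumr; apply: eq_bigr => i _; rewrite !scalerA mulrC.
rewrite sum3 rho3.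
move: (x 0 0)%:C%C (x 1 0)%:C%C (x 2%:R 0)%:C%C => ? ? ?.
move: (mpart 0 G x) (mpart 1 G x) (mpart 2%:R G x) (G x) => ? ? ? ?.
apply: mat_ext => k l; rewrite !mxE; ring.
Qed.

(** Combinations of |x|^(2a) A(x)^b with 2a + b < k.  With this shift level 0 is zero, and D
lowers the level by one without exception. *)
Inductive filt : nat -> (R3 -> mat) -> Prop :=
| filt0 k : filt k (fun=> 0)
| filt1 k : filt k.+1 (fun=> 1)
| filtZ k (a : C) G : filt k G -> filt k (fun x => a *: G x)
| filtD k G H : filt k G -> filt k H -> filt k (fun x => G x + H x)
| filtA k G : filt k G -> filt k.+1 (fun x => Amx x * G x)
| filt_rho k G : filt k G -> filt k.+2 (fun x => rho x *: G x).

Lemma filt_ext k G H : G =1 H -> filt k G -> filt k H.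
Proof. by move=> /funext ->. Qed.

Lemma filt_zero k G : filt k G -> k = 0%N -> forall x, G x = 0.
Proof.
elim=> {k G} [k|k|k a G _ IH|k G H _ IHG _ IHH|k G _ IH|k G _ IH] k0 x.
- by [].
- by discriminate k0.
- by rewrite (IH k0 x) scaler0.
- by rewrite (IHG k0 x) (IHH k0 x) addr0.
- by discriminate k0.
- by discriminate k0.
Qed.

Lemma filt_msmooth k G : filt k G -> msmooth G.
Proof.
elim=> {k G} [k|k|k a G _ IH|k G H _ IHG _ IHH|k G _ IH|k G _ IH].
- exact: msmooth_cst.
- exact: msmooth_cst.
- by apply: msmoothZ => //; apply: csmooth_cst.
- exact: msmoothD.
- by apply: msmoothM => //; apply: msmooth_Amx.
- by apply: msmoothZ => //; apply: csmooth_sqnorm.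
Qed.

Lemma filt_rho_pred k G : filt k.-1 G -> filt k.+1 (fun x => rho x *: G x).
Proof.
case: k => [|k] /= fG; last exact: filt_rho.
by apply: filt_ext (filt0 1) => x; rewrite (filt_zero fG erefl) scaler0.
Qed.

Lemma filtA_pred k G : filt k.-1 G -> filt k (fun x => Amx x * G x).
Proof.
case: k => [|k] /= fG; last exact: filtA.
by apply: filt_ext (filt0 0) => x; rewrite (filt_zero fG erefl) mulr0.
Qed.

(** The three operators have to be treated together: D (A G) involves [Dbrk] G, and [Dbrk] (A G)
involves the Euler operator and |x|^2 D G. *)
Lemma filt_diff k G : filt k G ->
  [/\ filt k.-1 (Dmx G), filt k (Dbrk G) & filt k (eulermx G)].
Proof.
elim=> {k G} [k|k|k a G fG [D D' E]|k G H fG [DG D'G EG] fH [DH D'H EH]|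
  k G fG [D D' E]|k G fG [D D' E]].
- split; apply: filt_ext (filt0 _) => x; rewrite /Dmx /Dbrk /eulermx big1 // => i _;
    by rewrite mpart_cst ?mulr0 ?scaler0.
- split; apply: filt_ext (filt0 _) => x; rewrite /Dmx /Dbrk /eulermx big1 // => i _;
    by rewrite mpart_cst ?mulr0 ?scaler0.
- have sG := filt_msmooth fG.
  split; [apply: filt_ext (filtZ a D)|apply: filt_ext (filtZ a D')|apply: filt_ext (filtZ a E)]
    => x; rewrite /Dmx /Dbrk /eulermx scaler_sumr; apply: eq_bigr => i _;
    by rewrite mpart_scale // ?scalerAr // !scalerA mulrC.
- have sG := filt_msmooth fG; have sH := filt_msmooth fH.
  split; [apply: filt_ext (filtD DG DH)|apply: filt_ext (filtD D'G D'H)|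
    apply: filt_ext (filtD EG EH)] => x; rewrite /Dmx /Dbrk /eulermx -big_split;
    apply: eq_bigr => i _ /=; by rewrite mpartD // ?mulrDr ?scalerDr.
- have sG := filt_msmooth fG; split.
  + apply: filt_ext (filtD (filtD (filtZ c fG) (filtA_pred D)) D') => x.
    by rewrite Dmx_AG.
  + apply: filt_ext (filtD (filtD (filtD (filtA fG) (filtA D')) (filtA E))
      (filtZ (-1) (filt_rho_pred D))) => x.
    by rewrite Dbrk_AG // scaleN1r.
  + by apply: filt_ext (filtD (filtA fG) (filtA E)) => x; rewrite eulermx_AG.
- have sG := filt_msmooth fG; split.
  + apply: filt_ext (filtD (filtZ 2 (filtA fG)) (filt_rho_pred D)) => x.
    by rewrite Dmx_rhoG.
  + by apply: filt_ext (filt_rho D') => x; rewrite Dbrk_rhoG.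
  + by apply: filt_ext (filtD (filtZ 2 (filt_rho fG)) (filt_rho E)) => x; rewrite eulermx_rhoG.
Qed.

Fixpoint Qmx (j : nat) : R3 -> mat :=
  match j with
  | 0 => fun=> 1
  | j'.+1 =>
    match j' with
    | 0 => Amx
    | _ => fun x => Amx x * Qmx j' x - (sqnorm x / (2 * j' + 1)%N%:R)%:C%C *: Dmx (Qmx j') x
    end
  end.

Lemma filt_pow j : filt j.+1 (fun x => Amx x ^+ j).
Proof.
elim: j => [|j IH]; first exact: filt1.
by apply: filt_ext (filtA IH) => x; rewrite exprS.
Qed.

(** In the recursion D Q_j comes with the factor |x|^2, and it has lost one level, so that the
remainder stays |x|^2 times an element of the right level. *)
Lemma Qmx_lead j : exists2 G, filt j G & forall x, Qmx j.+1 x = Amx x ^+ j.+1 + rho x *: G x.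
Proof.
elim: j => [|j [G fG EG]].
  by exists (fun=> 0) => [|x]; [apply: filt0 | rewrite scaler0 addr0 expr1].
have fQ : filt j.+2 (Qmx j.+1).
  by apply: filt_ext (filtD (filt_pow j.+1) (filt_rho fG)) => x; rewrite EG.
have [fD _ _] := filt_diff fQ.
exists (fun x => Amx x * G x + (- (2 * j.+1 + 1)%N%:R^-1) *: Dmx (Qmx j.+1) x).
  by apply: filtD; [apply: filtA | apply: filtZ].
move=> x; rewrite [LHS]/= -/(Qmx j.+1) EG mulrDr -exprS -addrA; congr (_ + _).
rewrite scalerDr -scalerAr; congr (_ + _).
by rewrite scalerA mulrN scaleNr rmorphM fmorphV rmorph_nat.
Qed.

Let powers i x := Amx x ^+ i.
Let everywhere (x : R3) := True.

Lemma smooth_comb_mulA dom d G : smooth_comb powers dom d G ->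
  smooth_comb powers dom d.+1 (fun x => Amx x * G x).
Proof.
move=> [e se Ee]; exists (fun i => if i is i'.+1 then e i' else fun=> 0) => [[|i]|x dx] //.
  exact: csmooth_cst.
rewrite Ee // big_ord_recl scale0r add0r mulr_sumr.
by apply: eq_bigr => i _; rewrite -scalerAr /powers -exprS.
Qed.

Lemma filt_smooth_comb k G : filt k G -> smooth_comb powers everywhere k G.
Proof.
elim=> {k G} [k|k|k a G _ IH|k G H _ IHG _ IHH|k G _ IH|k G _ IH].
- exact: smooth_comb0.
- by apply: smooth_comb_ext (@smooth_comb_base _ _ powers _ 0 k.+1 _) => // x _; rewrite /powers expr0.
- by apply: smooth_combZ => //; apply: csmooth_cst.
- exact: smooth_combD.
- exact: smooth_comb_mulA.
- apply: smooth_combZ; first exact: csmooth_sqnorm.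
  by apply: smooth_comb_mono IH; rewrite leqW.
Qed.

(** The base change of [Qmx_lead] is unitriangular. *)
Lemma powers_Qmx j : smooth_comb Qmx everywhere j.+1 (powers j).
Proof.
have [k] := ubnP j; elim: k j => // k IH j jk.
case: j jk => [|j] jk.
  by apply: smooth_comb_ext (@smooth_comb_base _ _ Qmx _ 0 1 _) => // x _; rewrite /powers expr0.
have [G fG EG] := Qmx_lead j.
have S1 : smooth_comb Qmx everywhere j.+2 (Qmx j.+1) by apply: smooth_comb_base.
have S2 : smooth_comb Qmx everywhere j.+2 G.
  apply: (@smooth_comb_trans _ _ powers Qmx _ j); last exact: filt_smooth_comb.
  move=> i ij; apply: (@smooth_comb_mono _ _ _ _ i.+1); first by lia.
  by apply: IH; lia.
have S3 := smooth_combZ (csmoothZ (-1) csmooth_sqnorm) S2.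
apply: smooth_comb_ext (smooth_combD S1 S3) => x _.
by rewrite EG mulN1r scaleNr addrK.
Qed.

Lemma smooth_comb_powers_Qmx d G : smooth_comb powers everywhere d G ->
  smooth_comb Qmx everywhere d G.
Proof.
apply: smooth_comb_trans => i id; apply: (@smooth_comb_mono _ _ _ _ i.+1) => //.
exact: powers_Qmx.
Qed.

End Filtration.

(** * Equivariant functions on the third axis *)

Section Axis.
Context {R : realType} {m : nat}.
Local Notation C := R[i].
Local Notation R3 := 'cV[R]_3.
Local Notation N := (2 * m).+1.
Local Notation mat := 'M[C]_((2 * m).+1).
Variables (T : 'I_3 -> mat) (M : R3 -> mat).
Let Jmx : mat := - ('i%C *: T 0 + T 1).
Hypothesis T2_diag : forall i j, T 2%:R i j = ('i%C * (m%:R - (j : nat)%:R)) *+ (i == j).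
Hypothesis Jmx_shift : forall i (j : 'I_N), (j < 2 * m)%N -> Jmx i j = (i == j.+1 :> nat)%:R.
Hypothesis M_smooth : msmooth M.
Hypothesis M_inf : forall i x, \sum_a ((so3Y i *m x) a 0)%:C%C *: mpart a M x = T i * M x - M x * T i.
Implicit Types (G H : R3 -> mat) (x : R3).

Let ii : 'i%C * 'i%C = -1 :> C.
Proof. by rewrite -expr2 sqr_i. Qed.

Lemma M_inf0 x :
  (x 2%:R 0)%:C%C *: mpart 1 M x - (x 1 0)%:C%C *: mpart 2%:R M x = T 0 * M x - M x * T 0.
Proof.
rewrite -M_inf sum3 so3YE /mx3 !(mxE, sum3) /= !(mul0r, mul1r, mulN1r, add0r, addr0).
by rewrite rmorph0 scale0r add0r rmorphN scaleNr.
Qed.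

Lemma M_inf1 x :
  (x 0 0)%:C%C *: mpart 2%:R M x - (x 2%:R 0)%:C%C *: mpart 0 M x = T 1 * M x - M x * T 1.
Proof.
rewrite -M_inf sum3 so3YE /mx3 !(mxE, sum3) /= !(mul0r, mul1r, mulN1r, add0r, addr0).
by rewrite rmorph0 scale0r addr0 rmorphN scaleNr addrC.
Qed.

Definition zbar x : C := (x 0 0)%:C%C - 'i%C * (x 1 0)%:C%C.

(** The vector field by which the bracket with the lowering operator acts on an equivariant
function. *)
Definition Lminus G x : mat :=
  (x 2%:R 0)%:C%C *: (mpart 0 G x - 'i%C *: mpart 1 G x) - zbar x *: mpart 2%:R G x.

Lemma Lminus_M x : Lminus M x = Jmx * M x - M x * Jmx.
Proof.
have -> : Jmx * M x - M x * Jmx =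
    - ('i%C *: (T 0 * M x - M x * T 0) + (T 1 * M x - M x * T 1)).
  rewrite /Jmx mulNr mulrN mulrDl mulrDr -scalerAl -scalerAr scalerBr !opprD !opprK.
  by rewrite addrACA.
rewrite -(M_inf0 x) -(M_inf1 x) /Lminus /zbar.
move: (mpart 0 M x) (mpart 1 M x) (mpart 2%:R M x) => ? ? ?.
move: (x 0 0)%:C%C (x 1 0)%:C%C (x 2%:R 0)%:C%C => ? ? ?.
apply/matrixP => i j; rewrite !mxE; ring: ii.
Qed.

Lemma csmooth_zbar : csmooth zbar.
Proof.
by apply: csmoothB; last apply: csmoothZ; apply: csmooth_coord.
Qed.

Lemma msmoothN G : msmooth G -> msmooth (fun x => - G x).
Proof.
move=> sG; apply: (@msmooth_ext _ _ (fun x => (-1) *: G x)).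
  by move=> x; rewrite scaleN1r.
by apply: msmoothZ => //; apply: csmooth_cst.
Qed.

Lemma msmooth_Lminus G : msmooth G -> msmooth (Lminus G).
Proof.
move=> sG; apply: msmoothD.
  apply: msmoothZ; first exact: csmooth_coord.
  apply: msmoothD; first exact: msmooth_mpart.
  apply/msmoothN/msmoothZ; [exact: csmooth_cst | exact: msmooth_mpart].
apply/msmoothN/msmoothZ; [exact: csmooth_zbar | exact: msmooth_mpart].
Qed.

Lemma mpartB a G H x : msmooth G -> msmooth H ->
  mpart a (fun x => G x - H x) x = mpart a G x - mpart a H x.
Proof.
move=> sG sH; rewrite mpartD //; last exact: msmoothN.
rewrite -scaleN1r -mpart_scale //; congr (_ + mpart a _ x).
by apply: funext => y; rewrite scaleN1r.
Qed.

Definition adJ G x : mat := Jmx * G x - G x * Jmx.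

Definition adM (j : nat) : R3 -> mat := iter j adJ M.

Lemma msmooth_adJ G : msmooth G -> msmooth (adJ G).
Proof.
by move=> sG; apply: msmoothD; last apply: msmoothN; apply: msmoothM => //; apply: msmooth_cst.
Qed.

Lemma msmooth_adM j : msmooth (adM j).
Proof. by elim: j => //= j; apply: msmooth_adJ. Qed.

Lemma Lminus_adJ G x : msmooth G -> Lminus (adJ G) x = adJ (Lminus G) x.
Proof.
move=> sG; have S1 : msmooth (fun x => Jmx * G x) by apply: msmoothM => //; apply: msmooth_cst.
have S2 : msmooth (fun x => G x * Jmx) by apply: msmoothM => //; apply: msmooth_cst.
pose f (u : mat) := Jmx * u - u * Jmx.
have fB u v : f (u - v) = f u - f v.
  by rewrite /f mulrBr mulrBl opprD opprK addrACA; congr (_ + _); rewrite opprB addrC.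
have fZ a u : f (a *: u) = a *: f u by rewrite /f -scalerAr -scalerAl scalerBr.
have D i : mpart i (adJ G) x = f (mpart i G x).
  by rewrite /adJ mpartB // mpart_mull // mpart_mulr.
by rewrite /Lminus !D -[RHS]/(f _) fB !fZ fB fZ.
Qed.

Lemma Lminus_adM j x : Lminus (adM j) x = adM j.+1 x.
Proof.
elim: j x => [|j IH] x; first exact: Lminus_M.
rewrite [adM j.+1]/= Lminus_adJ; last exact: msmooth_adM.
by rewrite /adJ IH.
Qed.

Definition dminus (j : nat) : R3 -> mat :=
  iter j (fun G x => mpart 0 G x - 'i%C *: mpart 1 G x) M.

Lemma msmooth_dminus j : msmooth (dminus j).
Proof.
elim: j => //= j IH; apply: msmoothD; first exact: msmooth_mpart.
by apply/msmoothN/msmoothZ; [exact: csmooth_cst | exact: msmooth_mpart].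
Qed.

Lemma cpartial_coordX a j x : a != 2%:R ->
  cpartial a (fun x : R3 => (x 2%:R 0)%:C%C ^+ j) x = 0.
Proof.
move=> a2; elim: j x => [|j IH] x; first exact: (cpartial_cst 1).
have -> : (fun x : R3 => (x 2%:R 0)%:C%C ^+ j.+1) =
    (fun x => (x 2%:R 0)%:C%C * (x 2%:R 0)%:C%C ^+ j).
  by apply: funext => y; rewrite exprS.
rewrite cpartialM ?IH; [|exact: csmooth_coord|exact/csmoothX/csmooth_coord].
by rewrite cpartial_coord (negbTE a2) mul0r mulr0 addr0.
Qed.

Lemma cpartial_zbar x : (cpartial 0 zbar x = 1) * (cpartial 1 zbar x = - 'i%C) *
  (cpartial 2%:R zbar x = 0).
Proof.
have E a : cpartial a zbar x = (a == 0)%:R - 'i%C * (a == 1)%:R.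
  have -> : zbar = fun x => (x 0 0)%:C%C + (- 'i%C) * (x 1 0)%:C%C.
    by apply: funext => y; rewrite /zbar mulNr.
  rewrite cpartialD; [|exact: csmooth_coord|exact/csmoothZ/csmooth_coord].
  by rewrite cpartialZ ?cpartial_coord ?mulNr //; apply: csmooth_coord.
by rewrite !E /= !mulr0 !mulr1 !subr0 sub0r.
Qed.

(** As d_0 - i d_1 kills x_0 - i x_1 and x_2, every term of the j-th power of the vector field
except x_2^j (d_0 - i d_1)^j keeps a factor x_0 - i x_1, which vanishes on the third axis. *)
Lemma adM_dminus j : exists2 S, msmooth S &
  forall x, adM j x = (x 2%:R 0)%:C%C ^+ j *: dminus j x + zbar x *: S x.
Proof.
elim: j => [|j [S sS E]].
  exists (fun=> 0) => [|x]; first exact: msmooth_cst.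
  by rewrite expr0 scale1r scaler0 addr0.
pose H x := (x 2%:R 0)%:C%C ^+ j *: dminus j x.
have sc : csmooth (fun x : R3 => (x 2%:R 0)%:C%C ^+ j) by apply/csmoothX/csmooth_coord.
have sP := msmooth_dminus j.
have sH : msmooth H by apply: msmoothZ.
exists (fun x => Lminus S x - mpart 2%:R H x) => [|x].
  by apply: msmoothD; [exact: msmooth_Lminus | exact/msmoothN/msmooth_mpart].
rewrite -Lminus_adM; have -> : adM j = fun x => H x + zbar x *: S x by apply: funext.
have sz := csmooth_zbar; have szS : msmooth (fun x => zbar x *: S x) by apply: msmoothZ.
rewrite /Lminus !mpartD // !(mpartZ _ _ sz sS) !cpartial_zbar.
rewrite [mpart 0 H x](mpartZ 0 x sc sP) [mpart 1 H x](mpartZ 1 x sc sP) !cpartial_coordX //.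
rewrite [dminus j.+1]/= exprS.
move: (mpart 0 (dminus j) x) (mpart 1 (dminus j) x) (dminus j x) (mpart 2%:R H x) => ? ? ? ?.
move: (mpart 0 S x) (mpart 1 S x) (mpart 2%:R S x) (S x) => ? ? ? ?.
move: ((x 2%:R 0)%:C%C ^+ j) (x 2%:R 0)%:C%C (zbar x) => ? ? ?.
apply/matrixP => k l; rewrite !mxE; ring: ii.
Qed.

Lemma evec2 (r : R) : ((r *: evec 2%:R) 0 0 = 0) * ((r *: evec 2%:R) 1 0 = 0) *
  ((r *: evec 2%:R) 2%:R 0 = r).
Proof. by rewrite !mxE /= !mulr0 mulr1. Qed.

Lemma adM_axis j (r : R) :
  adM j (r *: evec 2%:R) = (r%:C%C) ^+ j *: dminus j (r *: evec 2%:R).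
Proof.
have [S _ ->] := adM_dminus j.
by rewrite /zbar !evec2 rmorph0 mulr0 subr0 scale0r addr0.
Qed.

(** The third axis is fixed by the rotations generated by T_2, and T_2 has simple eigenvalues. *)
Lemma M_axis_diag (r : R) i j : i != j -> M (r *: evec 2%:R) i j = 0.
Proof.
set D := M _ => ij.
have /matrixP/(_ i j) : T 2%:R * D - D * T 2%:R = 0.
  rewrite -M_inf big1 // => a _.
  have -> : (so3Y 2%:R *m (r *: evec 2%:R)) a 0 = 0.
    rewrite mxE sum3 !evec2 !mulr0 !add0r so3YE /mx3 mxE.
    by elim/ord3P: a; rewrite /= mul0r.
  by rewrite rmorph0 scale0r.
rewrite !mxE (bigD1 i) //= big1 ?addr0 => [|k ki]; last first.
  by rewrite T2_diag eq_sym (negbTE ki) mulr0n mul0r.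
rewrite (bigD1 j) //= big1 ?addr0 => [|k kj]; last first.
  by rewrite T2_diag (negbTE kj) mulr0n mulr0.
rewrite !T2_diag !eqxx !mulr1n [D i j * _]mulrC -mulrBl -mulrBr.
have -> : m%:R - (i : nat)%:R - (m%:R - (j : nat)%:R) = (j : nat)%:R - (i : nat)%:R :> C by ring.
move/eqP; rewrite !mulf_eq0 subr_eq0 eqr_nat.
rewrite [(j : nat) == i]eq_sym -[(i : nat) == j]/(i == j) (negbTE ij) orbF.
case/orP => /eqP // i0; have := ii; rewrite i0 mul0r => /eqP.
by rewrite eq_sym oppr_eq0 oner_eq0.
Qed.

(** (-1)^j times the j-th forward difference of f at k. *)
Fixpoint bdiff (f : nat -> C) (j k : nat) : C :=
  if j is j'.+1 then bdiff f j' k - bdiff f j' k.+1 else f k.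

Lemma bdiff_newton f p i k : (k < p)%N ->
  bdiff f i k = \sum_(j < p) 'C(k, j)%:R * (-1) ^+ j * bdiff f (i + j) 0.
Proof.
elim: k i => [|k IH] i kp.
  case: p kp => // p _; rewrite big_ord_recl big1 ?addr0 => [|j _].
    by rewrite bin0 expr0 !mul1r addn0.
  by rewrite bin0n /= !mul0r.
have -> : bdiff f i k.+1 = bdiff f i k - bdiff f i.+1 k by rewrite /= opprB addrC subrK.
rewrite !IH ?(ltnW kp) //; case: p kp {IH} => // p kp.
rewrite [in RHS]big_ord_recl [X in X - _]big_ord_recl /= !bin0 -addrA; congr (_ + _).
rewrite [X in _ - X]big_ord_recr /= bin_small ?mul0r ?addr0 //.
rewrite -sumrB; apply: eq_bigr => j _.
rewrite /bump /= add1n binS natrD exprS addnS ?addSn /=; ring.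
Qed.

(** The bracket of a shift with a diagonal matrix takes differences along the diagonal. *)
Lemma adM_entry (r : R) j k i (hk : (k + j <= 2 * m)%N) :
  adM j (r *: evec 2%:R) i (inord k) =
  bdiff (fun k => M (r *: evec 2%:R) (inord k) (inord k)) j k *+ (i == (k + j)%N :> nat).
Proof.
elim: j k i hk => [|j IH] k i hk.
  rewrite addn0; have [e|ne] := eqVneq (i : nat) k.
    by rewrite mulr1n /= -e !inord_val.
  rewrite mulr0n; apply: M_axis_diag; apply: contraNneq ne => ->.
  by rewrite inordK // ltnS; lia.
set D := M _ in IH *; set f := fun k : nat => _ in IH *.
rewrite [adM j.+1]/= /adJ !mxE.
have lt1 : (k + j < N)%N by lia.
rewrite (bigD1 (Ordinal lt1)) //= big1 ?addr0 => [|l lk]; last first.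
  rewrite IH; last lia.
  rewrite (_ : (_ == _) = false) ?mulr0n ?mulr0 //; apply: contraNF lk => /eqP e.
  exact/eqP/val_inj.
have lt2 : (k.+1 < N)%N by lia.
rewrite (bigD1 (Ordinal lt2)) //= big1 ?addr0 => [|l lk]; last first.
  rewrite Jmx_shift; last by rewrite inordK; lia.
  rewrite inordK; last lia.
  by rewrite (_ : (_ == _) = false) ?mulr0 //; apply: contraNF lk => /eqP e; apply/eqP/val_inj.
rewrite IH; last lia.
have E : Ordinal lt2 = inord k.+1 by apply: val_inj; rewrite /= inordK.
rewrite E IH; last lia.
rewrite /= eqxx mulr1n !Jmx_shift /=; [|rewrite inordK; lia|lia].
rewrite !inordK //; try lia.
rewrite eqxx mulr1 addnS addSn; case: (_ == _); first by rewrite mul1r !mulr1n.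
by rewrite mul0r !mulr0n subr0.
Qed.

Lemma M_axis_newton (r : R) (k : 'I_N) : M (r *: evec 2%:R) k k =
  \sum_(j < N) 'C(k, j)%:R * (-1) ^+ j * ((r%:C%C) ^+ j * dminus j (r *: evec 2%:R) j 0).
Proof.
pose f (k : nat) := M (r *: evec 2%:R) (inord k) (inord k).
have := @bdiff_newton f N 0 k (ltn_ord k); rewrite [bdiff f 0 k]/= /f inord_val => ->.
apply: eq_bigr => j _; congr (_ * _).
have h : (0 + j <= 2 * m)%N by rewrite add0n -ltnS.
have := adM_entry r j h; rewrite add0n eqxx mulr1n => <-.
rewrite adM_axis mxE; congr (_ * dminus _ _ _ _); apply: val_inj; rewrite /= inordK //.
Qed.

Definition axis x := exists r : R, x = r *: evec 2%:R.
Let powers i x := Amx T x ^+ i.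

Definition ffactmx (j : nat) x : mat :=
  (x 2%:R 0)%:C%C ^+ j *: \matrix_(a, b) (((a : nat) ^_ j)%:R *+ (a == b)).

(** The matrix diag(0, ..., 2m) is m + i T_2, so the step from j to j + 1 multiplies the matrix by
r (m - j) + i r T_2, which is affine in A(r e_3) = r T_2. *)
Lemma ffactmx_comb j : smooth_comb powers axis j.+1 (ffactmx j).
Proof.
elim: j => [|j IH].
  apply: smooth_comb_ext (@smooth_comb_base _ _ powers _ 0 1 _) => // x _.
  rewrite /ffactmx /powers !expr0 scale1r; apply/matrixP => a b; rewrite !mxE ffactn0.
  by case: (a == b).
have S1 : smooth_comb powers axis j.+2 (ffactmx j) by apply: smooth_comb_mono IH.
have sc : csmooth (fun x : R3 => (m%:R - j%:R) * (x 2%:R 0)%:C%C).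
  by apply: csmoothZ; apply: csmooth_coord.
have S2 := smooth_combZ (csmooth_cst 'i%C) (smooth_comb_mulA IH).
apply: smooth_comb_ext (smooth_combD (smooth_combZ sc S1) S2) => x [r ->].
have -> : Amx T (r *: evec 2%:R) = r%:C%C *: T 2%:R.
  by rewrite Amx3 !evec2 rmorph0 !scale0r !add0r.
rewrite /ffactmx !evec2; apply/matrixP => a b.
rewrite -scalerAl -scalerAr !mxE (bigD1 b) //= big1 ?addr0 => [|l lb]; last first.
  by rewrite mxE (negbTE lb) mulr0n mulr0.
rewrite mxE T2_diag eqxx mulr1n; have [->|ab] := eqVneq a b; last first.
  by rewrite !mulr0n mul0r !mulr0 addr0.
rewrite !mulr1n ffactnSr; have [lt|ge] := ltnP b j.
  by rewrite ffact_small // mul0n !mulr0 addr0.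
rewrite natrM natrB // exprS; ring: ii.
Qed.

(** Newton's interpolation; the binomial coefficients are falling factorials divided by j!. *)
Lemma M_axis_comb : smooth_comb powers axis N M.
Proof.
apply: (@smooth_comb_ext _ _ _ _ _ (fun x => \sum_(j < N)
   (((-1) ^+ j / (j `!)%:R) * dminus j x j 0) *: ffactmx j x)).
  move=> x [r ->]; apply/matrixP => a b; rewrite summxE.
  have [<-|ab] := eqVneq a b; last first.
    rewrite M_axis_diag // big1 // => j _.
    by rewrite !mxE (negbTE ab) mulr0n !mulr0.
  rewrite M_axis_newton; apply: eq_bigr => j _.
  rewrite /ffactmx !evec2; move: (dminus _ _ _ _) => p; rewrite !mxE eqxx mulr1n -bin_ffact natrM.
  have f0 : (j `!)%:R != 0 :> C by rewrite pnatr_eq0 -lt0n fact_gt0.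
  by field.
apply: smooth_comb_sum => j _; apply: smooth_combZ.
  by apply: csmoothZ; apply: msmooth_dminus.
apply: smooth_comb_mono (ffactmx_comb j); exact: ltn_ord.
Qed.

Hypothesis M_equiv : forall k : 'M[R]_3, SO3 k -> exists2 S : mat, S \is a GRing.unit &
  forall x, S * M x = M (k *m x) * S /\ S * Amx T x = Amx T (k *m x) * S.

(** On the axis the coefficients can be replaced by their even parts, which are smooth functions of
|x|; the expansion is then moved to x by a rotation. *)
Lemma M_comb : smooth_comb powers (fun=> True) N M.
Proof.
have [g sg Eg] := M_axis_comb.
pose e3 : R3 := evec 2%:R.
exists (fun i x => (g i (Num.sqrt (sqnorm x) *: e3) + g i (- Num.sqrt (sqnorm x) *: e3)) / 2).
  by move=> i; apply: csmooth_even_radial.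
have powS (S : mat) x y i : S * Amx T x = Amx T y * S -> S * powers i x = powers i y * S.
  move=> E; rewrite /powers; elim: i => [|i IH]; first by rewrite !expr0 mulr1 mul1r.
  by rewrite !exprS mulrA E -mulrA IH mulrA.
have trans (S : mat) x y (a : nat -> C) : S \is a GRing.unit ->
    S * M x = M y * S -> S * Amx T x = Amx T y * S ->
    M x = \sum_(i < N) a i *: powers i x -> M y = \sum_(i < N) a i *: powers i y.
  move=> uS EM EA Ex; apply: (mulIr uS); rewrite -EM Ex mulr_sumr mulr_suml.
  by apply: eq_bigr => i _; rewrite -scalerAr -scalerAl (powS _ _ _ _ EA).
have half (r : R) : M (r *: e3) =
    \sum_(i < N) ((g i (r *: e3) + g i (- r *: e3)) / 2) *: powers i (r *: e3).
  have E1 : M (r *: e3) = \sum_(i < N) g i (r *: e3) *: powers i (r *: e3) by apply: Eg; exists r.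
  (* the rotation by pi about the first axis exchanges r e3 and - r e3 *)
  have E2 : M (r *: e3) = \sum_(i < N) g i (- r *: e3) *: powers i (r *: e3).
    have [S uS ES] := M_equiv SO3_flip; have [EM EA] := ES (- r *: e3).
    rewrite SO3_flip_axis opprK in EM EA.
    apply: (trans S (- r *: e3) (r *: e3) (fun i => g i (- r *: e3)) uS EM EA).
    by apply: Eg; exists (- r).
  have H : M (r *: e3) + M (r *: e3) = 2 *: M (r *: e3) by rewrite scaler_nat mulr2n.
  apply: (@scalerI _ _ (2 : C)); first by rewrite pnatr_eq0.
  rewrite -H {1}E1 {1}E2 -big_split scaler_sumr; apply: eq_bigr => i _ /=.
  by rewrite -scalerDl scalerA mulrC divfK // pnatr_eq0.
move=> x _; have [k hk Ex] := SO3_axis x.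
have [S uS ES] := M_equiv hk; have [EM EA] := ES (Num.sqrt (sqnorm x) *: e3).
rewrite -Ex in EM EA.
exact: (trans S _ x (fun i => (g i (Num.sqrt (sqnorm x) *: e3) +
   g i (- Num.sqrt (sqnorm x) *: e3)) / 2) uS EM EA (half _)).
Qed.

End Axis.

(** * The decomposition theorem for an abstract representation *)

Section EndSmooth.
Context {R : realType}.
Local Notation C := R[i].
Local Notation R3 := 'cV[R]_3.
Variables (V : vectType C) (n : nat) (X : n.+1.-tuple V).
Hypothesis X_basis : basis_of {:V} X.
Implicit Types (F : R3 -> 'End(V)).

Lemma msmooth_endmx F :
  (forall i j : 'I_(\dim {:V}), csmooth (fun x => coord (vbasis {:V}) i (F x (vbasis {:V})`_j))) ->
  msmooth (fun x => endmx X (F x)).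
Proof.
move=> sF i j; pose b (k : 'I_(\dim {:V})) := (vbasis {:V})`_k.
rewrite (_ : (fun _ => _) = fun x => \sum_k \sum_l (coord (vbasis {:V}) k X`_j * coord X i (b l)) *
    coord (vbasis {:V}) l (F x (b k))).
  by apply: csmooth_sum => k _; apply: csmooth_sum => l _; apply: csmoothZ; apply: sF.
apply: funext => x; rewrite mxE {1}(coord_vbasis (memvf X`_j)) !linear_sum.
apply: eq_bigr => k _; rewrite !linearZ /= {1}(coord_vbasis (memvf (F x _))) linear_sum mulr_sumr.
apply: eq_bigr => l _; rewrite linearZ /=; ring.
Qed.

(** The derivative defined in coordinates can be computed in any basis, for smooth functions. *)
Lemma vderive_endmx F i x : msmooth (fun x => endmx X (F x)) ->
  endmx X (vderive F (evec i) x) = mpart i (fun x => endmx X (F x)) x.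
Proof.
move=> sF; have cF b : csmooth (fun y => coord (vbasis {:'End(V)}) b (F y)).
  rewrite (_ : (fun _ => _) = fun y : R3 => \sum_(j < n.+1) \sum_(k < n.+1)
     coord (vbasis {:'End(V)}) b (rank1 X j X`_k) * endmx X (F y) k j).
    by apply: csmooth_sum => j _; apply: csmooth_sum => k _; apply: csmoothZ; apply: sF.
  apply: funext => y; rewrite {1}(endmx_decomp X_basis (F y)) linear_sum.
  by apply: eq_bigr => j _; rewrite linear_sum; apply: eq_bigr => k _; rewrite linearZ mulrC.
apply/matrixP => k l; rewrite [RHS]mxE /vderive linear_sum summxE.
rewrite (_ : (fun y => _) = fun y : R3 => \sum_(b < \dim {:'End(V)}) endmx X (vbasis {:'End(V)})`_b k l *
    coord (vbasis {:'End(V)}) b (F y)); last first.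
  apply: funext => y; rewrite {1}(coord_vbasis (memvf (F y))) linear_sum summxE.
  by apply: eq_bigr => b _; rewrite linearZ /= mxE mulrC.
rewrite cpartial_sum => [|b]; last exact: csmoothZ.
by apply: eq_bigr => b _; rewrite cpartialZ // linearZ /= [LHS]mxE mulrC.
Qed.
End EndSmooth.

Section AbstractTheorem.
Context {R : realType}.
Local Notation C := R[i].
Local Notation R3 := 'cV[R]_3.
Variables (V : vectType C) (m : nat) (T : 'I_3 -> 'End(V)).

Definition genA (x : R3) : 'End(V) := \sum_i (x i 0)%:C%C *: T i.

Definition genD (F : R3 -> 'End(V)) (x : R3) : 'End(V) :=
  \sum_i (T i \o vderive F (evec i) x)%VF.

(** The recursion of Q for an arbitrary family T in place of the derived representation. *)
Fixpoint genQ (j : nat) : R3 -> 'End(V) :=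
  match j with
  | 0 => fun=> \1%VF
  | j'.+1 =>
    match j' with
    | 0 => genA
    | _ => fun x => (genA x \o genQ j' x)%VF
             - (sqnorm x / (2 * j' + 1)%N%:R)%:C%C *: genD (genQ j') x
    end
  end.

Variables (v0 : V) (U : 'M[R]_3 -> 'End(V)).
Hypothesis T01 : forall v, T 0 (T 1 v) - T 1 (T 0 v) = - T 2%:R v.
Hypothesis T12 : forall v, T 1 (T 2%:R v) - T 2%:R (T 1 v) = - T 0 v.
Hypothesis T20 : forall v, T 2%:R (T 0 v) - T 0 (T 2%:R v) = - T 1 v.
Hypothesis v0_neq0 : v0 != 0.
Hypothesis T2v0 : T 2%:R v0 = ('i%C * m%:R) *: v0.
Hypothesis Jpv0 : T 1 v0 - 'i%C *: T 0 v0 = 0.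
Hypothesis dimV : (\dim {:V} <= (2 * m).+1)%N.
Hypothesis U_inj : forall k, SO3 k -> lker (U k) == 0%VS.
Hypothesis U_1 : U 1%:M = \1%VF.
Hypothesis U_A : forall k x v, SO3 k -> U k (genA x v) = genA (k *m x) (U k v).
Hypothesis U_der : forall i, sepder (fun t => U (rotc i t)) (T i).

Variable F : R3 -> 'End(V).
Hypothesis F_smooth : forall i j : 'I_(\dim {:V}),
  csmooth (fun x => coord (vbasis {:V}) i (F x (vbasis {:V})`_j)).
Hypothesis F_equiv : forall k x, SO3 k -> F (k *m x) = (U k \o F x \o (U k)^-1)%VF.

Lemma F_intertwine k x : SO3 k -> (F (k *m x) \o U k)%VF = (U k \o F x)%VF.
Proof.
move=> hk; apply/lfunP => v; rewrite F_equiv // !comp_lfunE.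
by rewrite (lker0_lfunK (U_inj hk)).
Qed.

Lemma is_derive_rotc_vec i (x : R3) a :
  is_derive (0 : R) (1 : R) (fun t => (rotc i t *m x) a 0) ((so3Y i *m x) a 0).
Proof.
rewrite (_ : (fun t => _) = (x 0 0 \*: (fun t => rotc i t a 0)) +
   (x 1 0 \*: (fun t => rotc i t a 1)) + (x 2%:R 0 \*: (fun t => rotc i t a 2%:R))).
  rewrite mxE sum3 ![so3Y i a _ * _]mulrC.
  by apply: is_deriveD; [apply: is_deriveD|]; apply: is_deriveZ; apply: is_derive_rotc.
apply: funext => t; rewrite mxE sum3 /GRing.scale /=.
by rewrite ![rotc i t a _ * _]mulrC.
Qed.

(** Passing to matrices in the weight basis, the expansion [M_comb] of F in powers of Q_1 is
converted by [smooth_comb_powers_Qmx]. *)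
Theorem equivariant_decomposition : exists g : 'I_(2 * m).+1 -> R3 -> C,
  (forall k, csmooth (g k)) /\ forall x, F x = \sum_k g k x *: genQ k x.
Proof.
have [X [XP [C01 C12 C20] T2d Jsh [c cas]]] :=
  ladder_matrices T01 T12 T20 v0_neq0 T2v0 Jpv0 dimV.
pose TT i := endmx X (T i); pose M x := endmx X (F x).
have sM : msmooth M by apply: msmooth_endmx.
have EA x : endmx X (genA x) = Amx TT x.
  by rewrite /genA linear_sum; apply: eq_bigr => i _; rewrite linearZ.
have EQ j x : endmx X (genQ j x) = Qmx TT j x.
  elim: j x => [|j IH] x; first exact: endmx1.
  case: j IH => [|j] IH; first exact: EA.
  have IH' : (fun y => endmx X (genQ j.+1 y)) = Qmx TT j.+1 by apply: funext.
  have sQ : msmooth (fun y => endmx X (genQ j.+1 y)).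
    have [G fG EG] := @Qmx_lead R (2 * m) TT c C01 C12 C20 cas j.
    rewrite IH'; apply: (@msmooth_ext _ _ (fun y => Amx TT y ^+ j.+1 + (sqnorm y)%:C%C *: G y)) => //.
    apply: msmoothD; first exact: filt_msmooth (filt_pow TT j.+1).
    by apply: msmoothZ; [exact: csmooth_sqnorm | exact: filt_msmooth fG].
  rewrite [genQ _]/= [Qmx _ _]/= -/(genQ j.+1) -/(Qmx TT j.+1) linearB linearZ /=.
  rewrite (endmx_comp XP) EA IH; congr (_ - _ *: _).
  rewrite /genD linear_sum; apply: eq_bigr => i _ /=.
  rewrite -/(genQ j.+1) -/(Qmx TT j.+1).
  by rewrite (endmx_comp XP) (vderive_endmx XP) // IH'.
(* differentiate F (k x) U(k) = U(k) F x along k = exp (t Y_i) *)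
have Minf i x : \sum_a ((so3Y i *m x) a 0)%:C%C *: mpart a M x = TT i * M x - M x * TT i.
  pose S t := endmx X (U (rotc i t)).
  have S0 : S 0 = 1 by rewrite /S rotc0 U_1 endmx1.
  have MS t : M (rotc i t *m x) * S t = S t * M x.
    by rewrite -!(endmx_comp XP) F_intertwine //; apply: SO3_rotc.
  have DS a b : is_cderive (0 : R) (1 : R) (fun t => S t a b) (TT i a b).
    apply: (sepder_scalar (f := fun f => endmx X f a b) _ (U_der i)) => d f g.
    by rewrite linearP !mxE.
  apply/matrixP => a b.
  have DM l : is_cderive (0 : R) (1 : R) (fun t => M (rotc i t *m x) a l)
      (\sum_j ((so3Y i *m x) j 0)%:C%C * cpartial j (fun y => M y a l) x).
    have := is_cderive_curve (sM a l) (is_derive_rotc_vec i x).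
    by rewrite rotc0 mul1mx.
  have DL := is_cderive_sum (index_enum 'I_(2 * m).+1) (P := predT)
     (fun l _ => is_cderiveM (DM l) (DS l b)).
  have DR := is_cderive_sum (index_enum 'I_(2 * m).+1) (P := predT)
     (fun l _ => is_cderiveM (DS a l) (is_cderive_cst (0 : R) (1 : R) (M x l b))).
  have EF : (fun t => \sum_l M (rotc i t *m x) a l * S t l b) = (fun t => \sum_l S t a l * M x l b).
    by apply: funext => t; have /matrixP/(_ a b) := MS t; rewrite !mxE.
  rewrite EF in DL; have := is_cderive_unique DL DR.
  rewrite rotc0 mul1mx S0 !big_split /= => E.
  rewrite summxE.
  have E1 : \sum_l (\sum_j ((so3Y i *m x) j 0)%:C%C * cpartial j (fun y => M y a l) x) * (1 : 'M[C]_((2 * m).+1)) l b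
     = \sum_j (((so3Y i *m x) j 0)%:C%C *: mpart j M x) a b.
    rewrite [LHS](bigD1 b) //= [X in _ + X = _]big1 ?addr0 => [|l lb]; last by rewrite mxE (negbTE lb) mulr0.
    rewrite mxE eqxx mulr1; apply: eq_bigr => j _; by rewrite !mxE.
  rewrite -E1; move: E; rewrite [X in _ = _ + X]big1 ?addr0 => [|l _]; last by rewrite mulr0.
  by move=> /(canRL (addrK _)) ->; rewrite !mxE.
have Meq k : SO3 k -> exists2 S : 'M[C]_((2 * m).+1), S \is a GRing.unit &
    forall x, S * M x = M (k *m x) * S /\ S * Amx TT x = Amx TT (k *m x) * S.
  move=> hk; exists (endmx X (U k)).
    apply/unitrP; exists (endmx X (U k)^-1%VF).
    by rewrite -!(endmx_comp XP) lker0_compVf ?lker0_compfV ?U_inj // endmx1.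
  move=> x; split; first by rewrite -!(endmx_comp XP) F_intertwine.
  rewrite -!EA -!(endmx_comp XP); congr endmx.
  by apply/lfunP => v; rewrite !comp_lfunE U_A.
have [g sg Eg] := @smooth_comb_powers_Qmx R (2 * m) TT c C01 C12 C20 cas _ _
  (@M_comb R m TT M T2d Jsh sM Minf Meq).
exists (fun k => g k); split=> [k|x]; first exact: sg.
apply: (endmx_inj XP); rewrite -/(M x) Eg // linear_sum.
by apply: eq_bigr => k _; rewrite linearZ /= EQ.
Qed.
End AbstractTheorem.

(** * The representation on harmonic polynomials *)

Section Instance.
Context {R : realType}.
Local Notation C := R[i].
Variable m : nat.
Local Notation V := (subvs_of (@harm R m)).

Lemma so3Y_comm : [/\ so3Y 0 *m so3Y 1 - so3Y 1 *m so3Y 0 = (-1) *: so3Y 2%:R :> 'M[R]_3,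
  so3Y 1 *m so3Y 2%:R - so3Y 2%:R *m so3Y 1 = (-1) *: so3Y 0 :> 'M[R]_3 &
  so3Y 2%:R *m so3Y 0 - so3Y 0 *m so3Y 2%:R = (-1) *: so3Y 1 :> 'M[R]_3].
Proof.
by split; apply: matrix3P; split; rewrite !so3YE /mx3 !(mxE, sum3) /=; ring.
Qed.

Lemma Top_commN i j k (v : V) :
  so3Y i *m so3Y j - so3Y j *m so3Y i = (-1) *: so3Y k :> 'M[R]_3 ->
  @Top R m i (@Top R m j v) - @Top R m j (@Top R m i v) = - @Top R m k v.
Proof. by move=> /(Top_comm v) ->; rewrite rmorphN1 scaleN1r. Qed.

Lemma hwvec_neq0 : @hwvec R m != 0 :> V.
Proof.
apply/eqP => /(congr1 (@pval R m)); rewrite pval_hwvec => E.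
by have := hwpoly_neq0 (R := R) m; rewrite E linear0 eqxx.
Qed.

Lemma Top_hw : @Top R m 2%:R (@hwvec R m) = ('i%C * m%:R) *: @hwvec R m :> V.
Proof.
apply: pval_inj; apply: etrans (pval_Top 2%:R (@hwvec R m)) _.
have -> : pval (('i%C * m%:R) *: @hwvec R m) = ('i%C * m%:R) *: pval (@hwvec R m : V).
  exact: linearZ.
rewrite pval_hwvec; apply: lie_hwpoly_weight; by rewrite so3YE !mxE.
Qed.

Lemma Top_hw_raise : @Top R m 1 (@hwvec R m) - 'i%C *: @Top R m 0 (@hwvec R m) = 0 :> V.
Proof.
apply: pval_inj.
have -> : pval (@Top R m 1 (@hwvec R m) - 'i%C *: @Top R m 0 (@hwvec R m) : V) =
    pval (@Top R m 1 (@hwvec R m)) - 'i%C *: pval (@Top R m 0 (@hwvec R m)).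
  apply: etrans (linearB _ _ _) _; congr (_ - _); exact: linearZ.
apply: etrans (congr2 (fun p q => p - 'i%C *: q) (pval_Top 1 (@hwvec R m)) (pval_Top 0 (@hwvec R m))) _.
rewrite pval_hwvec linear0; apply: lie_hwpoly_raise; rewrite ?so3YE ?mxE //.
  by elim/ord3P; rewrite ?so3YE ?mxE.
by elim/ord3P; rewrite ?so3YE ?mxE.
Qed.

Lemma tauop1 : @tauop R m 1%:M = \1%VF.
Proof.
apply/lfunP => v; apply: pval_inj; rewrite id_lfunE.
apply: etrans (pval_tauop v SO3_1) _; exact: rot_id.
Qed.

Lemma genA_Aop x : genA (@Top R m) x = Aop m x.
Proof. by rewrite AopE. Qed.

Lemma Q_genQ j : @Q R m j = genQ (@Top R m) j.
Proof.
have -> : @Top R m = fun i => @dtau R m (so3Y i) by apply: funext => i; exact: TopE.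
elim: j => [|j IH].
  exact: erefl.
case: j IH => [|j] IH.
  exact: erefl.
have E : @Q R m j.+2 = fun x => (dtauR3 m x \o @Q R m j.+1 x)%VF
   - (sqnorm x / (2 * j.+1 + 1)%N%:R)%:C%C *: Dtau (@Q R m j.+1) x.
  exact: erefl.
apply: etrans E _.
apply: (etrans (f_equal (fun (P : 'cV[R]_3 -> 'End(V)) x => (dtauR3 m x \o P x)%VF
   - (sqnorm x / (2 * j.+1 + 1)%N%:R)%:C%C *: Dtau P x) IH)).
exact: erefl.
Qed.

Lemma sepder_tauop i : sepder (fun t : R => @tauop R m (rotc i t)) (@Top R m i).
Proof.
rewrite TopE; apply: sepder_eq (dtau_sepder m i) => // t.
by rewrite tauopE.
Qed.

End Instance.

Unset Implicit Arguments.

Theorem corollary3 (R : realType) (m : nat)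
    (F : 'cV[R]_3 -> 'End(subvs_of (@harm R m)))
    (F_schwartz : schwartzEnd F)
    (F_equiv : forall (k : 'M[R]_3) (x : 'cV[R]_3), SO3 k ->
       F (k *m x) = (tau m k \o F x \o (tau m k)^-1)%VF) :
  exists g : 'I_(2 * m).+1 -> 'cV[R]_3 -> R[i],
    (forall k, csmooth (g k)) /\
    (forall x, F x = \sum_k g k x *: Q m k x).
Proof.
have [C01 C12 C20] := @so3Y_comm R.
have sF (i j : 'I_(\dim {:subvs_of (@harm R m)})) : csmooth (fun x => coord (vbasis {:subvs_of (@harm R m)}) i
    (F x (vbasis {:subvs_of (@harm R m)})`_j)).
  by have [[s1 _] [s2 _]] := F_schwartz i j; split.
have UA k x v : SO3 k -> @tauop R m k (genA (@Top R m) x v) = genA (@Top R m) (k *m x) (@tauop R m k v).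
  by move=> hk; rewrite !genA_Aop; apply: tauop_Aop.
have FE k x : SO3 k -> F (k *m x) = (@tauop R m k \o F x \o (@tauop R m k)^-1)%VF.
  by move=> hk; rewrite tauopE; apply: F_equiv.
have [g [sg Eg]] := equivariant_decomposition (fun v => Top_commN v C01)
  (fun v => Top_commN v C12) (fun v => Top_commN v C20) (@hwvec_neq0 R m) (@Top_hw R m)
  (@Top_hw_raise R m) (@dim_V R m) (@tauop_inj R m) (@tauop1 R m) UA (@sepder_tauop R m) sF FE.
exists g; split=> // x; rewrite Eg; apply: eq_bigr => k _.
by rewrite Q_genQ.
Qed.
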